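(* Let $\mu_n,\mu\in\mathcal M_+^0([0,\tau])$ ($n\in\mathbb N$) and assume that $\mu_n\rightharpoonup\mu$ narrowly on $[0,\tau]$. Let $u_n:=u_{\mu_n}$ and $u:=u_\mu$ be the weak solutions of the delay problem with kernels $\mu_n$ and $\mu$, respectively, and with common data $u_0\in H$, $f\in L^2(0,T;V^* )$, $\psi\in L^2(-\tau,0;V)$. Then $$u_n\longrightarrow u\quad\text{in }\mathcal W(0,T)\cap\mathcal C([0,T];H).$$
   Context: Fix real numbers $T>0$ and $\tau>0$. $V,H$ are real separable Hilbert spaces with $V\hookrightarrow H$ continuously and densely; $H$ is identified with its dual, giving the Gelfand triple $V\hookrightarrow H\cong H^*\hookrightarrow V^*$, and $\langle\cdot,\cdot\rangle$ is the duality pairing between $V^*$ and $V$. $a_0,a_1:V\times V\to\mathbb R$ are bilinear forms and $\Lambda_0,\Lambda_1,\alpha_0>0$ are constants with $|a_i(w,v)|\le\Lambda_i\|w\|_V\|v\|_V$ for all $w,v\in V$, $i\in\{0,1\}$, and $a_0(v,v)\ge\alpha_0\|v\|_V^2$ for all $v\in V$. The operators $A_i\in\mathcal L(V,V^* )$ are given by $\langle A_iw,v\rangle=a_i(w,v)$. $\mathcal M_+([0,\tau])$ is the set of finite non-negative Borel measures on $[0,\tau]$, and $\mathcal M_+^0([0,\tau])=\{\sigma\in\mathcal M_+([0,\tau]):\sigma(\{0\})=0\}$. Narrow convergence $\mu_n\rightharpoonup\mu$ means $\int\varphi\,d\mu_n\to\int\varphi\,d\mu$ for every $\varphi\in\mathcal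 C([0,\tau])$. For a finite Borel measure $\sigma$ on $[0,\tau]$ and $g\in L^2(-\tau,T;V)$, $\mathcal K_\sigma g\in L^2(0,T;V^* )$ is defined by $(\mathcal K_\sigma g)(t)=\int_{[0,\tau]}A_1g(t-s)\,d\sigma(s)$ for a.e. $t\in(0,T)$ (Bochner integral, using any Borel strongly measurable representative of $g$; the resulting element of $L^2(0,T;V^* )$ does not depend on the representative). $\mathcal W(0,T)=\{u\in L^2(0,T;V):\partial_tu\in L^2(0,T;V^* )\}$ with norm $\|u\|_{\mathcal W(0,T)}=\bigl(\|u\|_{L^2(0,T;V)}^2+\|\partial_tu\|_{L^2(0,T;V^* )}^2\bigr)^{1/2}$; it embeds into $\mathcal C([0,T];H)$, and pointwise values refer to the $H$-continuous representative. For $u:(0,T)\to V$ the joined trajectory is $\tilde u(t)=\psi(t)$ for $-\tau<t<0$ and $\tilde u(t)=u(t)$ for $0<t<T$. For $\mu\in\mathcal M_+^0([0,\tau])$, the weak solution $u_\mu$ of the delay problem with kernel $\mu$ and data $(u_0,f,\psi)$ is the (unique) $u\in\mathcal W(0,T)$ with $u(0)=u_0$ in $H$ and $\partial_tu(t)+A_0u(t)+(\mathcal K_\mu\tilde u)(t)=f(t)$ in $V^*$ for a.e. $t\in(0,T)$. *)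

(* Defs.v *)
From HB Require Import structures.
From mathcomp Require Import all_boot all_order all_algebra.
From mathcomp Require Import all_classical all_reals all_analysis.
From mathcomp Require Import ring.

Set Implicit Arguments.
Unset Strict Implicit.
Unset Printing Implicit Defensive.

Import Order.TTheory GRing.Theory Num.Theory.
Import numFieldNormedType.Exports.

Local Open Scope classical_set_scope.
Local Open Scope ring_scope.

HB.mixin Record isHilbert (R : realType) V & CompleteNormedModule R V := {
  dotv : {dot V for idfun} ;
  sqr_normv : forall v : V, `|v| ^+ 2 = dotv v v }.

#[short(type="hilbertType")]
HB.structure Definition Hilbert (R : realType) :=
  {V of isHilbert R V & CompleteNormedModule R V}.

Definition separable (T : topologicalType) : Prop :=
  exists2 A : set T, countable A & dense A.

Section Dual.
Context {R : realType} (V : normedModType R).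

Definition is_dual : {pred V -> R^o} :=
  fun f => `[< linear f /\ continuous f >].

Record dual := Dual { dual_fun :> V -> R^o ; dual_funP : dual_fun \in is_dual }.

HB.instance Definition _ := [isSub for dual_fun].
HB.instance Definition _ := [Choice of dual by <:].

Lemma is_dual_submod_closed : submod_closed is_dual.
Proof.
split=> [|k f g].
  apply/asboolP; split; last exact: cst_continuous.
  by move=> k x y /=; rewrite scaler0 addr0.
rewrite !unfold_in => /asboolP[lf cf] /asboolP[lg cg]; apply/asboolP; split.
  move=> a x y; rewrite !fctE lf lg !scalerDr !scalerA [k * a]mulrC.
  by rewrite addrACA.
move=> x; apply: (@continuousD _ _ _ (k \*: f) g); last exact: cg.
by apply: continuousZr; exact: cf.
Qed.

HB.instance Definition _ :=
  GRing.isSubmodClosed.Build R _ is_dual is_dual_submod_closed.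
HB.instance Definition _ := [SubChoice_isSubLmodule of dual by <:].

Lemma dual_linear (f : dual) : linear f.
Proof. by have /asboolP[] := dual_funP f. Qed.

Lemma dual_continuous (f : dual) : continuous f.
Proof. by have /asboolP[] := dual_funP f. Qed.

HB.instance Definition _ (f : dual) :=
  GRing.isLinear.Build R V R^o *:%R f (dual_linear f).

Definition dual_norm (f : dual) : R := sup [set `|f x| | x in [set x | `|x| <= 1]].

Lemma dual_norm_has_sup (f : dual) :
  has_sup [set `|f x| | x in [set x | `|x| <= 1]].
Proof.
split; first by exists `|f 0|; exists 0 => //=; rewrite normr0.
have /linear_boundedP : bounded_near f (nbhs (0 : V)).
  by apply: continuous_linear_bounded; exact: dual_continuous.
case=> y [yreal fr]; exists (`|y| + 1) => _ [x /= x1 <-].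
have /= := fr (`|y| + 1) _ x; rewrite (le_lt_trans (ler_norm y)) ?ltrDl//.
by move=> /(_ isT)/le_trans; apply; rewrite ler_piMr.
Qed.

Lemma le_dual_norm (f : dual) (x : V) : `|f x| <= dual_norm f * `|x|.
Proof.
have [->|x0] := eqVneq x 0; first by rewrite linear0 !normr0 mulr0.
rewrite -ler_pdivrMr ?normr_gt0//.
apply: (sup_upper_bound (dual_norm_has_sup f)); exists (`|x|^-1 *: x) => /=.
  by rewrite normrZ normfV normr_id mulVf ?normr_eq0.
by rewrite linearZ/= normrZ normfV normr_id mulrC.
Qed.

Lemma dual_normD (f g : dual) : dual_norm (f + g) <= dual_norm f + dual_norm g.
Proof.
apply: ge_sup; first exact: (dual_norm_has_sup _).1.
move=> _ [x /= x1 <-]; rewrite (le_trans (ler_normD _ _))//.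
by apply: lerD; (apply: sup_upper_bound; first exact: dual_norm_has_sup);
  exists x.
Qed.

Lemma dual_normZ (k : R) (f : dual) : dual_norm (k *: f) = `|k| * dual_norm f.
Proof.
have le l (g : dual) : dual_norm (l *: g) <= `|l| * dual_norm g.
  apply: ge_sup; first exact: (dual_norm_has_sup _).1.
  move=> _ [x /= x1 <-]; rewrite [leLHS]normrZ ler_wpM2l//.
  by apply: sup_upper_bound; [exact: dual_norm_has_sup | exists x].
have ge0 (g : dual) : 0 <= dual_norm g.
  apply: (le_trans (normr_ge0 (g 0))).
  apply: sup_upper_bound; first exact: dual_norm_has_sup.
  by exists 0; rewrite //= normr0.
have [k0|k0] := eqVneq k 0.
  have := le k f; rewrite k0 normr0 mul0r => le0.
  by apply/eqP; rewrite eq_le le0 ge0.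
apply/eqP; rewrite eq_le le/= -ler_pdivlMl ?normr_gt0//.
by rewrite -{1}[f](scalerK k0) -normfV le.
Qed.

Lemma dual_norm_eq0 (f : dual) : dual_norm f = 0 -> f = 0.
Proof.
move=> f0; apply/val_inj/funext => x /=; apply/normr0_eq0/eqP.
by rewrite eq_le normr_ge0 andbT (le_trans (le_dual_norm _ _))// f0 mul0r.
Qed.

HB.instance Definition _ :=
  @Lmodule_isNormed.Build R dual dual_norm dual_normD dual_normZ dual_norm_eq0.

End Dual.
Arguments dual {R} V.

Record gelfand_embedding (R : realType) (V H : hilbertType R) :=
  GelfandEmbedding {
    embed :> {linear V -> H} ;
    embed_continuous : continuous embed ;
    embed_inj : injective embed ;
    embed_dense : dense (range embed) }.

Section GelfandTriple.
Context {R : realType} {V H : hilbertType R} (j : gelfand_embedding V H).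

Lemma dotv_continuous (h : H) : continuous (fun k : H => dotv h k : R^o).
Proof.
have -> : (fun k : H => dotv h k : R^o) =
    fun k => (`|h + k| ^+ 2 - `|h - k| ^+ 2) / 4%:R.
  apply/funext => k; rewrite !sqr_normv.
  rewrite (hnormD dotv h k) (hnormB dotv h k) /=.
  by rewrite expr0 mul1r; field.
have sqr_cont (g : H -> H) : continuous g ->
    continuous (fun k => `|g k| ^+ 2 : R^o).
  move=> gc k; apply: (@continuousM _ _ (fun k => `|g k|) (fun k => `|g k|));
    by apply: continuous_comp; [exact: gc | exact: norm_continuous].
move=> k; apply: (@continuousM _ _ (fun k => `|h + k| ^+ 2 - `|h - k| ^+ 2)
  (fun=> 4%:R^-1)); last exact: cst_continuous.
apply: (@continuousB _ _ _ (fun k => `|h + k| ^+ 2 : R^o)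
  (fun k => `|h - k| ^+ 2 : R^o)); apply: sqr_cont => {}k.
  by apply: continuousD; [exact: cst_continuous | exact: cvg_id].
by apply: continuousB; [exact: cst_continuous | exact: cvg_id].
Qed.

Lemma gelfand_is_dual (h : H) : (fun v : V => dotv h (j v) : R^o) \in @is_dual R V.
Proof.
apply/asboolP; split.
  by move=> a x y; rewrite linearP (linearPr dotv h a).
by move=> v; apply: continuous_comp; [exact: embed_continuous
  | exact: dotv_continuous].
Qed.

(* H identified with its dual, and functionals on H restricted to V along j *)
Definition gelfand (h : H) : dual V := Dual (gelfand_is_dual h).

End GelfandTriple.

Section Bochner.
Context {d : measure_display} {T : measurableType d} {R : realType}.
Context {E : normedModType R}.

Definition simple_fun (s : T -> E) : Prop :=
  finite_set (range s) /\ forall y, measurable (s @^-1` [set y]).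

Definition strongly_measurable (D : set T) (f : T -> E) : Prop :=
  exists2 s : nat -> T -> E, forall n, simple_fun (s n) &
    forall x, D x -> s n x @[n --> \oo] --> f x.

Variable mu : {measure set T -> \bar R}.

Definition simple_integral (D : set T) (s : T -> E) : E :=
  \sum_(y \in range s) fine (mu (D `&` s @^-1` [set y])) *: y.

Definition is_bochner_integral (D : set T) (f : T -> E) (I : E) : Prop :=
  exists s : nat -> T -> E, [/\
    forall n, simple_fun (s n) /\ (\int[mu]_(x in D) (`|s n x|)%:E < +oo)%E,
    {ae mu, forall x, D x -> s n x @[n --> \oo] --> f x},
    (\int[mu]_(x in D) (`|f x - s n x|)%:E)%E @[n --> \oo] --> 0%E &
    simple_integral D (s n) @[n --> \oo] --> I].

(* 0 when f is not Bochner integrable on D *)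
Definition bochner_integral (D : set T) (f : T -> E) : E :=
  xget 0 [set I | is_bochner_integral D f I].

End Bochner.

(* Elements of L^2(a, b; E) are given by Borel strongly measurable
    representatives R -> E, whose values outside ]a, b[ are irrelevant. *)

Section L2.
Context {R : realType} {E : normedModType R}.
Local Open Scope ereal_scope.

Definition L2_norm (a b : R) (f : R -> E) : \bar R :=
  (\int[lebesgue_measure]_(t in `]a, b[) (`|f t| ^+ 2)%:E) `^ 2^-1.

Definition in_L2 (a b : R) (f : R -> E) : Prop :=
  strongly_measurable (`]a, b[ : set (measurableTypeR R)) f /\
  L2_norm a b f < +oo.

End L2.

Section W.
Context {R : realType} {V H : hilbertType R} (j : gelfand_embedding V H).
Variable T : R.

Definition test_function (phi : R -> R) : Prop :=
  (forall n x, derivable (derive1n n phi) x 1) /\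
  exists a b : R, [/\ 0 < a, b < T & forall x, x \notin `[a, b] -> phi x = 0].

Definition is_weak_derivative (u : R -> V) (g : R -> dual V) : Prop :=
  forall phi, test_function phi ->
    bochner_integral lebesgue_measure `]0, T[
      (fun t => derive1 phi t *: gelfand j (j (u t))) =
    - bochner_integral lebesgue_measure `]0, T[ (fun t => phi t *: g t).

Definition in_W (u : R -> V) : Prop :=
  in_L2 0 T u /\ exists2 g, in_L2 0 T g & is_weak_derivative u g.

(* a representative of the derivative of u in L^2(0, T; dual V) *)
Definition dt (u : R -> V) : R -> dual V :=
  xget (cst 0) [set g | in_L2 0 T g /\ is_weak_derivative u g].

Definition W_norm (u : R -> V) : \bar R :=
  ((L2_norm 0 T u ^+ 2 + L2_norm 0 T (dt u) ^+ 2) `^ 2^-1)%E.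

(* the H-continuous representative on [0, T] of u *)
Definition Crepr (u : R -> V) : R -> H :=
  xget (cst 0) [set w | {within `[0, T], continuous w} /\
    {ae lebesgue_measure, forall t, t \in `]0, T[ -> w t = j (u t)}].

End W.

Section Delay.
Context {R : realType}.
Implicit Types (tau T : R)
  (sigma : {finite_measure set (measurableTypeR R) -> \bar R}).

(* The measures on [0, tau] are the Borel measures on the line that are
   concentrated on [0, tau]. *)
Definition Mplus0 tau sigma : Prop :=
  sigma (~` `[0, tau]) = 0%E /\ sigma [set 0] = 0%E.

Definition narrow_cvg tau
    (mun : nat -> {finite_measure set (measurableTypeR R) -> \bar R})
    (mu : {finite_measure set (measurableTypeR R) -> \bar R}) : Prop :=
  forall phi : R -> R, {within `[0, tau], continuous phi} ->
    \int[mun n]_(s in `[0, tau]) phi s @[n --> \oo] -->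
    \int[mu]_(s in `[0, tau]) phi s.

Definition delay_op {V : hilbertType R} (A1 : V -> dual V) tau sigma
    (g : R -> V) (t : R) : dual V :=
  bochner_integral sigma `[0, tau] (fun s => A1 (g (t - s))).

Definition joined {V : hilbertType R} (psi u : R -> V) (t : R) : V :=
  if t < 0 then psi t else u t.

Definition weak_solution {V H : hilbertType R} (j : gelfand_embedding V H)
    (A0 A1 : V -> dual V) T tau sigma (u0 : H) (f : R -> dual V)
    (psi u : R -> V) : Prop :=
  [/\ in_W j T u, Crepr j T u 0 = u0 &
    {ae lebesgue_measure, forall t, t \in `]0, T[ ->
      dt j T u t + A0 (u t) + delay_op A1 tau sigma (joined psi u) t = f t}].

End Delay.

(* Main.v *)
(* The difference w = u_n - u solves the delay equation with kernel mu_n, zero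
   data and right-hand side (K_mu - K_{mu_n}) applied to the joined trajectory
   of u.  This right-hand side tends to 0 in L^2(0, T; dual V): by density it is
   enough to check it on phi *: v with phi continuous and compactly supported,
   where narrow convergence applies pointwise in t.

   Since mu({0}) = 0, narrow convergence yields a d > 0 with mu_n([0, d]) as
   small as desired for all large n.  In the energy identity for w, the delays
   in [0, d] are absorbed by the coercivity, and the remaining ones only see w
   on (0, t - d).  Hence the squared L^2(V) norm of w on (0, t) is at most a
   constant times its value on (0, t - d) plus the squared norm of the
   right-hand side, and finitely many steps of length d cover (0, T).

   The energy identity |w(t)|_H^2 - |w(s)|_H^2 = 2 int_s^t <w', w> is obtained
   without regularising w: the weak derivative gives the increment
   w(r + h) - w(r) as the integral of w', so that
   |w(r + h)|^2 - |w(r)|^2 = int_r^{r+h} <w', w(r + h) + w(r)>; divide by h and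
   use the continuity of translations in L^2 and Lebesgue points. *)

Require Import Defs.
From HB Require Import structures.
From mathcomp Require Import all_boot all_order all_algebra.
From mathcomp Require Import all_classical all_reals all_analysis.
From mathcomp Require Import measurable_realfun.
From mathcomp Require Import ring lra.

Set Implicit Arguments.
Unset Strict Implicit.
Unset Printing Implicit Defensive.

Import Order.TTheory GRing.Theory Num.Theory.
Import numFieldNormedType.Exports.

Local Open Scope classical_set_scope.
Local Open Scope ring_scope.

(** * Strong measurability and integrals with values in the dual *)

Section StrongMeasurability.
Import HBSimple.
Context {d} {T : measurableType d} {R : realType}.
Implicit Types (D A : set T) (E F : normedModType R).

(** The Bochner integral, [dt] and [Crepr] are choices with a default value, so that each must first
    be shown to exist. Integrals with values in the dual are built as weak integrals, and later
    identities are tested on vectors of [V]. Separability of [V] makes the exceptional null set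
    independent of the test vector, which permits test vectors that depend on time, such as
    [u (r + h) + u r]. The energy identity holds at first only for times outside a null set. It
    gives a modulus of continuity for [j (u t)], hence a continuous representative, and continuity
    then carries the identity to all of [[0, T]]. Functions are extended by zero to the line, where
    translations and delays act on a single space. The kernels may have atoms, so these extensions
    must agree with the joined trajectory at every relevant time, the origin included, and not only
    almost everywhere. Bounds are kept squared and expressed by real majorants. The bound on the
    derivative is read off the equation once [w] is controlled. *)

Lemma simple_fun_comp {E F} (phi : E -> F) (s : T -> E) :
  simple_fun s -> simple_fun (phi \o s).
Proof.
move=> [fs ms]; split; first by rewrite -(image_comp s phi); exact: finite_image.
move=> y; have -> : (phi \o s) @^-1` [set y] =
    \bigcup_(z in range s `&` phi @^-1` [set y]) (s @^-1` [set z]).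
  apply/seteqP; split=> [x /= xy|x [z /= [_ zy]] xz]; last by rewrite /= xz.
  by exists (s x) => //; split => //; exists x.
by apply: fin_bigcup_measurable => [|z _]; [exact: finite_setIl|exact: ms].
Qed.

Lemma simple_fun_pair {E F} (s : T -> E) (r : T -> F) :
  simple_fun s -> simple_fun r -> simple_fun (fun x => (s x, r x)).
Proof.
move=> [fs ms] [fr mr]; split.
  apply: (@sub_finite_set _ _ (range s `*` range r)); last exact: finite_setX.
  by move=> _ [x _ <-]; split; exists x.
case=> y z; have -> : (fun x => (s x, r x)) @^-1` [set (y, z)] =
    s @^-1` [set y] `&` r @^-1` [set z].
  by apply/seteqP; split=> x /= [-> ->].
exact: measurableI.
Qed.

Lemma simple_fun_cst {E} (c : E) : simple_fun (fun _ : T => c).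
Proof.
split; first by apply: (@sub_finite_set _ _ [set c]) => // _ [x _ <-].
by move=> y; rewrite preimage_cst; case: ifP.
Qed.

Lemma simple_fun_if {E} A (s r : T -> E) : measurable A ->
  simple_fun s -> simple_fun r -> simple_fun (fun x => if x \in A then s x else r x).
Proof.
move=> mA [fs ms] [fr mr]; split.
  apply: (@sub_finite_set _ _ (range s `|` range r)).
    by move=> _ [x _ <-]; case: ifP => _; [left|right]; exists x.
  by rewrite finite_setU.
move=> y; have -> : (fun x => if x \in A then s x else r x) @^-1` [set y] =
    (A `&` s @^-1` [set y]) `|` (~` A `&` r @^-1` [set y]).
  apply/seteqP; split=> x /=.
    by case: ifPn => [/set_mem|/negP xA ?]; [left|right; split=> // /mem_set].
  by move=> [[/mem_set -> //]|[xA ry]]; rewrite ifN//; apply/negP => /set_mem.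
by apply: measurableU; apply: measurableI => //; exact: measurableC.
Qed.

Lemma simple_fun_measurable D (s : T -> R^o) :
  simple_fun s -> measurable_fun D (s : T -> R).
Proof.
move=> [fs ms] mD Y mY; apply: measurableI => //.
have -> : s @^-1` Y = \bigcup_(z in range s `&` Y) (s @^-1` [set z]).
  apply/seteqP; split=> [x /= xY|x [z /= [_ zY]] xz]; last by rewrite /= xz.
  by exists (s x) => //; split => //; exists x.
by apply: fin_bigcup_measurable => [|z _]; [exact: finite_setIl|exact: ms].
Qed.

Lemma strongly_measurable_comp {E F} D (phi : E -> F) (f : T -> E) :
  continuous phi -> strongly_measurable D f -> strongly_measurable D (phi \o f).
Proof.
move=> cphi [s ss sf]; exists (fun n => phi \o s n) => [n|x Dx].
  exact: simple_fun_comp.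
by apply: continuous_cvg; [exact: cphi|exact: sf].
Qed.

Lemma strongly_measurable_pair {E F} D (f : T -> E) (g : T -> F) :
  strongly_measurable D f -> strongly_measurable D g ->
  strongly_measurable D (fun x => (f x, g x)).
Proof.
move=> [s ss sf] [r sr rg]; exists (fun n x => (s n x, r n x)) => [n|x Dx].
  exact: simple_fun_pair.
by apply: cvg_pair; [exact: sf|exact: rg].
Qed.

Lemma strongly_measurable_comp2 {E F} {G : normedModType R} D
    (phi : E * F -> G) (f : T -> E) (g : T -> F) : continuous phi ->
  strongly_measurable D f -> strongly_measurable D g ->
  strongly_measurable D (fun x => phi (f x, g x)).
Proof.
move=> cphi mf mg.
exact: (strongly_measurable_comp cphi (strongly_measurable_pair mf mg)).
Qed.

Lemma strongly_measurableD {E} D (f g : T -> E) :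
  strongly_measurable D f -> strongly_measurable D g ->
  strongly_measurable D (fun x => f x + g x).
Proof.
apply: (strongly_measurable_comp2 (phi := fun z => z.1 + z.2)) => z.
exact: add_continuous.
Qed.

Lemma strongly_measurableN {E} D (f : T -> E) :
  strongly_measurable D f -> strongly_measurable D (fun x => - f x).
Proof.
by apply: (strongly_measurable_comp (phi := fun z => - z)); exact: opp_continuous.
Qed.

Lemma strongly_measurableB {E} D (f g : T -> E) :
  strongly_measurable D f -> strongly_measurable D g ->
  strongly_measurable D (fun x => f x - g x).
Proof.
by move=> mf mg; apply: strongly_measurableD => //; exact: strongly_measurableN.
Qed.

Lemma strongly_measurableZ {E} D (f : T -> R^o) (g : T -> E) :
  strongly_measurable D f -> strongly_measurable D g ->
  strongly_measurable D (fun x => f x *: g x).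
Proof.
apply: (strongly_measurable_comp2 (phi := fun z : R^o * E => z.1 *: z.2)) => z.
exact: scale_continuous.
Qed.

Lemma strongly_measurable_cst {E} D (c : E) :
  strongly_measurable D (fun _ : T => c).
Proof.
by exists (fun _ _ => c) => [n|x Dx]; [exact: simple_fun_cst|exact: cvg_cst].
Qed.

(** The bridge to measurability of real functions: norms and pairings become measurable by composing
    strongly measurable functions with continuous maps. *)
Lemma strongly_measurableP D (f : T -> R) : measurable D ->
  strongly_measurable D (f : T -> R^o) <-> measurable_fun D f.
Proof.
move=> mD; split=> [[s ss sf]|mf].
  apply: (measurable_fun_cvg (h := s)) => [n|x Dx]; last exact: sf.
  exact: simple_fun_measurable.
have [g gf] := approximation_sfun mD ((measurable_EFinP _ _).2 mf).
exists (fun n => g n) => [n|x Dx].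
  split; first exact: fimfunP.
  by move=> y; exact: measurable_funPTI.
exact: (fine_cvg (gf x Dx)).
Qed.

Lemma strongly_measurable_norm {E} D (f : T -> E) : measurable D ->
  strongly_measurable D f -> measurable_fun D (fun x => `|f x|).
Proof.
move=> mD mf; apply/strongly_measurableP => //.
apply: (strongly_measurable_comp (phi := fun z : E => `|z| : R^o)) => // z.
exact: norm_continuous.
Qed.

Lemma strongly_measurableS {E} D A (f : T -> E) : A `<=` D ->
  strongly_measurable D f -> strongly_measurable A f.
Proof. by move=> AD [s ss sf]; exists s => // x /AD; exact: sf. Qed.

Lemma strongly_measurable_if {E} D A (f g : T -> E) : measurable A ->
  strongly_measurable (D `&` A) f -> strongly_measurable (D `\` A) g ->
  strongly_measurable D (fun x => if x \in A then f x else g x).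
Proof.
move=> mA [s ss sf] [r sr rg].
exists (fun n x => if x \in A then s n x else r n x) => [n|x Dx].
  exact: simple_fun_if.
case: ifPn => [/set_mem xA|/negP xA]; first by apply: sf.
by apply: rg; split => // /mem_set.
Qed.

(** Zero extension lets functions given on an interval be translated and convolved on the whole
    line. *)
Definition zext {E} D (f : T -> E) (x : T) : E := if x \in D then f x else 0.

Lemma zextE {E} D (f : T -> E) x : D x -> zext D f x = f x.
Proof. by move=> Dx; rewrite /zext mem_set. Qed.

Lemma zext0 {E} D (f : T -> E) x : ~ D x -> zext D f x = 0.
Proof. by move=> Dx; rewrite /zext memNset. Qed.

Lemma zextB {E} D (f g : T -> E) x :
  zext D (fun x => f x - g x) x = zext D f x - zext D g x.
Proof. by rewrite /zext; case: ifP => //; rewrite subr0. Qed.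

Lemma strongly_measurable_zext {E} D (f : T -> E) : measurable D ->
  strongly_measurable D f -> strongly_measurable setT (zext D f).
Proof.
move=> mD mf; apply: strongly_measurable_if; rewrite ?setTI//.
exact: strongly_measurable_cst.
Qed.

Lemma integral_zext {E} (mu : {measure set T -> \bar R}) D A (f : T -> E)
    (h : E -> \bar R) : h 0 = 0%E ->
  (\int[mu]_(x in D) h (zext A f x) = \int[mu]_(x in D `&` A) h (f x))%E.
Proof.
move=> h0; rewrite integral_mkcond [RHS]integral_mkcond; apply: eq_integral => x _.
rewrite !patchE in_setI /zext; case: (x \in D) => //=.
by case: ifP.
Qed.

End StrongMeasurability.

Lemma strongly_measurable_precomp {d d'} {S : measurableType d}
    {T : measurableType d'} {R : realType} {E : normedModType R}
    (D : set T) (A : set S) (p : S -> T) (f : T -> E) :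
  measurable_fun setT p -> (forall x, A x -> D (p x)) ->
  strongly_measurable D f -> strongly_measurable A (f \o p).
Proof.
move=> mp AD [s ss sf]; exists (fun n => s n \o p) => [n|x /AD]; last exact: sf.
have [fs ms] := ss n; split.
  by apply: sub_finite_set fs => _ [x _ <-]; exists (p x).
by move=> y; rewrite comp_preimage -[X in measurable X]setTI; exact: mp.
Qed.

(** The given approximants are set to 0 where their norm exceeds [2 * |f x|]. If [f x] is nonzero
    this happens for finitely many [n] only, and if [f x = 0] the cut forces the value 0, so the
    limit is unchanged. The bound is what dominated convergence needs. *)
Lemma strongly_measurable_approx {d} {T : measurableType d} {R : realType}
    {E : normedModType R} (D : set T) (f : T -> E) : measurable D ->
  strongly_measurable D f -> exists t : nat -> T -> E,
  [/\ forall n, simple_fun (t n), forall n x, `|t n x| <= 2 * `|f x|,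
      forall n x, ~ D x -> t n x = 0 &
      forall x, D x -> t n x @[n --> \oo] --> f x].
Proof.
move=> mD mf; have [s ss sf] := mf.
pose A n := D `&` [set x | `|s n x| <= 2 * `|f x|].
have mA n : measurable (A n).
  apply: measurable_fun_le => //.
    apply: strongly_measurable_norm => //; exists (fun _ => s n) => // x _.
    exact: cvg_cst.
  by apply: measurable_funM => //; exact: strongly_measurable_norm.
exists (fun n x => if x \in A n then s n x else 0); split.
- by move=> n; apply: simple_fun_if => //; exact: simple_fun_cst.
- move=> n x; case: ifPn => [/set_mem[]//|_].
  by rewrite normr0 mulr_ge0.
- by move=> n x Dx; rewrite memNset// => -[].
move=> x Dx; have [fx0|fx0] := eqVneq (f x) 0.
  rewrite (_ : (fun n => _) = cst 0) ?fx0; first exact: cvg_cst.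
  apply/funext => n; case: ifPn => // /set_mem[_ /=].
  by rewrite fx0 normr0 mulr0 normr_le0 => /eqP.
apply: cvg_trans (sf x Dx); apply: near_eq_cvg.
have /cvgrPdist_lt/(_ `|f x|) := sf x Dx.
rewrite normr_gt0 => /(_ fx0); apply: filterS => n fsn.
rewrite mem_set//; split => //=; rewrite -(subrK (f x) (s n x)).
by rewrite (le_trans (ler_normD _ _))// mulr_natl mulr2n lerD2r distrC ltW.
Qed.

Lemma cvge0P {R : realType} {I} {F : set_system I} {FF : Filter F}
    (b : I -> \bar R) : (forall n, 0 <= b n)%E ->
  b n @[n --> F] --> 0%E <->
  forall e : R, 0 < e -> \forall n \near F, (b n <= e%:E)%E.
Proof.
move=> b0; split=> [/fine_cvgP[fb /cvgrPdist_le b_0] e e0|be].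
  near=> n; have bfin : b n \is a fin_num by near: n.
  have : `|0 - fine (b n)| <= e by near: n; exact: b_0.
  by rewrite sub0r normrN -(fineK bfin) lee_fin; apply: le_trans; exact: ler_norm.
apply/fine_cvgP; split.
  near=> n; have : (b n <= 1%:E)%E by near: n; exact: be.
  by move=> /le_lt_trans; rewrite ge0_fin_numE//; apply; rewrite ltry.
apply/cvgrPdist_le => e e0; near=> n.
have bn : (b n <= e%:E)%E by near: n; exact: be.
have bfin : b n \is a fin_num.
  by rewrite ge0_fin_numE// (le_lt_trans bn)// ltry.
by rewrite /= sub0r normrN ger0_norm ?fine_ge0// -lee_fin fineK.
Unshelve. all: by end_near. Qed.

(** * The duality pairing and its continuity *)

Section DualBasics.
Context {R : realType} {V : normedModType R}.
Implicit Types (f g : dual V) (v : V).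

Lemma dualD f g v : (f + g) v = f v + g v. Proof. by []. Qed.

Lemma dualB f g v : (f - g) v = f v - g v. Proof. by []. Qed.

Lemma dualZ (c : R) f v : (c *: f) v = c * f v. Proof. by []. Qed.

Lemma dual_sum (I : Type) (r : seq I) (F : I -> dual V) v :
  (\sum_(i <- r) F i) v = \sum_(i <- r) F i v.
Proof.
by elim: r => [|i r IH]; rewrite ?big_nil ?big_cons// dualD IH.
Qed.

Lemma dual_ext f g : (forall v, f v = g v) -> f = g.
Proof. by move=> fg; apply/val_inj/funext => v; exact: fg. Qed.

Lemma le_dual f v : `|f v| <= `|f| * `|v|.
Proof. exact: le_dual_norm. Qed.

Lemma dual_norm_le f (C : R) : 0 <= C -> (forall v, `|f v| <= C * `|v|) ->
  `|f| <= C.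
Proof.
move=> C0 fC; apply: ge_sup; first exact: (dual_norm_has_sup f).1.
by move=> _ [v /= v1 <-]; rewrite (le_trans (fC v))// ler_piMr.
Qed.

Lemma pairing_continuous : continuous (fun z : dual V * V => z.1 z.2 : R^o).
Proof.
move=> [f v]; apply/cvgrPdist_lt => e e0 /=.
(* Within distance [r <= 1] of [(f, v)] the error is at most [r * (|v| + 1) + |f| * r = r * C]. *)
pose C := `|f| + `|v| + 1.
have C0 : 0 < C by rewrite ltr_wpDl// addr_ge0.
pose r := Num.min 1 (e / (2 * C)).
have r0 : 0 < r by rewrite lt_min ltr01 divr_gt0// mulr_gt0.
near=> z; rewrite /=.
have zf : `|f - z.1| < r.
  near: z; have /cvgrPdist_lt H : z.1 @[z --> (f, v)] --> f by exact: cvg_fst.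
  exact: H.
have zv : `|v - z.2| < r.
  near: z; have /cvgrPdist_lt H : z.2 @[z --> (f, v)] --> v by exact: cvg_snd.
  exact: H.
have -> : f v - z.1 z.2 = (f - z.1) z.2 + f (v - z.2).
  by rewrite dualB linearB/=; ring.
rewrite (le_lt_trans (ler_normD _ _))//.
have z2 : `|z.2| <= `|v| + 1.
  rewrite -{1}(subrK v z.2) addrC (le_trans (ler_normD _ _))// lerD2l.
  by rewrite distrC (le_trans (ltW zv))// ge_min lexx.
apply: (@le_lt_trans _ _ (r * (`|v| + 1) + `|f| * r)).
  apply: lerD; (apply: le_trans; first exact: le_dual).
    by apply: ler_pM => //; exact: ltW.
  by rewrite ler_wpM2l// ltW.
have -> : r * (`|v| + 1) + `|f| * r = r * C by rewrite /C; ring.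
rewrite (@le_lt_trans _ _ (e / 2))//; last by rewrite ltr_pdivrMr// ltr_pMr// ltr1n.
rewrite (_ : e / 2 = e / (2 * C) * C); last by field; rewrite gt_eqF.
by rewrite ler_wpM2r ?(ltW C0)// ge_min lexx orbT.
Unshelve. all: by end_near. Qed.

Lemma eval_continuous v : continuous (fun f => f v : R^o).
Proof.
move=> f; apply/(cvgrPdist_lt (FF := nbhs_filter f)) => e e0.
have v1 : 0 < `|v| + 1 by rewrite ltr_wpDl.
near=> g; rewrite -[_ - _]/((f - g) v) (le_lt_trans (le_dual _ _))//.
apply: (@le_lt_trans _ _ (`|f - g| * (`|v| + 1))).
  by rewrite ler_wpM2l// lerDl.
rewrite -ltr_pdivlMr//; near: g.
by apply: cvgr_dist_lt => //; rewrite divr_gt0.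
Unshelve. all: by end_near. Qed.

End DualBasics.

(** * Bochner integrals in the dual, characterised by testing on vectors *)

Section BochnerDual.
Context {d} {T : measurableType d} {R : realType} {V : normedModType R}.
Variables (mu : {measure set T -> \bar R}) (D : set T).
Hypothesis mD : measurable D.

Lemma strongly_measurable_eval (f : T -> dual V) v : strongly_measurable D f ->
  strongly_measurable D (fun x => f x v : R^o).
Proof.
apply: (strongly_measurable_comp (phi := fun g : dual V => g v : R^o)).
exact: eval_continuous.
Qed.

Lemma integrable_pairing (f : T -> dual V) v : strongly_measurable D f ->
  (\int[mu]_(x in D) (`|f x|)%:E < +oo)%E ->
  mu.-integrable D (fun x => (f x v)%:E).
Proof.
move=> mf fi; apply/integrableP; split.
  apply/measurable_EFinP/strongly_measurableP => //.
  exact: strongly_measurable_eval.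
apply: (@le_lt_trans _ _ (\int[mu]_(x in D) (`|v|%:E * (`|f x|)%:E))%E).
  apply: ge0_le_integral => //.
  - apply/measurable_EFinP/measurableT_comp => //.
    apply/strongly_measurableP => //.
    exact: strongly_measurable_eval.
  - apply/measurable_EFinP/measurable_funM => //.
    exact: strongly_measurable_norm.
  - by move=> x _; rewrite lee_fin mulrC le_dual.
rewrite ge0_integralZl//; last by apply/measurable_EFinP/strongly_measurable_norm.
by rewrite lte_mul_pinfty.
Qed.

(** The alternative [c = 0] covers the fibre of a simple function over 0, which may have infinite
    measure. *)
Lemma integral_cst_indic (c : R) (A : set T) : measurable A ->
  c = 0 \/ (mu (D `&` A) < +oo)%E ->
  mu.-integrable D (fun x => (c * \1_A x)%:E) /\
  (\int[mu]_(x in D) (c * \1_A x)%:E = (fine (mu (D `&` A)) * c)%:E)%E.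
Proof.
move=> mA [->|fA].
  under eq_fun do rewrite mul0r; split; first exact: integrable0.
  by rewrite integral0_eq// mulr0.
have iA : mu.-integrable D (fun x => (\1_A x)%:E).
  apply/integrableP; split; first exact/measurable_EFinP/measurable_indic.
  under eq_integral do rewrite gee0_abs ?lee_fin//.
  by rewrite integral_indic// setIC.
under eq_fun do rewrite EFinM; split; first exact: integrableZl.
rewrite integralZl//; rewrite integral_indic//.
rewrite (setIC A D) EFinM fineK; first by rewrite muleC.
by rewrite ge0_fin_numE.
Qed.

(** Evaluation at [v] distributes over the finite sum. Fibres over nonzero values [y] have finite
    measure because [|y|] times that measure is at most the integral of [|s|]. *)
Lemma simple_integral_dual (s : T -> dual V) v : simple_fun s ->
  (\int[mu]_(x in D) (`|s x|)%:E < +oo)%E ->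
  simple_integral mu D s v = \int[mu]_(x in D) (s x v).
Proof.
move=> ss si; have [fs ms] := ss.
have /finite_seqP[r0 r0E] := fs; pose r := undup r0.
have rE : range s = [set` r].
  by rewrite r0E; apply/seteqP; split=> y /=; rewrite mem_undup.
have ur : uniq r by exact: undup_uniq.
rewrite /simple_integral rE -fsbig_seq// dual_sum.
have sE x : s x v = \sum_(y <- r) (y v) * \1_(s @^-1` [set y]) x.
  have rx : s x \in r.
    by have : range s (s x) by [exists x]; rewrite rE.
  rewrite (bigD1_seq (s x) rx ur)/= indicE mem_set// mulr1 big1 ?addr0// => y ysx.
  by rewrite indicE memNset ?mulr0//= => /esym/eqP; rewrite (negbTE ysx).
have H (y : dual V) : y v = 0 \/ (mu (D `&` s @^-1` [set y]) < +oo)%E.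
  have [->|y0] := eqVneq y 0; first by left.
  right; have y0' : 0 < `|y| by rewrite normr_gt0.
  rewrite -(@lte_pmul2l _ `|y|%:E)// mulry gtr0_sg// mul1e.
  apply: le_lt_trans si.
  rewrite -integral_cst; last exact: measurableI.
  rewrite (eq_integral (fun x => (`|s x|)%:E)); last by move=> x /set_mem[_ <-].
  apply: ge0_subset_integral => //; first exact: measurableI.
  apply/measurable_EFinP/strongly_measurable_norm => //.
  by exists (fun _ => s) => // x _; exact: cvg_cst.
rewrite /Rintegral; under eq_integral do rewrite sE -sumEFin.
rewrite big_seq_cond; under eq_bigr do rewrite dualZ.
transitivity (fine (\sum_(y <- r | (y \in r) && true)
   \int[mu]_(x in D) (y v * \1_(s @^-1` [set y]) x)%:E))%E; last first.
  rewrite -integral_sum//.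
    by congr fine; apply: eq_integral => x _; rewrite -big_seq_cond.
  by move=> y; exact: (integral_cst_indic (ms y) (H y)).1.
rewrite (eq_bigr (fun y => (fine (mu (D `&` s @^-1` [set y])) * y v)%:E)).
  by rewrite sumEFin.
by move=> y _; exact: (integral_cst_indic (ms y) (H y)).2.
Qed.

Lemma le_pairing_integral (f : T -> dual V) v : strongly_measurable D f ->
  (\int[mu]_(x in D) (`|f x|)%:E < +oo)%E ->
  ((`|\int[mu]_(x in D) (f x v)|)%:E <= `|v|%:E * \int[mu]_(x in D) (`|f x|)%:E)%E.
Proof.
move=> mf fi; have mn := strongly_measurable_norm mD mf.
rewrite EFin_normr_Rintegral//; last exact: integrable_pairing.
apply: (le_trans (le_abse_integral _ _ _)) => //.
  by case/integrableP: (integrable_pairing v mf fi).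
rewrite -ge0_integralZl//; last exact/measurable_EFinP.
apply: ge0_le_integral => //.
- apply/measurable_EFinP/measurableT_comp => //.
  by case/integrableP: (integrable_pairing v mf fi) => /measurable_EFinP.
- by apply/measurable_EFinP/measurable_funM.
- by move=> x _; rewrite lee_fin mulrC le_dual.
Qed.

Lemma cvg_pairing_integral (f : T -> dual V) (s : nat -> T -> dual V) v :
  strongly_measurable D f -> (forall n, strongly_measurable D (s n)) ->
  (\int[mu]_(x in D) (`|f x|)%:E < +oo)%E ->
  (forall n, \int[mu]_(x in D) (`|s n x|)%:E < +oo)%E ->
  (\int[mu]_(x in D) (`|f x - s n x|)%:E)%E @[n --> \oo] --> 0%E ->
  \int[mu]_(x in D) (s n x v) @[n --> \oo] --> \int[mu]_(x in D) (f x v).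
Proof.
move=> mf ms fi si /cvge0P fs.
have {}fs : forall e : R, 0 < e ->
    \forall n \near \oo, (\int[mu]_(x in D) (`|f x - s n x|)%:E <= e%:E)%E.
  by apply: fs => n; exact: integral_ge0.
apply/cvgrPdist_le => e e0.
have v1 : 0 < `|v| + 1 by rewrite ltr_wpDl.
have e1 : 0 < e / (`|v| + 1) by rewrite divr_gt0.
apply: filterS (fs _ e1) => n fsn.
rewrite -RintegralB//; [|exact: integrable_pairing..].
rewrite -lee_fin.
rewrite (@eq_Rintegral _ _ _ mu D (fun x => (f x - s n x) v))//.
apply: le_trans.
  apply: le_pairing_integral; first exact: strongly_measurableB.
  by rewrite (le_lt_trans fsn)// ltry.
apply: (@le_trans _ _ (`|v|%:E * (e / (`|v| + 1))%:E)%E).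
  by rewrite lee_wpmul2l// lee_fin.
by rewrite -EFinM lee_fin mulrCA ger_pMr// ler_pdivrMr// mul1r lerDl.
Qed.

(** Evaluation at [v] is continuous and commutes with the integral of simple functions. In
    particular the Bochner integral is unique. *)
Lemma is_bochner_integral_dual (f : T -> dual V) (I : dual V) v :
  strongly_measurable D f -> (\int[mu]_(x in D) (`|f x|)%:E < +oo)%E ->
  is_bochner_integral mu D f I -> I v = \int[mu]_(x in D) (f x v).
Proof.
move=> mf fi [s [ss _ fs sI]].
have ms n : strongly_measurable D (s n).
  by exists (fun=> s n) => [_|x _]; [have [] := ss n|exact: cvg_cst].
have H1 : simple_integral mu D (s n) v @[n --> \oo] --> I v.
  apply: (@cvg_comp _ _ _ _ (fun f : dual V => f v : R^o)); first exact: sI.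
  exact: eval_continuous.
have H2 := cvg_pairing_integral mf ms fi (fun n => (ss n).2) fs.
apply: (cvg_unique _ H1); first exact: norm_hausdorff.
have -> : (fun n => simple_integral mu D (s n) v) =
    (fun n => \int[mu]_(x in D) (s n x v) : R^o).
  by apply: funext => n; rewrite simple_integral_dual//; have [] := ss n.
exact: H2.
Qed.

(** The limit does not come from completeness of the dual: the functional sending [v] to the
    integral of [f x v] is bounded, and the simple integrals converge to it in the dual norm because
    the error, tested on [v], is at most [|v|] times the integral of [|f - s n|]. *)
Lemma is_bochner_integral_ex (f : T -> dual V) :
  strongly_measurable D f -> (\int[mu]_(x in D) (`|f x|)%:E < +oo)%E ->
  exists I, is_bochner_integral mu D f I.
Proof.
move=> mf fi; have mn := strongly_measurable_norm mD mf.
have [s [ss s2 s0 sf]] := strongly_measurable_approx mD mf.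
have ms n : strongly_measurable D (s n).
  by exists (fun=> s n) => [_|x _]; [exact: ss|exact: cvg_cst].
have si n : (\int[mu]_(x in D) (`|s n x|)%:E < +oo)%E.
  apply: (@le_lt_trans _ _ (\int[mu]_(x in D) (2%:E * (`|f x|)%:E))%E).
    apply: ge0_le_integral => //.
    - exact/measurable_EFinP/strongly_measurable_norm.
    - exact/measurable_EFinP/measurable_funM.
    - by move=> x _; rewrite lee_fin.
  rewrite ge0_integralZl//; last exact/measurable_EFinP.
  by rewrite lte_mul_pinfty.
pose F v : R^o := \int[mu]_(x in D) (f x v).
have F_lin : linear F.
  move=> a v w; rewrite /F; rewrite (@eq_Rintegral _ _ _ mu D (fun x => a * f x v + f x w)); last first.
    by move=> x _; rewrite linearP.
  rewrite RintegralD//; last 2 first.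
  - by apply: (integrableZl mD a (f := fun x => (f x v)%:E)); exact: integrable_pairing.
  - exact: integrable_pairing.
  by rewrite RintegralZl//; exact: integrable_pairing.
have F_le v : `|F v| <= `|v| * fine (\int[mu]_(x in D) (`|f x|)%:E)%E.
  rewrite -lee_fin (le_trans (le_pairing_integral _ mf fi))// EFinM fineK//.
  by rewrite ge0_fin_numE// integral_ge0.
pose F' : {linear V -> R^o} := HB.pack F (GRing.isLinear.Build R V R^o *:%R F F_lin).
have F_cont : continuous F.
  apply: (@bounded_linear_continuous _ _ _ F').
  apply/linear_boundedP; near=> r => v; rewrite mulrC (le_trans (F_le v))//.
  by rewrite ler_wpM2l//; near: r; apply: nbhs_pinfty_ge; rewrite num_real.
have F_dual : F \in @is_dual R V by apply/asboolP.
pose I := Dual F_dual.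
(* The bound [|s n| <= 2 * |f|] makes [3 * |f|] a dominating function. *)
have fs : (\int[mu]_(x in D) (`|f x - s n x|)%:E)%E @[n --> \oo] --> 0%E.
  rewrite -[X in _ --> X](@integral0 _ _ _ mu D).
  apply: (@dominated_cvg _ _ _ mu D mD _ _ (fun x => 3%:E * (`|f x|)%:E)%E).
  - by move=> n; apply/measurable_EFinP/strongly_measurable_norm => //;
      exact: strongly_measurableB.
  - move=> x Dx; apply/cvg_EFin; first by near=> n.
    rewrite -[X in _ --> X](@normr0 _ (dual V)) -(subrr (f x)).
    by apply: cvg_norm; apply: cvgB; [exact: cvg_cst|exact: sf].
  - by [].
  - apply: integrableZl => //; apply/integrableP; split; first exact/measurable_EFinP.
    by under eq_integral do rewrite gee0_abs ?lee_fin//.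
  - move=> n x Dx; rewrite gee0_abs ?lee_fin// (le_trans (ler_normB _ _))//.
    by rewrite (_ : 3 * `|f x| = `|f x| + 2 * `|f x|); [rewrite lerD2l|ring].
exists I, s; split => //; first by apply: aeW => x Dx; exact: sf.
have {}fs' : forall e : R, 0 < e ->
    \forall n \near \oo, (\int[mu]_(x in D) (`|f x - s n x|)%:E <= e%:E)%E.
  by apply/cvge0P => // n; exact: integral_ge0.
apply/(cvgrPdist_le (FF := eventually_filter)) => e e0.
apply: filterS (fs' _ e0) => n fsn; apply: dual_norm_le; first exact: ltW.
move=> v; rewrite dualB simple_integral_dual// -[I v]/(\int[mu]_(x in D) (f x v)).
rewrite -RintegralB//; [|exact: integrable_pairing..].
rewrite (@eq_Rintegral _ _ _ mu D (fun x => (f x - s n x) v))// -lee_fin.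
apply: le_trans.
  apply: le_pairing_integral; first exact: strongly_measurableB.
  by rewrite (le_lt_trans fsn)// ltry.
by rewrite EFinM muleC lee_wpmul2r.
Unshelve. all: by end_near. Qed.

(** [bochner_integral] is 0 unless some integral exists, so existence enters before the evaluation
    formula. Dual-valued integrals are used only through this formula. *)
Lemma bochner_integral_dual (f : T -> dual V) v :
  strongly_measurable D f -> (\int[mu]_(x in D) (`|f x|)%:E < +oo)%E ->
  bochner_integral mu D f v = \int[mu]_(x in D) (f x v).
Proof.
move=> mf fi; apply: is_bochner_integral_dual => //.
have [I fI] := is_bochner_integral_ex mf fi.
exact: (xgetPex 0 (ex_intro _ I fI)).
Qed.

End BochnerDual.

Section RealIntegrals.
Context {d} {T : measurableType d} {R : realType}.
Variables (nu : {measure set T -> \bar R}) (D : set T).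
Hypothesis mD : measurable D.

(** Integrability may fail here: [fine] sends infinite values to 0, and then the inequality is
    trivial. *)
Lemma EFin_Rintegral_le (f : T -> R) : measurable_fun D f ->
  ((`|\int[nu]_(x in D) f x|)%:E <= \int[nu]_(x in D) (`|f x|)%:E)%E.
Proof.
move=> mf; apply: (@le_trans _ _ (`|\int[nu]_(x in D) (f x)%:E|)%E).
  rewrite /Rintegral; case: (\int[nu]_(x in D) (f x)%:E)%E => //=.
  - by rewrite normr0 leey.
  - by rewrite normr0 leey.
by apply: le_abse_integral => //; exact/measurable_EFinP.
Qed.

Lemma integrable_mul_bounded (f g : T -> R) (C : R) :
  measurable_fun D f -> (forall x, D x -> `|f x| <= C) ->
  nu.-integrable D (EFin \o g) -> nu.-integrable D (EFin \o (fun x => f x * g x)).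
Proof.
move=> mf fC ig; have mg : measurable_fun D g.
  by case/integrableP: ig => /measurable_EFinP.
apply: (le_integrable mD _ _ (integrableZl mD C ig)).
  by apply/measurable_EFinP; apply: measurable_funM.
move=> x Dx /=; rewrite lee_fin !normrM ler_wpM2r// (le_trans (fC x Dx))//.
exact: ler_norm.
Qed.

Lemma integrable_EFinP (f : T -> R) : nu.-integrable D (EFin \o f) <->
  measurable_fun D f /\ (\int[nu]_(x in D) (`|f x|)%:E < +oo)%E.
Proof.
split=> [/integrableP[/measurable_EFinP mf fi]//|[/measurable_EFinP mf fi]].
exact/integrableP.
Qed.

Lemma integrable_dominated (f g : T -> R) : measurable_fun D f ->
  measurable_fun D g -> (forall x, D x -> `|f x| <= g x) ->
  (\int[nu]_(x in D) (g x)%:E < +oo)%E -> nu.-integrable D (EFin \o f).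
Proof.
move=> mf mg fg gi; apply/integrable_EFinP; split => //.
apply: le_lt_trans gi; apply: ge0_le_integral => //.
- by apply/measurable_EFinP; exact: measurableT_comp.
- exact/measurable_EFinP.
Qed.

End RealIntegrals.

(** * Smooth bumps and the lemma of du Bois-Reymond *)

Section Bump.
Context {R : realType}.
Implicit Types (f g : R -> R) (x : R).

(** The powers of [x^-1] make this family closed under differentiation up to linear combinations. *)
Definition expVX k x : R := if 0 < x then x^-1 ^+ k * expR (- x^-1) else 0.

(** One term of the exponential series suffices: [expR y >= y ^+ k.+2 / k.+2!] at [y = x^-1]. The
    linear bound gives differentiability at the origin. *)
Lemma expVX_le k x : 0 < x -> x^-1 ^+ k.+1 * expR (- x^-1) <= (k.+2)`!%:R * x.
Proof.
move=> x0; have y0 : 0 < x^-1 by rewrite invr_gt0.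
rewrite expRN -(ler_pM2r (expR_gt0 x^-1)) mulfVK ?gt_eqF ?expR_gt0//.
have := @expR_ge1Dxn R x^-1 k.+1 (ltW y0).
set n := k.+2`!%:R => H.
have n0 : 0 < n by rewrite ltr0n fact_gt0.
have : x^-1 ^+ k.+2 / n <= expR x^-1 by apply: le_trans H; rewrite lerDr.
rewrite ler_pdivrMr// => {}H.
rewrite -(ler_pM2r y0) -exprSr (le_trans H)//.
have -> : n * x * expR x^-1 / x = expR x^-1 * n by field; rewrite gt_eqF.
by [].
Qed.

Lemma is_derive_expVX k x :
  is_derive x 1 (expVX k) (expVX k.+2 x - k%:R * expVX k.+1 x).
Proof.
have [x0|x0|<-] := ltgtP 0 x.
- rewrite /expVX x0.
  have powE n (z : R) : ((fun z : R => z^-1) ^+ n : R -> R) z = z^-1 ^+ n.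
    by elim: n => [//|n IH]; rewrite !exprS -IH.
  pose F : R -> R := fun z => z^-1 ^+ k * expR (- z^-1).
  apply: (@near_eq_is_derive _ _ _ F).
    by near=> z; rewrite ifT//; near: z; exact: lt_nbhsr.
  have d1 : is_derive x 1 (fun z : R => z^-1) (- x ^- 2 *: 1).
    by apply: is_deriveV; rewrite ?gt_eqF.
  have d2 : is_derive x 1 ((fun z : R => z^-1) ^+ k)
      ((k%:R * x^-1 ^+ k.-1) *: (- x ^- 2 *: 1)) by exact: is_deriveX.
  have d3 : is_derive x 1 (- (fun z : R => z^-1)) (- (- x ^- 2 *: 1)).
    exact: is_deriveN.
  have d4 : is_derive x 1 (expR \o (- (fun z : R => z^-1)))
      (expR (- x^-1) * (- (- x ^- 2 *: 1))) by exact: is_derive1_comp.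
  have -> : F =
      ((fun z : R => z^-1) ^+ k) * (expR \o (- (fun z : R => z^-1))).
    apply/funext => z; rewrite /GRing.mul/=; congr (_ * _).
    by rewrite powE.
  apply: is_derive_eq; rewrite powE /= !scaler1 /GRing.scale/= -exprVn.
  by case: k {d2 F} => [|k] /=; rewrite ?exprS; ring.
- have e0 n : expVX n x = 0 by rewrite /expVX ltNge (ltW x0).
  rewrite !e0 mulr0 subr0.
  have c0 : is_derive x 1 (cst (0 : R)) 0 by exact: is_derive_cst.
  apply: near_eq_is_derive c0.
  near=> z; rewrite /expVX ifF//; apply/negbTE; rewrite -leNgt ltW//.
  by near: z; exact: lt_nbhsl.
(* At the origin the difference quotient of [expVX k] is [expVX k.+1], which tends to 0 by
   [expVX_le]. *)
rewrite /expVX ltxx mulr0 subr0; apply/is_derive1_caratheodory.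
exists (fun z => expVX k z / z); split => [z||]; last by rewrite invr0 mulr0.
- rewrite /expVX ltxx !subr0; have [->|z0] := eqVneq z 0.
    by rewrite ltxx !mulr0.
  by rewrite mulfVK.
apply/cvgrPdist_le => e e0; near=> z.
rewrite invr0 mulr0 sub0r normrN /expVX.
case: ifPn => z0; last by rewrite mul0r normr0 ltW.
rewrite mulrAC -exprSr ger0_norm; last first.
  by rewrite mulr_ge0 ?expR_ge0// exprn_ge0// invr_ge0 ltW.
apply: (le_trans (expVX_le k z0)); rewrite -ler_pdivlMl ?ltr0n ?fact_gt0//.
rewrite (le_trans (ler_norm z))//; near: z.
exists (k.+2`!%:R^-1 * e) => /=; first by rewrite mulr_gt0// invr_gt0 ltr0n fact_gt0.
by move=> y /=; rewrite sub0r normrN => /ltW.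
Unshelve. all: by end_near. Qed.

(** A class of expressions stable under [derive1]: derivatives of all orders then exist by induction
    on the order, without a formula for the n-th derivative. *)
Inductive smooth_gen : (R -> R) -> Prop :=
| smooth_expVX k : smooth_gen (expVX k)
| smooth_cst c : smooth_gen (fun=> c)
| smoothD f g : smooth_gen f -> smooth_gen g -> smooth_gen (fun x => f x + g x)
| smoothM f g : smooth_gen f -> smooth_gen g -> smooth_gen (fun x => f x * g x)
| smoothV f : smooth_gen f -> (forall x, f x != 0) ->
    smooth_gen (fun x => (f x)^-1)
| smooth_affine f c d : smooth_gen f -> smooth_gen (fun x => f (c * x + d)).

Lemma smooth_gen_derive f : smooth_gen f ->
  exists2 g, smooth_gen g & forall x, is_derive x 1 f (g x).
Proof.
elim=> {f}.
- move=> k; exists (fun x => expVX k.+2 x + (- k%:R) * expVX k.+1 x).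
    apply: smoothD; first exact: smooth_expVX.
    by apply: smoothM; [exact: smooth_cst|exact: smooth_expVX].
  by move=> x; rewrite mulNr; exact: is_derive_expVX.
- by move=> c; exists (fun=> 0) => [|x]; [exact: smooth_cst|exact: is_derive_cst].
- move=> f g _ [f' sf' df] _ [g' sg' dg]; exists (fun x => f' x + g' x).
    exact: smoothD.
  by move=> x; exact: is_deriveD.
- move=> f g sf [f' sf' df] sg [g' sg' dg].
  exists (fun x => f x * g' x + g x * f' x).
    by apply: smoothD; exact: smoothM.
  by move=> x; exact: is_deriveM.
- move=> f sf [f' sf' df] f0.
  exists (fun x => (-1) * (f x * f x)^-1 * f' x).
    apply: smoothM => //; apply: smoothM; first exact: smooth_cst.
    by apply: smoothV => [|x]; [exact: smoothM|rewrite mulf_neq0].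
  move=> x; have := is_deriveV (f0 x) (df x) => /is_derive_eq; apply.
  by rewrite mulN1r expr2.
- move=> f c d sf [f' sf' df]; exists (fun x => f' (c * x + d) * c).
    by apply: smoothM; [exact: smooth_affine|exact: smooth_cst].
  move=> x; have dl : is_derive x 1 (fun z => c * z + d) c.
    have -> : (fun z => c * z + d) = (c \*: id) + cst d by [].
    by apply: is_derive_eq; rewrite addr0 scaler1.
  exact: (@is_derive1_comp _ f).
Qed.

Lemma smooth_gen_derivable f x : smooth_gen f -> derivable f x 1.
Proof. by move=> /smooth_gen_derive[g _ /(_ x) []]. Qed.

Lemma smooth_gen_derive1 f : smooth_gen f -> smooth_gen (derive1 f).
Proof.
move=> /smooth_gen_derive[g sg dg]; suff -> : (derive1 f) = g by [].
by apply/funext => x; rewrite derive1E; exact: derive_val.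
Qed.

Lemma smooth_gen_derive1n f n : smooth_gen f -> smooth_gen (derive1n n f).
Proof.
by move=> sf; elim: n => [//|n IH]; rewrite derive1nS; exact: smooth_gen_derive1.
Qed.

Lemma smooth_gen_continuous f : smooth_gen f -> continuous f.
Proof.
by move=> sf x; apply/differentiable_continuous/derivable1_diffP/smooth_gen_derivable.
Qed.

Lemma expVX_ge0 k x : 0 <= expVX k x.
Proof.
rewrite /expVX; case: ifPn => // x0.
by rewrite mulr_ge0 ?expR_ge0// exprn_ge0// invr_ge0 ltW.
Qed.

Lemma expVX_gt0 k x : 0 < x -> 0 < expVX k x.
Proof. by move=> x0; rewrite /expVX x0 mulr_gt0 ?expR_gt0// exprn_gt0// invr_gt0. Qed.

Let den x : R := expVX 0 x + expVX 0 ((-1) * x + 1).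

Let den_gt0 x : 0 < den x.
Proof.
rewrite /den; have [x0|x0] := ltP 0 x.
  by rewrite ltr_pwDl ?expVX_gt0 ?expVX_ge0.
rewrite ltr_wpDl ?expVX_ge0// expVX_gt0// mulN1r addrC subr_gt0.
by rewrite (le_lt_trans x0).
Qed.

(** The standard smooth transition [f x / (f x + f (1 - x))] with [f = expVX 0], equal to 0 up to 0
    and to 1 from 1 on. *)
Definition step x : R := expVX 0 x * (den x)^-1.

Lemma smooth_step : smooth_gen step.
Proof.
apply: smoothM; first exact: smooth_expVX.
apply: smoothV => [|x]; last by rewrite gt_eqF.
by apply: smoothD; [|apply: smooth_affine]; exact: smooth_expVX.
Qed.

Lemma step_le0 x : x <= 0 -> step x = 0.
Proof. by move=> x0; rewrite /step /expVX ltNge x0/= mul0r. Qed.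

Lemma step_ge1 x : 1 <= x -> step x = 1.
Proof.
move=> x1; rewrite /step /den [X in _ + X](_ : _ = 0).
  by rewrite addr0 mulfV// gt_eqF// expVX_gt0// (lt_le_trans _ x1).
by rewrite /expVX ifF// mulN1r addrC subr_gt0 ltNge x1.
Qed.

Lemma step_bound x : 0 <= step x <= 1.
Proof.
rewrite /step divr_ge0 ?expVX_ge0 ?(ltW (den_gt0 _))//=.
by rewrite ler_pdivrMr ?den_gt0// mul1r lerDl expVX_ge0.
Qed.

Lemma derive1_step_out x : x < 0 \/ 1 < x -> (derive1 step) x = 0.
Proof.
case=> x0; rewrite derive1E.
  rewrite (@near_eq_derive _ _ _ _ (cst 0)) ?derive_cst//.
  by near=> z; rewrite step_le0// ltW//; near: z; exact: lt_nbhsl.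
rewrite (@near_eq_derive R R^o R^o _ (cst (1 : R))) ?derive_cst//.
by near=> z; rewrite step_ge1// ltW//; near: z; exact: lt_nbhsr.
Unshelve. all: by end_near. Qed.

Lemma derive1_step_bounded : exists2 K : R, 0 < K & forall x, `|(derive1 step) x| <= K.
Proof.
have cs : continuous (derive1 step).
  exact/smooth_gen_continuous/smooth_gen_derive1/smooth_step.
have [c _ cM] : exists2 c, c \in `[0, 1]%R &
    forall t, t \in `[0, 1]%R -> `|(derive1 step) t| <= `|(derive1 step) c|.
  apply: EVT_max => //; apply: continuous_subspaceT => x.
  by apply: continuous_comp; [exact: cs|exact: norm_continuous].
exists (`|(derive1 step) c| + 1); first by rewrite ltr_wpDl.
move=> x; have [x0|x0] := ltP x 0.
  by rewrite derive1_step_out ?normr0 ?addr_ge0//; left.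
have [x1|x1] := ltP 1 x.
  by rewrite derive1_step_out ?normr0 ?addr_ge0//; right.
by rewrite (le_trans (cM x _)) ?lerDl// in_itv/= x0.
Qed.

(** Both ramps lie to the right of their base points [a] and [b], so the pointwise limit as [h]
    decreases to 0 is the indicator of the half-open interval []a, b]]. *)
Definition bump (a b h x : R) : R := step ((x - a) / h) - step ((x - b) / h).

Lemma bump_test (T a b h : R) : 0 < a -> a < b -> 0 < h -> b + h < T ->
  test_function T (bump a b h).
Proof.
move=> a0 ab h0 bhT; have sb : smooth_gen (bump a b h).
  rewrite (_ : bump a b h = fun x => step (h^-1 * x + (- a / h)) +
      (-1) * step (h^-1 * x + (- b / h))); last first.
    by apply/funext => x; rewrite /bump mulN1r; congr (step _ - step _); ring.
  apply: smoothD; first exact: smooth_affine smooth_step.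
  by apply: smoothM; [exact: smooth_cst|exact: smooth_affine smooth_step].
split=> [n x|]; first exact/smooth_gen_derivable/smooth_gen_derive1n.
exists a, (b + h); split=> // x.
rewrite in_itv/= negb_and -!ltNge /bump => /orP[xa|xb].
  by rewrite !step_le0 ?subr0// ler_pdivrMr// mul0r subr_le0 ltW// (lt_trans xa).
rewrite !step_ge1 ?subrr// ler_pdivlMr// mul1r lerBrDl ltW//.
by rewrite (le_lt_trans _ xb)// lerD2r ltW.
Qed.

Lemma is_derive_step_affine (c h x : R) :
  is_derive x 1 (fun x => step ((x - c) / h)) (h^-1 * derive1 step ((x - c) / h)).
Proof.
rewrite mulrC; apply: (@is_derive1_comp _ step).
  have /derivableP := @smooth_gen_derivable _ ((x - c) / h) smooth_step.
  by rewrite derive1E.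
rewrite (_ : (fun x => _) = (h^-1 \*: id) - cst (c / h)); last first.
  by apply/funext => z; rewrite mulrBl mulrC.
by apply: is_derive_eq; rewrite subr0 scaler1.
Qed.

Lemma continuous_step_affine (c h : R) : continuous (fun x : R => step ((x - c) / h)).
Proof.
move=> x; apply/differentiable_continuous/derivable1_diffP.
by have [] := is_derive_step_affine c h x.
Qed.

Lemma derive1_bump (a b h x : R) : derive1 (bump a b h) x =
  h^-1 * derive1 step ((x - a) / h) - h^-1 * derive1 step ((x - b) / h).
Proof.
have ds c := is_derive_step_affine c h x.
rewrite derive1E (_ : bump a b h = (fun x => step ((x - a) / h)) -
  (fun x => step ((x - b) / h)))//.
by rewrite (@derive_val _ _ _ _ _ _ _ (is_deriveB (ds a) (ds b))).
Qed.

End Bump.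

Section DuBoisReymond.
Context {R : realType}.
Notation mu := (@lebesgue_measure R).

Definition mollifier (a h x : R) : R := h^-1 * derive1 step ((x - a) / h).

Lemma mollifier_continuous (a h : R) : continuous (mollifier a h).
Proof.
move=> x; apply: cvgM; first exact: cvg_cst.
apply: (@continuous_comp _ _ _ (fun x => (x - a) / h) (derive1 step)).
  by apply: cvgM; [apply: cvgB; [exact: cvg_id|exact: cvg_cst]|exact: cvg_cst].
exact/smooth_gen_continuous/smooth_gen_derive1/smooth_step.
Qed.

Lemma measurable_mollifier (a h : R) :
  measurable_fun (setT : set (measurableTypeR R)) (mollifier a h).
Proof. by apply: continuous_measurable_fun; exact: mollifier_continuous. Qed.

Lemma integrable_mollifier (p : R -> R) (a h : R) : 0 < h ->
  mu.-integrable setT (EFin \o p) ->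
  mu.-integrable setT (EFin \o (fun x => mollifier a h x * p x)).
Proof.
move=> h0 ip; have [K K0 sK] := @derive1_step_bounded R.
have kK x : `|mollifier a h x| <= h^-1 * K.
  by rewrite normrM gtr0_norm ?invr_gt0// ler_wpM2l// invr_ge0 ltW.
exact: (integrable_mul_bounded measurableT (measurable_mollifier a h)
  (fun x _ => kK x) ip).
Qed.

(* The mollifier [h^-1 * step' ((x - a) / h)] has mass one, lives on
   [[a, a + h]] and is bounded by [K / h]. *)
Lemma cvg_mollify (p : R -> R) (a : R) (h : nat -> R) :
  mu.-integrable setT (EFin \o p) -> lebesgue_pt p a ->
  (forall n, 0 < h n) -> h n @[n --> \oo] --> (0 : R) ->
  \int[mu]_x (mollifier a (h n) x * p x) @[n --> \oo] --> p a.
Proof.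
move=> ip pa h0 h_0; have [K K0 sK] := @derive1_step_bounded R.
pose k n x := mollifier a (h n) x.
have ck n : continuous (k n) by exact: mollifier_continuous.
have mk n := measurable_mollifier a (h n).
have kK n x : `|k n x| <= (h n)^-1 * K.
  by rewrite normrM gtr0_norm ?invr_gt0// ler_wpM2l// invr_ge0 ltW.
have k0 n x : x \notin `[a, a + h n] -> k n x = 0.
  rewrite in_itv/= negb_and -!ltNge /k /mollifier => xa; rewrite derive1_step_out ?mulr0//.
  case/orP : xa => xa; [left|right].
    by rewrite ltr_pdivrMr// mul0r subr_lt0.
  by rewrite ltr_pdivlMr// mul1r ltrBrDl.
have k1 n : (\int[mu]_x (k n x)%:E = 1)%E.
  rewrite (_ : (fun x => (k n x)%:E) = (fun x => (k n x)%:E) \_ `[a, a + h n]); last first.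
    apply/funext => x; rewrite patchE; case: ifPn => // xa.
    by rewrite k0//; move: xa; rewrite notin_setE/= => /negP.
  rewrite -integral_mkcond (@continuous_FTC2 _ _ (fun x => step ((x - a) / h n))).
  - rewrite step_ge1; last by rewrite addrAC subrr add0r mulfV// gt_eqF.
    by rewrite step_le0 ?subrr ?mul0r// sube0.
  - by rewrite ltrDl.
  - exact: continuous_subspaceT.
  - have c := @continuous_step_affine R a (h n).
    split; [|by apply: cvg_at_right_filter; exact: c|by apply: cvg_at_left_filter; exact: c].
    by move=> x _; have [] := is_derive_step_affine a (h n) x.
  move=> x _; rewrite derive1E.
  by have [_ ->] := is_derive_step_affine a (h n) x.
have mp : measurable_fun (setT : set (measurableTypeR R)) p by case/integrableP: ip => /measurable_EFinP.
have ik n : mu.-integrable setT (EFin \o k n).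
  have -> : EFin \o k n = (EFin \o k n) \_ `[a, a + h n].
    apply/funext => x; rewrite patchE; case: ifPn => //= xa.
    by rewrite k0//; move: xa; rewrite notin_setE/= => /negP.
  have HH := @integrable_mkcond _ _ R mu `[a, a + h n] (EFin \o k n) (measurable_itv _).
  apply: HH.1.
  apply: continuous_compact_integrable.
    exact: segment_compact.
  exact: continuous_subspaceT.
have ikp n := integrable_mollifier a (h0 n) ip.
apply/cvgrPdist_le => e e0.
(* The interval [[a, a + h]] lies in the ball of radius [2 * h], of measure [4 * h], and the
   mollifier is at most [K / h]; the product of the three factors is [e]. *)
have e1 : 0 < e / (4 * K) by rewrite divr_gt0// mulr_gt0.
have H : \forall n \near \oo, (davg p a (2 * h n) <= (e / (4 * K))%:E)%E.
  have [d /= d0 Hd] : \forall r \near (0 : R)^'+, (davg p a r <= (e / (4 * K))%:E)%E.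
    by move: pa => /cvge0P; apply => // r; exact: davg_ge0.
  have d2 : 0 < d / 2 by rewrite divr_gt0.
  have /cvgrPdist_lt/(_ _ d2) := h_0; apply: filterS => n hn.
  apply: Hd; last by rewrite mulr_gt0.
  move: hn; rewrite /= !sub0r !normrN normrM gtr0_norm// ltr_pdivlMr//.
  by rewrite mulrC.
apply: filterS H => n; rewrite /davg /iavg lebesgue_measure_ball; last first.
  by rewrite mulr_ge0// ltW.
set J := (\int[_]_(y in _) _)%E => H.
have J0 : (0 <= J)%E by exact: integral_ge0.
have {}H : (J <= (h n * (e / K))%:E)%E.
  have h4 : 0 < (2 * h n) *+ 2 by rewrite pmulrn_lgt0// mulr_gt0.
  move: H; rewrite inver gt_eqF// lee_pdivrMl// => /le_trans; apply.
  rewrite -EFinM lee_fin le_eqVlt; apply/orP; left; apply/eqP.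
  by rewrite mulr2n; field; rewrite gt_eqF.
(* Since the mollifier has mass one, [p a] can be moved under the integral. *)
have -> : p a - \int[mu]_x (k n x * p x) = - \int[mu]_x (k n x * (p x - p a)).
  have -> : (fun x => k n x * (p x - p a)) = (fun x => k n x * p x - k n x * p a).
    by apply/funext => x; rewrite mulrBr.
  rewrite RintegralB//; last 2 first.
  - exact: ikp.
  - by have := integrableZr measurableT (p a) (ik n).
  by rewrite RintegralZr// /Rintegral k1 mul1r opprB.
rewrite normrN -lee_fin.
have mkp : measurable_fun (setT : set (measurableTypeR R)) (fun x => k n x * (p x - p a)).
  by apply: measurable_funM; [exact: mk|exact: measurable_funB].
apply: (le_trans (@EFin_Rintegral_le _ _ R mu setT measurableT _ mkp)).
apply: (@le_trans _ _ (((h n)^-1 * K)%:E * J)%E); last first.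
  apply: (@le_trans _ _ (((h n)^-1 * K)%:E * (h n * (e / K))%:E)%E).
    by rewrite lee_wpmul2l// lee_fin mulr_ge0 ?invr_ge0// ltW.
  by rewrite -EFinM lee_fin le_eqVlt; apply/orP; left; apply/eqP; field; rewrite !gt_eqF.
have mJ : measurable_fun (ball a (2 * h n) : set (measurableTypeR R))
    (fun y => (`|(p y - p a)|)%:E).
  apply/measurable_EFinP/measurableT_comp => //.
  by apply: measurable_funTS; apply: measurable_funB.
rewrite -ge0_integralZl//; last 2 first.
- exact: measurable_ball.
- by rewrite lee_fin mulr_ge0 ?invr_ge0// ltW.
rewrite [leRHS]integral_mkcond; apply: ge0_le_integral => //.
- by apply/measurable_EFinP; exact: measurableT_comp.
- apply/(measurable_restrictT _ _).1; first exact: measurable_ball.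
  exact: emeasurable_funM.
move=> x _; rewrite patchE; case: ifPn => xa.
  by rewrite -EFinM lee_fin normrM ler_wpM2r.
rewrite k0 ?mul0r ?normr0//; apply: contra xa => xa; apply/mem_set.
move: xa; rewrite in_itv/= /ball/= => /andP[ax xh].
rewrite distrC ger0_norm ?subr_ge0// ltrBlDl (le_lt_trans xh)// ltrD2l.
by rewrite ltr_pMl// ltr1n.
Qed.

(* Test functions [bump a b h] converge to the indicator of [a, b] while
   their derivatives are differences of mollifiers at [a] and [b]. *)
Lemma du_bois_reymond (T : R) (p q : R -> R) :
  mu.-integrable `]0, T[ (EFin \o p) -> mu.-integrable `]0, T[ (EFin \o q) ->
  (forall phi, test_function T phi ->
    \int[mu]_(t in `]0, T[) (derive1 phi t * p t) =
    - \int[mu]_(t in `]0, T[) (phi t * q t)) ->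
  forall a b, 0 < a -> a < b -> b < T ->
  lebesgue_pt (p \_ `]0, T[) a -> lebesgue_pt (p \_ `]0, T[) b ->
  p b - p a = \int[mu]_(t in `]a, b]) q t.
Proof.
move=> ip iq pq a b a0 ab bT la lb.
pose P : measurableTypeR R -> R := p \_ `]0, T[.
pose Q : measurableTypeR R -> R := q \_ `]0, T[.
have iP : mu.-integrable setT (EFin \o P).
  have H := @integrable_mkcond _ _ R mu `]0, T[ (EFin \o p) (measurable_itv _).
  by move/H : ip; rewrite /P restrict_EFin.
have iQ : mu.-integrable setT (EFin \o Q).
  have H := @integrable_mkcond _ _ R mu `]0, T[ (EFin \o q) (measurable_itv _).
  by move/H : iq; rewrite /Q restrict_EFin.
(* Dividing by at least 2 keeps [b + h n] strictly below [T], as the support of a test function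
   requires. *)
pose h n : R := (T - b) / n.+2%:R.
have h0 n : 0 < h n by rewrite divr_gt0// subr_gt0.
have hb n : b + h n < T.
  by rewrite -ltrBrDl /h ltr_pdivrMr// ltr_pMr ?subr_gt0// ltr1n.
have h_0 : h n @[n --> \oo] --> (0 : R).
  rewrite -[X in _ --> X](mulr0 (T - b)); apply: cvgM; first exact: cvg_cst.
  by have := @cvg_harmonic R; rewrite -cvg_shiftS.
have aT := lt_trans ab bT.
have PE t : 0 < t -> t < T -> P t = p t.
  by move=> t0 tT; rewrite /P patchE mem_set//= in_itv/= t0.
have lhs n : \int[mu]_(t in `]0, T[) (derive1 (bump a b (h n)) t * p t) =
    \int[mu]_x (mollifier a (h n) x * P x) - \int[mu]_x (mollifier b (h n) x * P x).
  rewrite -RintegralB//; [|exact: integrable_mollifier..].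
  rewrite Rintegral_mkcond; apply: eq_Rintegral => x _.
  rewrite patchE /P patchE; case: ifPn => _; last by rewrite !mulr0 subrr.
  by rewrite derive1_bump mulrBl.
have mQ : measurable_fun (setT : set (measurableTypeR R)) Q.
  by case/integrableP: iQ => /measurable_EFinP.
have sc c n := @continuous_step_affine R c (h n).
have mb n : measurable_fun (setT : set (measurableTypeR R)) (bump a b (h n)).
  by apply: measurable_funB; apply: continuous_measurable_fun; exact: sc.
have b2 n x : `|bump a b (h n) x| <= 1.
  rewrite /bump ler_norml; have /andP[A1 A2] := @step_bound R ((x - a) / h n).
  by have /andP[B1 B2] := @step_bound R ((x - b) / h n); lra.
have rhs : \int[mu]_(t in `]0, T[) (bump a b (h n) t * q t) @[n --> \oo] -->
    \int[mu]_(t in `]a, b]) q t.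
  have E1 : (fun n => \int[mu]_(t in `]0, T[) (bump a b (h n) t * q t)) =
      fun n => fine (\int[mu]_x (bump a b (h n) x * Q x)%:E)%E.
    apply/funext => n; rewrite Rintegral_mkcond; apply: eq_Rintegral => x _.
    by rewrite patchE /Q patchE; case: ifPn => _; rewrite ?mulr0.
  have E2 : \int[mu]_(t in `]a, b]) q t =
      fine (\int[mu]_x (\1_(`]a, b] : set R) x * Q x)%:E)%E.
    rewrite Rintegral_mkcond; apply: eq_Rintegral => x _.
    rewrite patchE indicE; case: ifPn => [|_]; last by rewrite mul0r.
    move=> /set_mem/=; rewrite in_itv/= => /andP[ax xb]; rewrite mul1r /Q patchE.
    by rewrite mem_set//= in_itv/= (lt_trans a0 ax) (le_lt_trans xb bT).
  rewrite E1 E2; apply: fine_cvg; rewrite fineK.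
    apply: (@dominated_cvg _ _ _ mu setT measurableT _ _ (fun x => (`|Q x|)%:E)) => //.
    - by move=> n; apply/measurable_EFinP; apply: measurable_funM.
    - move=> x _; apply: cvg_EFin; first by near=> n.
      apply: cvgM; last exact: cvg_cst.
      rewrite /comp/= indicE.
      have [xa|ax] := leP x a.
        rewrite memNset/=; last by rewrite in_itv/= ltNge xa.
        rewrite (_ : (fun n => _) = cst 0); first exact: cvg_cst.
        apply/funext => n; rewrite /bump !step_le0 ?subr0//.
          by rewrite ler_pdivrMr// mul0r subr_le0 (le_trans xa)// ltW.
        by rewrite ler_pdivrMr// mul0r subr_le0.
      have near1 c : c < x -> \forall n \near \oo, step ((x - c) / h n) = 1.
        move=> cx; have xc : 0 < x - c by rewrite subr_gt0.
        have /cvgrPdist_lt/(_ _ xc) := h_0; apply: filterS => n.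
        rewrite sub0r normrN gtr0_norm// => hn.
        by rewrite step_ge1// ler_pdivlMr// mul1r ltW.
      have [xb|bx] := leP x b.
        rewrite mem_set/=; last by rewrite in_itv/= ax.
        apply: cvg_near_cst; apply: filterS (near1 a ax) => n sn.
        rewrite /bump sn step_le0 ?subr0//.
        by rewrite ler_pdivrMr// mul0r subr_le0.
      rewrite memNset/=; last by rewrite in_itv/= leNgt bx andbF.
      apply: cvg_near_cst; apply: filterS2 (near1 a ax) (near1 b bx) => n sa sb.
      by rewrite /bump sa sb subrr.
    - by have := integrable_norm iQ.
    - move=> n x _; rewrite lee_fin normrM ler_piMl//.
  apply: integrable_fin_num => //.
  have HH : measurable_fun (setT : set (measurableTypeR R)) (\1_(`]a, b] : set R) : _ -> R).
    by apply: measurable_indic; exact: measurable_itv.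
  apply: (integrable_mul_bounded measurableT HH _ iQ (C := 1)) => x _.
  by rewrite indicE; case: (_ \in _); rewrite ?normr1 ?normr0.
have L : (\int[mu]_x (mollifier a (h n) x * P x) -
    \int[mu]_x (mollifier b (h n) x * P x)) @[n --> \oo] --> P a - P b.
  by apply: cvgB; exact: cvg_mollify.
have N : (- (\int[mu]_(t in `]0, T[) (bump a b (h n) t * q t))) @[n --> \oo] -->
    - (\int[mu]_(t in `]a, b]) q t) by exact: cvgN.
have E : (fun n => \int[mu]_x (mollifier a (h n) x * P x) -
      \int[mu]_x (mollifier b (h n) x * P x)) =
    (fun n => - \int[mu]_(t in `]0, T[) (bump a b (h n) t * q t)).
  by apply/funext => n; rewrite -lhs pq//; exact: bump_test.
rewrite E in L; have H : P a - P b = - (\int[mu]_(t in `]a, b]) q t).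
  exact: (cvg_unique (@norm_hausdorff _ R^o) L N).
by rewrite -(opprK (\int[mu]_(t in `]a, b]) q t)) -H opprB !PE ?(lt_trans a0 ab).
Unshelve. all: by end_near. Qed.

End DuBoisReymond.

(** * Square integrable functions *)

Lemma cvg_sqr {R : realType} {I} {F : set_system I} {FF : Filter F}
    (u : I -> R) (l : R) : u n @[n --> F] --> l -> u n ^+ 2 @[n --> F] --> l ^+ 2.
Proof. by move=> ul; under eq_fun do rewrite expr2; rewrite expr2; exact: cvgM. Qed.

Section L2.
Context {R : realType}.
Notation mu := (@lebesgue_measure R).
Notation RM := (measurableTypeR R).

Lemma measurable_shift (h : R) : measurable_fun (setT : set RM) (fun x : RM => x + h : RM).
Proof. by apply: measurable_funD. Qed.

(** By uniqueness of the Lebesgue measure: the translated measure gives half-open intervals the same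
    length. *)
Lemma lebesgue_measure_shift (h : R) (A : set RM) : measurable A ->
  pushforward mu (fun x : RM => x + h : RM) A = mu A.
Proof.
move=> mA; have mh := measurable_shift h.
apply/esym/(@lebesgue_measure_unique R (measure_function_pushforward__canonical__measure_function_Measure mu mh)) => //= _ [[a b]] _ <-.
rewrite /pushforward /=.
rewrite (_ : (fun x : RM => x + h) @^-1` _ = `]a - h, b - h]%classic).
  by rewrite !lebesgue_measure_itv/= !lte_fin ltrD2r; case: ifP => // _; rewrite -!EFinB; congr EFin; ring.
by apply/seteqP; split=> x /=; rewrite !in_itv/= ltrBlDr lerBrDr.
Qed.

Lemma ge0_integral_shift (f : RM -> \bar R) (h : R) :
  measurable_fun (setT : set RM) f -> (forall x, 0 <= f x)%E ->
  (\int[mu]_x f (x + h)%R = \int[mu]_x f x)%E.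
Proof.
move=> mf f0; have mh := measurable_shift h.
have := @ge0_integral_pushforward _ _ _ _ R _ mh mu setT f measurableT mf (fun y _ => f0 y).
rewrite preimage_setT => <-; apply: eq_measure_integral => A mA _.
exact: lebesgue_measure_shift.
Qed.

Context {E : normedModType R}.
Implicit Types (f g : RM -> E).

(** The squared norm of L^2 over the whole line. Keeping the square replaces Minkowski's inequality
    by [|x + y|^2 <= 2 |x|^2 + 2 |y|^2]. *)
Definition sqn f : \bar R := (\int[mu]_t (`|f t| ^+ 2)%:E)%E.

Definition L2fun f := strongly_measurable (setT : set RM) f /\ (sqn f < +oo)%E.

Lemma sqn_ge0 f : (0 <= sqn f)%E.
Proof. by apply: integral_ge0 => t _; rewrite lee_fin exprn_ge0. Qed.

Lemma measurable_sqn f : strongly_measurable (setT : set RM) f ->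
  measurable_fun (setT : set RM) (fun t => (`|f t| ^+ 2)%:E).
Proof.
by move=> mf; apply/measurable_EFinP/measurable_funX/strongly_measurable_norm.
Qed.

Lemma sqr_normD_le (x y : E) : `|x + y| ^+ 2 <= 2 * `|x| ^+ 2 + 2 * `|y| ^+ 2.
Proof.
apply: (@le_trans _ _ ((`|x| + `|y|) ^+ 2)).
  by rewrite lerXn2r ?nnegrE ?addr_ge0// ler_normD.
by have := sqr_ge0 (`|x| - `|y|); nra.
Qed.

Lemma sqnD f g : strongly_measurable (setT : set RM) f ->
  strongly_measurable (setT : set RM) g ->
  (sqn (fun t => (f t + g t)%R) <= 2%:E * sqn f + 2%:E * sqn g)%E.
Proof.
move=> mf mg; rewrite -!ge0_integralZl//; last 2 first.
- exact: measurable_sqn.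
- exact: measurable_sqn.
rewrite -ge0_integralD//; last 2 first.
- by apply: measurable_funeM; exact: measurable_sqn.
- by apply: measurable_funeM; exact: measurable_sqn.
apply: ge0_le_integral => //.
- by apply: measurable_sqn; exact: strongly_measurableD.
- by apply: emeasurable_funD; apply: measurable_funeM; exact: measurable_sqn.
- by move=> x _; rewrite -!EFinM -EFinD lee_fin sqr_normD_le.
Qed.

Lemma sqnN f : sqn (fun t => - f t) = sqn f.
Proof. by apply: eq_integral => t _; rewrite normrN. Qed.

Lemma L2funD f g : L2fun f -> L2fun g -> L2fun (fun t => f t + g t).
Proof.
move=> [mf fi] [mg gi]; split; first exact: strongly_measurableD.
rewrite (le_lt_trans (sqnD mf mg))//.
by apply: lte_add_pinfty; rewrite lte_mul_pinfty.
Qed.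

Lemma L2funN f : L2fun f -> L2fun (fun t => - f t).
Proof.
by move=> [mf fi]; split; [exact: strongly_measurableN|rewrite sqnN].
Qed.

Lemma L2funB f g : L2fun f -> L2fun g -> L2fun (fun t => f t - g t).
Proof. by move=> Lf Lg; apply: L2funD => //; exact: L2funN. Qed.

Lemma L2fun_le f g : strongly_measurable (setT : set RM) f -> L2fun g ->
  (forall t, `|f t| <= `|g t|) -> L2fun f.
Proof.
move=> mf [mg gi] fg; split=> //; apply: le_lt_trans gi.
apply: ge0_le_integral => //; [exact: measurable_sqn|exact: measurable_sqn|].
by move=> t _; rewrite lee_fin lerXn2r ?nnegrE.
Qed.

Lemma strongly_measurable_shift f (h : R) : strongly_measurable (setT : set RM) f ->
  strongly_measurable (setT : set RM) (fun t => f (t + h)).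
Proof. exact: (strongly_measurable_precomp (measurable_shift h)). Qed.

Lemma sqn_shift f (h : R) : strongly_measurable (setT : set RM) f ->
  sqn (fun t => f (t + h)) = sqn f.
Proof.
move=> mf; rewrite /sqn (ge0_integral_shift (f := fun t => (`|f t| ^+ 2)%:E))//.
by exact: measurable_sqn.
Qed.

Lemma L2fun_shift f (h : R) : L2fun f -> L2fun (fun t => f (t + h)).
Proof.
move=> [mf fi]; split; first exact: strongly_measurable_shift.
by rewrite sqn_shift.
Qed.

Lemma sqn_le_cst f (A : set RM) (C : R) : measurable A ->
  strongly_measurable (setT : set RM) f ->
  (forall t, ~ A t -> f t = 0) -> (forall t, `|f t| <= C) ->
  (sqn f <= (C ^+ 2)%:E * mu A)%E.
Proof.
move=> mA mf f0 fC; rewrite -integral_cst// [leRHS]integral_mkcond.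
apply: ge0_le_integral => //.
- exact: measurable_sqn.
- by apply/(measurable_restrictT _ _).1 => //; exact: measurable_cst.
- move=> x _; rewrite patchE; case: ifPn => xA.
    by rewrite lee_fin lerXn2r ?nnegrE// (le_trans _ (fC x)).
  by rewrite f0 ?normr0 ?expr0n//; move/negP: xA => xA Ax; apply: xA; exact/mem_set.
Qed.

Lemma L2fun_bounded f (M C : R) : strongly_measurable (setT : set RM) f ->
  (forall t, M < `|t| -> f t = 0) -> (forall t, `|f t| <= C) -> L2fun f.
Proof.
move=> mf f0 fC; split => //.
have H : (sqn f <= (C ^+ 2)%:E * mu `[(- M)%R, M])%E.
  apply: sqn_le_cst => // t /= tM; apply: f0; rewrite ltNge; apply/negP => tM'.
  by apply: tM; rewrite in_itv/= -ler_norml.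
apply: (le_lt_trans H).
rewrite lebesgue_measure_itv/=; case: ifP => _; last by rewrite mule0.
by rewrite -EFinB -EFinM ltry.
Qed.

Lemma bounded_compact_support (phi : R -> R) (M : R) : continuous phi ->
  (forall x, M < `|x| -> phi x = 0) -> exists2 C, 0 <= C & forall x, `|phi x| <= C.
Proof.
move=> cphi p0; have [c _ cM] : exists2 c, c \in `[- `|M|, `|M|]%R &
    forall t, t \in `[- `|M|, `|M|]%R -> `|phi t| <= `|phi c|.
  apply: EVT_max; first by rewrite ge0_cp.
  apply: continuous_subspaceT => x.
  by apply: continuous_comp; [exact: cphi|exact: norm_continuous].
exists `|phi c| => // x; have [Mx|xM] := ltP M `|x|; first by rewrite p0// normr0.
by apply: cM; rewrite in_itv/= -ler_norml (le_trans xM)// ler_norm.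
Qed.

Lemma strongly_measurable_scale (phi : RM -> R) (v : E) :
  measurable_fun (setT : set RM) phi ->
  strongly_measurable (setT : set RM) (fun t => phi t *: v).
Proof.
move=> mphi; apply: strongly_measurableZ; last exact: strongly_measurable_cst.
exact/strongly_measurableP.
Qed.

Lemma L2fun_scale (phi : RM -> R) (v : E) (M C : R) :
  measurable_fun (setT : set RM) phi ->
  (forall x, M < `|x| -> phi x = 0) -> (forall x, `|phi x| <= C) ->
  L2fun (fun t => phi t *: v).
Proof.
move=> mphi p0 pC; apply: (@L2fun_bounded _ M (C * `|v|)).
- exact: strongly_measurable_scale.
- by move=> t /p0 ->; rewrite scale0r.
- by move=> t; rewrite normrZ ler_wpM2r.
Qed.

(** Start from a continuous approximation in L^1. Clamping its values to [[0, 1]] does not increase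
    the error, and an error at most 1 has its square below itself, so L^1 closeness gives L^2
    closeness. The factor [clamp (cut x)] is 1 on [A] and 0 outside [[- (M + 1), M + 1]]. *)
Lemma indic_approx (A : set RM) (M e : R) : measurable A ->
  (forall x, A x -> `|x| <= M) -> 0 < e ->
  exists phi : R -> R, [/\ continuous phi, forall x, M + 1 < `|x| -> phi x = 0 &
    (\int[mu]_x ((\1_A x - phi x) ^+ 2)%:E <= e%:E)%E].
Proof.
move=> mA AM e0; pose D : set RM := `[- (M + 1), M + 1]%classic.
have mD : measurable D by exact: measurable_itv.
have DM x : D x <-> `|x| <= M + 1 by rewrite /D/= in_itv/= -ler_norml.
have muD : (mu D < +oo)%E.
  by rewrite lebesgue_measure_itv/=; case: ifP => // _; rewrite -EFinB ltry.
have iA : mu.-integrable D (EFin \o (\1_A : RM -> R)).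
  apply/integrable_EFinP => //; split; first exact: measurable_indic.
  under eq_integral do rewrite ger0_norm//.
  rewrite integral_indic// (le_lt_trans _ muD)// le_measure// ?inE//.
  exact: measurableI.
have [g [cg ig]] := approximation_continuous_integrable mD muD iA.
move=> gl; have /(_ _ e0)[N _ /(_ N (leqnn N)) gN] : forall e : R, 0 < e ->
    \forall n \near \oo, (\int[mu]_(z in D) (`|\1_A z - g n z|)%:E <= e%:E)%E.
  by apply/cvge0P => // n; exact: integral_ge0.
pose clamp (y : R) := Num.max 0 (Num.min 1 y).
have clamp01 y : 0 <= clamp y <= 1.
  by rewrite /clamp le_max lexx ge_max ler01 ge_min lexx.
have clamp_cont (h : R -> R) : continuous h -> continuous (clamp \o h).
  move=> ch x; apply: (@continuous_comp _ _ _ h clamp); first exact: ch.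
  apply: (@continuous_max _ _ (cst 0) (fun y : R => Num.min 1 y)); first exact: cvg_cst.
  by apply: (@continuous_min _ _ (cst 1) id); [exact: cvg_cst|exact: cvg_id].
have clamp_id y : 0 <= y <= 1 -> clamp y = y.
  by move=> /andP[y0 y1]; rewrite /clamp min_r// max_r.
pose cut (x : R) : R := M + 1 - `|x|.
have cut_cont : continuous cut.
  by move=> x; apply: cvgB; [exact: cvg_cst|exact: norm_continuous].
exists (fun x => clamp (g N x) * clamp (cut x)); split.
- move=> x; apply: cvgM; first exact: (clamp_cont _ (cg N) x).
  exact: (clamp_cont _ cut_cont x).
- move=> x Mx; rewrite (_ : clamp (cut x) = 0) ?mulr0//.
  rewrite /clamp /cut min_r ?max_l//; first by rewrite subr_le0 ltW.
  by rewrite (@le_trans _ _ 0) // subr_le0 ltW.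
have clampl y : clamp y <= `|y|.
  by rewrite /clamp ge_max normr_ge0 ge_min ler_norm orbT.
have clampr y : 1 - clamp y <= `|1 - y|.
  rewrite lerBlDr addrC -lerBlDr /clamp le_max le_min; apply/orP; right.
  by rewrite lerBlDr lerDl normr_ge0/= lerBlDr -lerBlDl ler_norm.
have sq_le (z w : R) : 0 <= z -> z <= 1 -> z <= w -> z ^+ 2 <= w.
  move=> z0 z1; apply: le_trans; rewrite expr2 -[leRHS]mulr1.
  by rewrite ler_wpM2l.
have mg : measurable_fun (setT : set RM) (g N) by exact: continuous_measurable_fun.
have mphi : measurable_fun (setT : set RM) (fun x => clamp (g N x) * clamp (cut x)).
  apply: measurable_funM; apply: continuous_measurable_fun.
    exact: (clamp_cont _ (cg N)).
  exact: (clamp_cont _ cut_cont).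
have mA1 : measurable_fun (setT : set RM) (\1_A : RM -> R) by exact: measurable_indic.
apply: le_trans gN; rewrite [leRHS]integral_mkcond.
apply: ge0_le_integral => //.
- by move=> x _; rewrite lee_fin sqr_ge0.
- by apply/measurable_EFinP/measurable_funX/measurable_funB.
- apply/(measurable_restrictT _ _).1 => //; apply/measurable_EFinP/measurableT_comp => //.
  by apply: measurable_funTS; apply: measurable_funB.
move=> x _; have /andP[c0 c1] := clamp01 (g N x); have /andP[k0 k1] := clamp01 (cut x).
rewrite patchE; case: ifPn => xD; last first.
  have Mx : M + 1 < `|x|.
    by rewrite ltNge; apply/negP => xM; move/negP: xD; apply; apply/mem_set/DM.
  rewrite indicE memNset; last first.
    by move=> /AM xM; move: Mx; rewrite ltNge (le_trans xM)// lerDl.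
  rewrite (_ : clamp (cut x) = 0) ?mulr0 ?subrr ?expr0n//.
  rewrite /clamp /cut min_r ?max_l//; first by rewrite subr_le0 ltW.
  by rewrite (@le_trans _ _ 0) // subr_le0 ltW.
rewrite lee_fin indicE; have [Ax|nAx] := pselect (A x).
  rewrite mem_set//= (_ : clamp (cut x) = 1); last first.
    rewrite /clamp /cut min_l ?max_r//.
    by rewrite lerBrDr addrC lerD2r AM.
  rewrite mulr1; apply: sq_le; rewrite ?subr_ge0 ?clampr//.
  by rewrite lerBlDr lerDl.
rewrite memNset//= !sub0r sqrrN normrN; apply: sq_le.
- by rewrite mulr_ge0.
- by rewrite mulr_ile1.
- by rewrite (le_trans _ (clampl _))// ler_piMr.
Qed.

Lemma sqn_scale (phi : RM -> R) (v : E) : measurable_fun (setT : set RM) phi ->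
  (sqn (fun t => phi t *: v) = (`|v| ^+ 2)%:E * \int[mu]_t (phi t ^+ 2)%:E)%E.
Proof.
move=> mphi; rewrite -ge0_integralZl//.
- apply: eq_integral => t _; rewrite -EFinM normrZ exprMn.
  by rewrite mulrC -normrX ger0_norm ?sqr_ge0.
- by apply/measurable_EFinP/measurable_funX.
- by move=> t _; rewrite lee_fin sqr_ge0.
Qed.

(* Induction principle expressing the density in L^2 of the span of the
   functions [phi *: v] with [phi] continuous and compactly supported. *)
Lemma L2_ind (P : (RM -> E) -> Prop) :
  (forall (phi : R -> R) (v : E) (M : R), continuous phi ->
    (forall x, M < `|x| -> phi x = 0) -> P (fun t => phi t *: v)) ->
  (forall f g, L2fun f -> L2fun g -> P f -> P g -> P (fun t => f t + g t)) ->
  (forall f, L2fun f -> (forall e : R, 0 < e ->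
    exists g, [/\ L2fun g, P g & (sqn (fun t => f t - g t)%R <= e%:E)%E]) -> P f) ->
  forall f, L2fun f -> P f.
Proof.
move=> Pbase Padd Plim.
have P0 : P (fun=> 0).
  have : P (fun t => (cst 0 : R -> R) t *: (0 : E)).
    by apply: (Pbase (cst 0) 0 0) => // x; exact: cvg_cst.
  rewrite (_ : (fun t => _) = fun=> 0)//.
  by apply/funext => t; rewrite scaler0.
have Pind (A : set RM) (v : E) (M : R) : measurable A ->
    (forall x, A x -> `|x| <= M) ->
    P (fun t => \1_A t *: v) /\ L2fun (fun t => \1_A t *: v).
  move=> mA AM; have mA1 : measurable_fun (setT : set RM) (\1_A : RM -> R).
    exact: measurable_indic.
  have LA : L2fun (fun t => \1_A t *: v).
    apply: (@L2fun_scale _ _ M 1) => // x; last by rewrite indicE; case: (_ \in _); rewrite ?normr0 ?normr1.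
    by move=> Mx; rewrite indicE memNset// => /AM; rewrite leNgt Mx.
  split=> //; apply: Plim => // e e0.
  have e1 : 0 < e / (`|v| ^+ 2 + 1) by rewrite divr_gt0// ltr_wpDl// sqr_ge0.
  have [phi [cphi p0 pe]] := indic_approx mA AM e1.
  have [C C0 pC] := bounded_compact_support cphi p0.
  have mphi : measurable_fun (setT : set RM) phi by exact: continuous_measurable_fun.
  exists (fun t => phi t *: v); split.
  - exact: (@L2fun_scale _ _ (M + 1) C).
  - exact: (Pbase _ _ (M + 1)).
  rewrite (_ : (fun t => _) = fun t => (\1_A t - phi t) *: v); last first.
    by apply/funext => t; rewrite scalerBl.
  rewrite sqn_scale; last exact: measurable_funB.
  apply: (@le_trans _ _ ((`|v| ^+ 2)%:E * (e / (`|v| ^+ 2 + 1))%:E)%E).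
    by rewrite lee_wpmul2l// lee_fin sqr_ge0.
  rewrite -EFinM lee_fin mulrCA ger_pMr// ler_pdivrMr ?mul1r ?lerDl//.
have Psimple (s : RM -> E) (M : R) : simple_fun s ->
    (forall x, M < `|x| -> s x = 0) -> P s /\ L2fun s.
  move=> [fs ms] s0; have /finite_seqP[r0 r0E] := fs.
  pose r := undup r0; have ur : uniq r by exact: undup_uniq.
  have rE x : s x \in r.
    by rewrite mem_undup; have : range s (s x) by [exists x]; rewrite r0E.
  have -> : s = fun t => \sum_(y <- r) \1_(s @^-1` [set y]) t *: y.
    apply/funext => x; rewrite (bigD1_seq (s x) (rE x) ur)/= indicE mem_set//.
    rewrite scale1r big1 ?addr0// => y ysx.
    by rewrite indicE memNset ?scale0r//= => /esym/eqP; rewrite (negbTE ysx).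
  elim: r {ur rE} => [|y r [IHP IHL]].
    under eq_fun do rewrite big_nil; split=> //.
    by apply: (@L2fun_bounded _ 0 0) => //; [exact: strongly_measurable_cst|rewrite normr0].
  under eq_fun do rewrite big_cons.
  have [yP yL] : P (fun t => \1_(s @^-1` [set y]) t *: y) /\
      L2fun (fun t => \1_(s @^-1` [set y]) t *: y).
    have [->|y0] := eqVneq y 0.
      under eq_fun do rewrite scaler0; split=> //.
      by apply: (@L2fun_bounded _ 0 0) => //; [exact: strongly_measurable_cst|rewrite normr0].
    apply: (Pind _ _ M) => // x /= sx; rewrite leNgt; apply/negP => /s0 sx0.
    by move: y0; rewrite -sx sx0 eqxx.
  by split; [exact: Padd|exact: L2funD].
move=> f Lf; have [mf fi] := Lf; apply: Plim => // e e0.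
have [s [ss s2 _ sf]] := strongly_measurable_approx measurableT mf.
(* Truncation to [[-n, n]] gives bounded support; the factor 9 below is the square of the 3 in
   [|f - t n| <= 3 * |f|]. *)
pose D n : set RM := `[- n%:R, n%:R]%classic.
pose t n x := if x \in D n then s n x else 0.
have st n : simple_fun (t n).
  by apply: simple_fun_if => //; [exact: measurable_itv|exact: simple_fun_cst].
have t0 n x : n%:R < `|x| -> t n x = 0.
  move=> nx; rewrite /t memNset// /D/= in_itv/= -ler_norml => xn.
  by move: nx; rewrite ltNge xn.
have t2 n x : `|t n x| <= 2 * `|f x|.
  by rewrite /t; case: ifP => // _; rewrite normr0 mulr_ge0.
have tf x : t n x @[n --> \oo] --> f x.
  apply: cvg_trans (sf x I); apply: near_eq_cvg; near=> n.
  rewrite /t mem_set// /D/= in_itv/= -ler_norml.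
  by near: n; exact: nbhs_infty_ger.
have mt n : strongly_measurable (setT : set RM) (t n).
  by exists (fun=> t n) => // x _; exact: cvg_cst.
have lim0 : (sqn (fun x => f x - t n x)%R) @[n --> \oo] --> 0%E.
  rewrite -[X in _ --> X](@integral0 _ _ _ mu setT).
  apply: (@dominated_cvg _ _ _ mu setT measurableT _ _ (fun x => 9%:E * (`|f x| ^+ 2)%:E)%E).
  - by move=> n; apply: measurable_sqn; exact: strongly_measurableB.
  - move=> x _; apply/cvg_EFin; first by near=> n.
    rewrite -[X in _ --> X](_ : `|f x - f x| ^+ 2 = 0); last by rewrite subrr normr0 expr0n.
    by apply: cvg_sqr; apply: cvg_norm; apply: cvgB; [exact: cvg_cst|exact: tf].
  - by [].
  - apply: integrableZl => //; apply/integrableP; split; first exact: measurable_sqn.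
    by under eq_integral do rewrite gee0_abs ?lee_fin ?sqr_ge0//.
  - move=> n x _; rewrite gee0_abs ?lee_fin ?sqr_ge0//.
    have -> : 9 * `|f x| ^+ 2 = (3 * `|f x|) ^+ 2 by rewrite exprMn -natrX.
    rewrite lerXn2r ?nnegrE ?mulr_ge0// (le_trans (ler_normB _ _))//.
    by rewrite (_ : 3 * `|f x| = `|f x| + 2 * `|f x|); [rewrite lerD2l|ring].
have [N _ /(_ N (leqnn N)) tN] : \forall n \near \oo, (sqn (fun x => f x - t n x)%R <= e%:E)%E.
  by have /cvge0P := lim0; apply=> // n; exact: sqn_ge0.
by exists (t N); have [PtN LtN] := Psimple _ _ (st N) (t0 N); split.
Unshelve. all: by end_near. Qed.

(** For [phi *: v] this is dominated convergence: when [|h| <= 1] the squared difference of [phi] is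
    at most [4 * C ^+ 2] and vanishes outside [[- (M + 1), M + 1]]. Sums and limits follow since
    translation preserves [sqn]. *)
Lemma L2_translation f : L2fun f -> forall e : R, 0 < e ->
  \forall h \near (0 : R), (sqn (fun t => f (t + h) - f t)%R <= e%:E)%E.
Proof.
move: f; apply: L2_ind.
- move=> phi v M cphi p0.
  have [C C0 pC] := bounded_compact_support cphi p0.
  have mphi : measurable_fun (setT : set RM) phi by exact: continuous_measurable_fun.
  pose D : set RM := `[- (M + 1), M + 1]%classic.
  have mD : measurable D by exact: measurable_itv.
  pose F (h : R) : R := fine (\int[mu]_t ((phi (t + h) - phi t) ^+ 2)%:E).
  have mF h : measurable_fun (setT : set RM) (fun t => phi (t + h) - phi t).
    apply: measurable_funB => //.
    exact: (measurableT_comp mphi (measurable_shift h)).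
  have bF h t : `|h| <= 1 -> (phi (t + h) - phi t) ^+ 2 <= (4 * C ^+ 2) * \1_D t.
    move=> h1; rewrite indicE; have [tD|tD] := pselect (D t).
      rewrite mem_set// mulr1 (_ : 4 * C ^+ 2 = (2 * C) ^+ 2); last by rewrite exprMn -natrX.
      rewrite -real_normK ?num_real// lerXn2r ?nnegrE ?mulr_ge0//.
      by rewrite (le_trans (ler_normB _ _))// mulr_natl mulr2n lerD.
    rewrite memNset// mulr0 !p0 ?subrr ?expr0n//.
      rewrite ltNge; apply/negP => tM; apply: tD.
      by rewrite /D/= in_itv/= -ler_norml (le_trans tM)// lerDl.
    rewrite ltNge; apply/negP => tM; apply: tD.
    rewrite /D/= in_itv/= -ler_norml -(subrK h t) addrAC.
    by rewrite (le_trans (ler_normB _ _))// lerD.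
  have iD : mu.-integrable setT (fun t => ((4 * C ^+ 2) * \1_D t)%:E).
    have HD : (mu (setT `&` D) < +oo)%E.
      by rewrite setTI lebesgue_measure_itv/=; case: ifP => // _; rewrite -EFinB ltry.
    exact: (@integral_cst_indic _ RM R mu setT measurableT _ D mD (or_intror HD)).1.
  have lim0 (u : nat -> R) : u n @[n --> \oo] --> (0 : R) ->
      (\int[mu]_t ((phi (t + u n) - phi t) ^+ 2)%:E)%E @[n --> \oo] --> 0%E.
    move=> u0; have [N _ uN] : \forall n \near \oo, `|u n| <= 1.
      have /cvgrPdist_le/(_ _ ltr01) := u0; apply: filterS => n.
      by rewrite sub0r normrN.
    rewrite -[X in _ --> X](@integral0 _ _ _ mu setT).
    rewrite -(cvg_shiftn N).
    apply: (@dominated_cvg _ _ _ mu setT measurableT _ _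
      (fun t => ((4 * C ^+ 2) * \1_D t)%:E)) => //.
    - by move=> n; apply/measurable_EFinP/measurable_funX.
    - move=> t _; apply/cvg_EFin; first by near=> n.
      rewrite -[X in _ --> X](_ : (phi t - phi t) ^+ 2 = 0); last by rewrite subrr expr0n.
      apply: cvg_sqr; apply: cvgB; last exact: cvg_cst.
      have tu : t + u (n + N)%N @[n --> \oo] --> (t + 0 : R).
        by apply: cvgD; [exact: cvg_cst|rewrite (cvg_shiftn N)].
      rewrite addr0 in tu; exact: (cvg_comp _ phi tu (cphi t)).
    - by move=> n t _; rewrite gee0_abs ?lee_fin ?sqr_ge0// bF// uN//= leq_addl.
  have Ffin h : `|h| <= 1 ->
      (\int[mu]_t ((phi (t + h) - phi t) ^+ 2)%:E)%E \is a fin_num.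
    move=> h1; apply: integrable_fin_num => //.
    apply: (le_integrable measurableT _ _ iD).
      by apply/measurable_EFinP/measurable_funX.
    move=> t _; rewrite !gee0_abs ?lee_fin ?sqr_ge0// ?bF//.
    by rewrite mulr_ge0// mulr_ge0// sqr_ge0.
  have F0 : F h @[h --> (0 : R^o)] --> (0 : R^o).
    by apply/(@cvg_nbhsP _ R^o) => u u0; exact: (fine_cvg (lim0 u u0)).
  move=> e e0; have e1 : 0 < e / (`|v| ^+ 2 + 1) by rewrite divr_gt0// ltr_wpDl// sqr_ge0.
  have H1 : \forall h \near (0 : R), `|h| <= 1.
    by exists 1 => //= y; rewrite /= sub0r normrN => /ltW.
  have /cvgrPdist_le/(_ _ e1) H2 := F0.
  apply: filterS2 H1 H2 => h h1; rewrite sub0r normrN => hF.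
  rewrite (_ : (fun t => _) = fun t => (phi (t + h) - phi t) *: v); last first.
    by apply/funext => t; rewrite scalerBl.
  rewrite sqn_scale//; apply: (@le_trans _ _ ((`|v| ^+ 2)%:E * (e / (`|v| ^+ 2 + 1))%:E)%E).
    rewrite lee_wpmul2l ?lee_fin ?sqr_ge0// -(fineK (Ffin h h1)) lee_fin.
    by rewrite (le_trans _ hF)// ler_norm.
  rewrite -EFinM lee_fin mulrCA ger_pMr// ler_pdivrMr ?mul1r ?lerDl//.
- move=> f g Lf Lg IHf IHg e e0; have e4 : 0 < e / 4 by rewrite divr_gt0.
  apply: filterS2 (IHf _ e4) (IHg _ e4) => h hf hg.
  rewrite (_ : (fun t => _) = fun t => (f (t + h) - f t) + (g (t + h) - g t)); last first.
    by apply/funext => t; rewrite opprD addrACA.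
  apply: (le_trans (sqnD _ _)).
  + by have [] := L2funB (L2fun_shift h Lf) Lf.
  + by have [] := L2funB (L2fun_shift h Lg) Lg.
  apply: (@le_trans _ _ (2%:E * (e / 4)%:E + 2%:E * (e / 4)%:E)%E).
    by apply: leeD; rewrite lee_wpmul2l.
  by rewrite -!EFinM -EFinD lee_fin le_eqVlt; apply/orP; left; apply/eqP; field.
(* Two uses of [sqnD] give [2 * (e / 10) + 2 * (4 * (e / 10)) = e]. *)
move=> f Lf IH e e0; have e10 : 0 < e / 10 by rewrite divr_gt0.
have [g [Lg Pg fg]] := IH _ e10.
apply: filterS (Pg _ e10) => h hg.
have Lfg := L2funB Lf Lg.
rewrite (_ : (fun t => _) = fun t => (g (t + h) - g t) +
    ((f (t + h) - g (t + h)) + - (f t - g t))); last first.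
  apply/funext => t.
  by rewrite opprB addrCA [g (t + h) - g t + _]addrA subrK addrA subrK.
apply: (le_trans (sqnD _ _)).
- by have [] := L2funB (L2fun_shift h Lg) Lg.
- by have [] := L2funD (L2fun_shift h Lfg) (L2funN Lfg).
have H : (sqn (fun t => (f (t + h) - g (t + h)) + - (f t - g t))%R <= (4 * (e / 10))%:E)%E.
  apply: (le_trans (sqnD _ _)).
  + by have [] := L2fun_shift h Lfg.
  + by have [] := L2funN Lfg.
  rewrite sqnN (sqn_shift h (f := fun t => f t - g t)); last by case: Lfg.
  apply: (@le_trans _ _ (2%:E * (e / 10)%:E + 2%:E * (e / 10)%:E)%E).
    by apply: leeD; rewrite lee_wpmul2l.
  by rewrite -!EFinM -EFinD lee_fin le_eqVlt; apply/orP; left; apply/eqP; field.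
apply: (@le_trans _ _ (2%:E * (e / 10)%:E + 2%:E * (4 * (e / 10))%:E)%E).
  by apply: leeD; rewrite lee_wpmul2l.
by rewrite -!EFinM -EFinD lee_fin le_eqVlt; apply/orP; left; apply/eqP; field.
Unshelve. all: by end_near. Qed.

End L2.

(** * Weak derivatives *)

Section RealDot.
Context {R : realType} {H : hilbertType R}.
Implicit Types x y z : H.

Lemma dotC x y : dotv x y = dotv y x.
Proof. by rewrite hermC /= expr0 mul1r. Qed.

Lemma dotBl x y z : dotv (x - y) z = dotv x z - dotv y z.
Proof. by rewrite linearBl. Qed.

Lemma dotBr x y z : dotv x (y - z) = dotv x y - dotv x z.
Proof. by rewrite linearBr. Qed.

Lemma dotDr x y z : dotv x (y + z) = dotv x y + dotv x z.
Proof. by rewrite linearDr. Qed.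

Lemma dotZl (c : R) x y : dotv (c *: x) y = c * dotv x y.
Proof. by rewrite linearZl_LR. Qed.

Lemma dotZr (c : R) x y : dotv x (c *: y) = c * dotv x y.
Proof. by rewrite dotC dotZl dotC. Qed.

Lemma dot_le x y : dotv x y <= `|x| * `|y|.
Proof.
have [->|x0] := eqVneq x 0; first by rewrite normr0 mul0r linear0l.
have [->|y0] := eqVneq y 0; first by rewrite normr0 mulr0 dotC linear0l.
(* Expanding gives [|z|^2 = 2 |x| |y| (|x| |y| - dotv x y)], whose sign is the claim. *)
pose z := `|y| *: x - `|x| *: y.
have := sqr_ge0 `|z|; rewrite sqr_normv /z.
rewrite dotBl !dotBr !dotZl !dotZr -!sqr_normv [dotv y x]dotC.
have nx : 0 < `|x| by rewrite normr_gt0.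
have ny : 0 < `|y| by rewrite normr_gt0.
set d := dotv x y => D.
have : 0 <= 2 * (`|x| * `|y|) * (`|x| * `|y| - d).
  by rewrite (le_trans D)// le_eqVlt; apply/orP; left; apply/eqP; ring.
by rewrite pmulr_rge0 ?subr_ge0// !mulr_gt0.
Qed.

Lemma dot_norm_le x y : `|dotv x y| <= `|x| * `|y|.
Proof.
rewrite ler_norml dot_le andbT lerNl -mulN1r -dotZl.
by rewrite (le_trans (dot_le _ _))// normrZ normrN1 mul1r.
Qed.

Lemma sqr_normB x y : `|x - y| ^+ 2 = `|x| ^+ 2 + `|y| ^+ 2 - 2 * dotv x y.
Proof. by rewrite !sqr_normv dotBl !dotBr [dotv y x]dotC; ring. Qed.

Lemma sqr_normBD x y : `|x| ^+ 2 - `|y| ^+ 2 = dotv (x - y) (x + y).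
Proof. by rewrite !sqr_normv dotBl !dotDr [dotv y x]dotC; ring. Qed.

End RealDot.

Section L2Interval.
Context {R : realType} {E : normedModType R}.
Notation mu := (@lebesgue_measure R).
Notation RM := (measurableTypeR R).
Implicit Types (f : RM -> E) (a b : R).

Lemma L2_norm_lty a b f : (L2_norm a b f < +oo)%E ->
  (\int[mu]_(t in `]a, b[) (`|f t| ^+ 2)%:E < +oo)%E.
Proof.
rewrite /L2_norm; move: (\int[mu]_(t in _) _)%E => I.
case: I => [r _| + |_]; [exact: ltry| |by []].
by rewrite poweRyr// invr_eq0 pnatr_eq0.
Qed.

Lemma L2fun_zext (A : set RM) f : measurable A -> strongly_measurable A f ->
  (\int[mu]_(t in A) (`|f t| ^+ 2)%:E < +oo)%E -> L2fun (zext A f).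
Proof.
move=> mA mf fi; split; first exact: strongly_measurable_zext.
rewrite /sqn (integral_zext mu setT A f (h := fun y => (`|y| ^+ 2)%:E)).
  by rewrite setTI.
by rewrite normr0 expr0n.
Qed.

Lemma in_L2_zext a b f : in_L2 a b f -> L2fun (zext `]a, b[ f).
Proof.
move=> [mf /L2_norm_lty fi]; apply: L2fun_zext => //; exact: measurable_itv.
Qed.

(** From [a <= 1 + a ^+ 2] and the finite measure of [A]. *)
Lemma L2_L1 (A : set RM) f : measurable A -> (mu A < +oo)%E ->
  strongly_measurable A f ->
  (\int[mu]_(t in A) (`|f t| ^+ 2)%:E < +oo)%E ->
  (\int[mu]_(t in A) (`|f t|)%:E < +oo)%E.
Proof.
move=> mA muA mf fi; have mn := strongly_measurable_norm mA mf.
apply: (@le_lt_trans _ _ (\int[mu]_(t in A) (1 + (`|f t| ^+ 2)%:E))%E).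
  apply: ge0_le_integral => //.
  - exact/measurable_EFinP.
  - by apply: emeasurable_funD => //; apply/measurable_EFinP/measurable_funX.
  - move=> x _; rewrite -EFinD lee_fin; have := sqr_ge0 (`|f x| - 1); nra.
rewrite ge0_integralD//; last by apply/measurable_EFinP/measurable_funX.
by rewrite lte_add_pinfty// integral_cst// mul1e.
Qed.

Lemma in_L2_L1 a b f : in_L2 a b f ->
  (\int[mu]_(t in `]a, b[) (`|f t|)%:E < +oo)%E.
Proof.
move=> [mf /L2_norm_lty fi]; apply: (@L2_L1 `]a, b[%classic) => //.
by rewrite lebesgue_measure_itv/=; case: ifP => // _; rewrite -EFinB ltry.
Qed.

End L2Interval.

Section WeakDerivative.
Context {R : realType} {V H : hilbertType R} (j : gelfand_embedding V H).
Notation mu := (@lebesgue_measure R).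
Notation RM := (measurableTypeR R).

Lemma embed_bound : exists2 C : R, 0 < C & forall v, `|j v| <= C * `|v|.
Proof.
have /linear_boundedP : bounded_near j (nbhs (0 : V)).
  by apply: continuous_linear_bounded; exact: embed_continuous.
move=> [M [_ HM]]; exists (`|M| + 1); first by rewrite ltr_wpDl.
by apply: HM; rewrite (le_lt_trans (ler_norm M))// ltrDl.
Qed.

Lemma gelfandE (h : H) (v : V) : gelfand j h v = dotv h (j v).
Proof. by []. Qed.

Lemma gelfand_embed_le : exists2 C : R, 0 < C &
  forall v w : V, `|gelfand j (j v) - gelfand j (j w)| <= C * `|v - w|.
Proof.
have [C C0 jC] := embed_bound; exists (C * C); first by rewrite mulr_gt0.
move=> v w; apply: dual_norm_le => [|x]; first by rewrite mulr_ge0// mulr_ge0 ?ltW.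
rewrite dualB !gelfandE -dotBl -linearB (le_trans (dot_norm_le _ _))//.
rewrite (le_trans (ler_pM _ _ (jC _) (jC _)))//.
by rewrite le_eqVlt; apply/orP; left; apply/eqP; ring.
Qed.

Lemma gelfand_embed_continuous : continuous (fun v : V => gelfand j (j v)).
Proof.
have [C C0 jC] := gelfand_embed_le.
move=> v; apply/(cvgrPdist_lt (FF := nbhs_filter v)) => e e0.
near=> w; rewrite (le_lt_trans (jC _ _))// -ltr_pdivlMl//.
near: w; apply: cvgr_dist_lt => //; by rewrite mulr_gt0// invr_gt0.
Unshelve. all: by end_near. Qed.

Lemma continuous_itv_bounded (T : R) (phi : R -> R) : continuous phi ->
  exists2 C, 0 <= C & forall t, t \in `]0, T[%R -> `|phi t| <= C.
Proof.
move=> cphi; have [T0|T0] := leP T 0.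
  exists 0 => // t; rewrite in_itv/= => /andP[t0 tT].
  by move: (lt_trans t0 tT); rewrite ltNge T0.
have [c _ cM] : exists2 c, c \in `[0, T]%R &
    forall t, t \in `[0, T]%R -> `|phi t| <= `|phi c|.
  apply: EVT_max; first exact: ltW.
  apply: continuous_subspaceT => x.
  by apply: continuous_comp; [exact: cphi|exact: norm_continuous].
by exists `|phi c| => // t; rewrite in_itv/= => /andP[t0 tT]; apply: cM; rewrite in_itv/= !ltW.
Qed.

Lemma bochner_scale (T : R) (phi : R -> R) (g : R -> dual V) (v : V) :
  continuous phi -> strongly_measurable (`]0, T[ : set RM) g ->
  (\int[mu]_(t in `]0%R, T[) (`|g t|)%:E < +oo)%E ->
  bochner_integral mu (`]0, T[ : set RM) (fun t => phi t *: g t) v =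
  \int[mu]_(t in `]0, T[) (phi t * g t v).
Proof.
move=> cphi mg gi; have mI : measurable (`]0, T[%classic : set RM) by exact: measurable_itv.
have mphi : measurable_fun (`]0, T[%classic : set RM) phi.
  by apply: measurable_funTS; exact: continuous_measurable_fun.
have [C C0 pC] := continuous_itv_bounded T cphi.
rewrite bochner_integral_dual//.
  by apply: strongly_measurableZ => //; exact/strongly_measurableP.
apply: (@le_lt_trans _ _ (\int[mu]_(t in `]0%R, T[) (C%:E * (`|g t|)%:E))%E).
  apply: ge0_le_integral => //.
  - apply/measurable_EFinP/strongly_measurable_norm => //.
    by apply: strongly_measurableZ => //; exact/strongly_measurableP.
  - by apply: measurable_funeM; apply/measurable_EFinP/strongly_measurable_norm.
  - by move=> t tI; rewrite lee_fin normrZ ler_wpM2r// pC.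
rewrite ge0_integralZl//; last exact/measurable_EFinP/strongly_measurable_norm.
by rewrite lte_mul_pinfty.
Qed.

Lemma test_function_continuous (T : R) (phi : R -> R) : test_function T phi ->
  continuous phi /\ continuous (derive1 phi).
Proof.
move=> [dphi _]; split=> x; apply/differentiable_continuous/derivable1_diffP.
  exact: (dphi 0%N).
exact: (dphi 1%N).
Qed.

(** The null set [N] is chosen before [v], so the test vector may depend on [s] and [t]. *)
Definition primitive_off (T : R) (u : R -> V) (g : R -> dual V) (N : set R) :=
  forall s t, 0 < s -> s < t -> t < T -> ~ N s -> ~ N t ->
  forall v, dotv (j (u t) - j (u s)) (j v) = \int[mu]_(r in `]s, t]) (g r v).

Lemma dense_linear_eq0 (A : set V) (l : V -> R) (C : R) : dense A ->
  (forall v w, `|l v - l w| <= C * `|v - w|) ->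
  (forall v, A v -> l v = 0) -> forall v, l v = 0.
Proof.
move=> dA lC lA v; apply/eqP; rewrite -normr_le0; apply/ler_addgt0Pr => e e0.
have C1 : 0 < `|C| + 1 by rewrite ltr_wpDl.
have r0 : 0 < e / (`|C| + 1) by rewrite divr_gt0.
have [|w [vw Aw]] := dA (ball v (e / (`|C| + 1))) _ (ball_open v _).
  by exists v; exact: ballxx.
rewrite add0r -(subr0 (l v)) -(lA w Aw) (le_trans (lC _ _))//.
move: vw; rewrite -ball_normE/= => vw.
apply: (@le_trans _ _ ((`|C| + 1) * (e / (`|C| + 1)))).
  rewrite (@le_trans _ _ (`|C| * `|v - w|)) ?ler_wpM2r ?ler_norm//.
  by apply: ler_pM => //; [rewrite lerDl|exact: ltW].
by rewrite mulrC divfK// gt_eqF.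
Qed.

Lemma negligible_countable_union (A : set V) (N : V -> set R) : countable A ->
  (forall v, mu.-negligible (N v)) -> mu.-negligible (\bigcup_(v in A) N v).
Proof.
move=> /countable_injP[f finj] Nv.
pose M n : set R := [set t | exists v, [/\ A v, f v = n & N v t]].
suff : mu.-negligible (\bigcup_n M n).
  apply: negligibleS => t [v Av Nt].
  by exists (f v) => //; exists v.
apply: negligible_bigcup => n; have [[v [Av fv]]|nA] := pselect (exists v, A v /\ f v = n).
  apply: (negligibleS _ (Nv v)) => t [w [Aw fw Nt]].
  by rewrite (finj v w) ?inE// fw fv.
rewrite (_ : M n = set0); first exact: negligible_set0.
by apply/seteqP; split => // t [v [Av fv _]]; apply: nA; exists v.
Qed.

Lemma gelfand_L1 (T : R) (u : R -> V) : in_L2 0 T u ->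
  strongly_measurable (`]0, T[ : set RM) (fun t => gelfand j (j (u t))) /\
  (\int[mu]_(t in `]0%R, T[) (`|gelfand j (j (u t))|)%:E < +oo)%E.
Proof.
move=> Lu; have [mu_ _] := Lu; have ui := in_L2_L1 Lu.
have mI : measurable (`]0, T[%classic : set RM) by exact: measurable_itv.
have mG : strongly_measurable (`]0, T[%classic : set RM) (fun t => gelfand j (j (u t))).
  exact: (strongly_measurable_comp gelfand_embed_continuous mu_).
have [C C0 jC] := gelfand_embed_le.
have GC t : `|gelfand j (j (u t))| <= C * `|u t|.
  have := jC (u t) 0; rewrite subr0 linear0 (_ : gelfand j 0 = 0) ?subr0//.
  by apply: dual_ext => v; rewrite gelfandE linear0l.
split=> //.
apply: (@le_lt_trans _ _ (\int[mu]_(t in `]0%R, T[) (C%:E * (`|u t|)%:E))%E).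
  apply: ge0_le_integral => //.
  - exact/measurable_EFinP/strongly_measurable_norm.
  - by apply: measurable_funeM; exact/measurable_EFinP/strongly_measurable_norm.
  - by move=> t _; rewrite -EFinM lee_fin.
rewrite ge0_integralZl//; last 2 first.
- exact/measurable_EFinP/strongly_measurable_norm.
- by rewrite lee_fin ltW.
by rewrite lte_mul_pinfty// lee_fin ltW.
Qed.

(** The lemma of du Bois-Reymond gives, for each [v], an exceptional null set of non-Lebesgue
    points. The union over a countable dense set of vectors is still null, and the identity extends
    to all [v] because both sides are Lipschitz in [v]. *)
Lemma weak_derivative_primitive (T : R) (u : R -> V) (g : R -> dual V) :
  separable V -> in_L2 0 T u -> in_L2 0 T g -> is_weak_derivative j T u g ->
  exists2 N, mu.-negligible N & primitive_off T u g N.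
Proof.
move=> [A cA dA] Lu Lg ug.
have [mu_ _] := Lu; have [mg _] := Lg.
have gi := in_L2_L1 Lg.
have mI : measurable (`]0, T[%classic : set RM) by exact: measurable_itv.
pose G t : dual V := gelfand j (j (u t)).
have [mG Gi] := gelfand_L1 Lu.
pose p v t : R := G t v; pose q v t : R := g t v.
have ip v : mu.-integrable (`]0, T[ : set RM) (EFin \o p v).
  exact: (integrable_pairing mI v mG Gi).
have iq v : mu.-integrable (`]0, T[ : set RM) (EFin \o q v).
  exact: (integrable_pairing mI v mg gi).
have pq v phi : test_function T phi ->
    \int[mu]_(t in `]0, T[) (derive1 phi t * p v t) =
    - \int[mu]_(t in `]0, T[) (phi t * q v t).
  move=> tphi; have [cphi cphi'] := test_function_continuous tphi.
  by rewrite -(bochner_scale v cphi' mG Gi) -(bochner_scale v cphi mg gi) ug.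
pose N v : set R := ~` [set t | lebesgue_pt (p v \_ `]0, T[) t].
have nN v : mu.-negligible (N v).
  exact: (lebesgue_differentiation (integrable_locally mI (ip v))).
exists (\bigcup_(v in A) N v); first exact: negligible_countable_union.
move=> s t s0 st tT Ns Nt.
have mJ : measurable (`]s, t]%classic : set RM) by exact: measurable_itv.
have JI : `]s, t]%classic `<=` `]0, T[%classic.
  move=> r /=; rewrite !in_itv/= => /andP[sr rt].
  by rewrite (lt_trans s0 sr) (le_lt_trans rt tT).
have mgJ : strongly_measurable (`]s, t]%classic : set RM) g by exact: strongly_measurableS mg.
have giJ : (\int[mu]_(r in `]s, t]) (`|g r|)%:E < +oo)%E.
  apply: le_lt_trans gi; apply: ge0_subset_integral => //.
  exact/measurable_EFinP/strongly_measurable_norm.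
pose K := fine (\int[mu]_(r in `]s, t]) (`|g r|)%:E)%E.
pose l v := dotv (j (u t) - j (u s)) (j v) - \int[mu]_(r in `]s, t]) (g r v).
have lB v w : l v - l w = dotv (j (u t) - j (u s)) (j (v - w)) -
    \int[mu]_(r in `]s, t]) (g r (v - w)).
  have -> : j (v - w) = j v - j w by rewrite linearB.
  rewrite /l dotBr.
  have -> : \int[mu]_(r in `]s, t]) (g r (v - w)) =
      \int[mu]_(r in `]s, t]) (g r v) - \int[mu]_(r in `]s, t]) (g r w).
    rewrite -RintegralB//; [|exact: (integrable_pairing mJ _ mgJ giJ)..].
    by apply: eq_Rintegral => r _; rewrite linearB.
  by ring.
have [Cj Cj0 jCj] := embed_bound.
have H0 := @dense_linear_eq0 A l (`|j (u t) - j (u s)| * Cj + K) dA.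
suff : forall v, l v = 0 by move=> + v => /(_ v)/eqP; rewrite subr_eq0 => /eqP.
apply: H0 => [v w|v Av].
  rewrite lB (le_trans (ler_normB _ _))// mulrDl lerD//.
    rewrite (le_trans (dot_norm_le _ _))// -mulrA ler_wpM2l//.
  rewrite -lee_fin (le_trans (le_pairing_integral mJ _ mgJ giJ))// EFinM muleC.
  by rewrite /K fineK// ge0_fin_numE// integral_ge0.
apply/eqP; rewrite subr_eq0 dotBl; apply/eqP.
apply: (du_bois_reymond (ip v) (iq v) (pq v)) => //.
  by apply: contrapT => Hs; apply: Ns; exists v.
by apply: contrapT => Ht; apply: Nt; exists v.
Qed.

End WeakDerivative.

(** * The energy identity *)

Section IntegralBound.
Context {d} {T : measurableType d} {R : realType}.
Variables (nu : {measure set T -> \bar R}) (D : set T).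
Hypothesis mD : measurable D.
Implicit Types (f g : T -> R) (A B c : R).

(** Bundling measurability and positivity with the bound lets estimates be added and scaled without
    repeating side conditions. *)
Definition int_le f A := [/\ measurable_fun D f, forall x, D x -> 0 <= f x &
  (\int[nu]_(x in D) (f x)%:E <= A%:E)%E].

Lemma int_leD f g A B : int_le f A -> int_le g B ->
  int_le (fun x => f x + g x) (A + B).
Proof.
move=> [mf f0 fA] [mg g0 gB]; split; first exact: measurable_funD.
  by move=> x Dx; rewrite addr_ge0 ?f0 ?g0.
under eq_integral do rewrite EFinD.
by rewrite ge0_integralD//; [rewrite EFinD leeD|exact/measurable_EFinP..].
Qed.

Lemma int_leZ c f A : 0 <= c -> int_le f A -> int_le (fun x => c * f x) (c * A).
Proof.
move=> c0 [mf f0 fA]; split; first exact: measurable_funM.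
  by move=> x Dx; rewrite mulr_ge0 ?f0.
under eq_integral do rewrite EFinM.
by rewrite ge0_integralZl//; [rewrite EFinM lee_wpmul2l|exact/measurable_EFinP].
Qed.

Lemma int_leW f g A B : measurable_fun D f -> (forall x, D x -> 0 <= f x) ->
  (forall x, D x -> f x <= g x) -> A <= B -> int_le g A -> int_le f B.
Proof.
move=> mf f0 fg AB [mg g0 gA]; split => //.
apply: (@le_trans _ _ A%:E); last by rewrite lee_fin.
apply: le_trans gA; apply: ge0_le_integral => //.
- exact/measurable_EFinP.
- exact/measurable_EFinP.
Qed.

End IntegralBound.

Section Energy.
Context {R : realType} {V H : hilbertType R} (j : gelfand_embedding V H).
Notation mu := (@lebesgue_measure R).
Notation RM := (measurableTypeR R).

Lemma measurable_pairing {d} {S : measurableType d} (a : S -> dual V) (b : S -> V) :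
  strongly_measurable setT a -> strongly_measurable setT b ->
  measurable_fun setT (fun x => a x (b x) : R).
Proof.
move=> ma mb; apply/strongly_measurableP => //.
exact: (strongly_measurable_comp2 (@pairing_continuous R V) ma mb).
Qed.

(* Young's inequality with a free parameter stands in for Cauchy-Schwarz. *)
Lemma young (eta a b : R) : 0 < eta -> a * b <= eta^-1 * a ^+ 2 + eta * b ^+ 2.
Proof.
move=> e0; have e1 : 0 < eta^-1 by rewrite invr_gt0.
have : 0 <= eta^-1 * (a - eta * b / 2) ^+ 2 by rewrite mulr_ge0 ?sqr_ge0 ?ltW.
have -> : eta^-1 * (a - eta * b / 2) ^+ 2 = eta^-1 * a ^+ 2 - a * b + eta * b ^+ 2 / 4.
  by field; rewrite gt_eqF.
have : 0 <= eta * b ^+ 2 by rewrite mulr_ge0 ?sqr_ge0 ?ltW.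
by set x := a * b; set y := eta^-1 * _; set z := eta * _; lra.
Qed.

(** Split into [(f' - f) (v' + v) + f (v' - v)]. Young's inequality puts the large weight [eta^-1]
    on the differences, which will be small, and [eta] on the terms that are merely bounded. *)
Lemma pairing_diff_le (eta : R) (f f' : dual V) (v v' : V) : 0 < eta ->
  `|f' (v' + v) - 2 * f v| <= eta^-1 * `|f' - f| ^+ 2 +
    (2 * eta * `|v'| ^+ 2 + (2 * eta * `|v| ^+ 2 +
    (eta * `|f| ^+ 2 + eta^-1 * `|v' - v| ^+ 2))).
Proof.
move=> e0.
have -> : f' (v' + v) - 2 * f v = (f' - f) (v' + v) + f (v' - v).
  by rewrite dualB linearB/= !linearD/=; ring.
rewrite (le_trans (ler_normD _ _))//.
have h1 : `|(f' - f) (v' + v)| <= eta^-1 * `|f' - f| ^+ 2 + eta * `|v' + v| ^+ 2.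
  by rewrite (le_trans (le_dual _ _))// young.
have h2 : `|f (v' - v)| <= eta^-1 * `|v' - v| ^+ 2 + eta * `|f| ^+ 2.
  by rewrite (le_trans (le_dual _ _))// mulrC young.
have h3 : eta * `|v' + v| ^+ 2 <= eta * (2 * `|v'| ^+ 2 + 2 * `|v| ^+ 2).
  by rewrite ler_wpM2l ?sqr_normD_le// ltW.
rewrite (le_trans (lerD h1 h2))//.
move: h3; rewrite mulrDr !(mulrCA eta 2) -!(mulrA 2 eta).
lra.
Qed.

(** The two shifts vary independently since later [h] is fixed while [s] runs over []0, h]]. *)
Lemma L2_pairing_modulus (u : RM -> V) (g : RM -> dual V) (e : R) :
  L2fun u -> L2fun g -> 0 < e ->
  exists2 d : R, 0 < d & forall h s, `|h| < d -> `|s| < d ->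
  (\int[mu]_r (`|g (r + s)%R (u (r + h)%R + u r)%R - 2 * g r (u r)|)%:E <= e%:E)%E.
Proof.
move=> Lu Lg e0.
have suE : (sqn u = (fine (sqn u))%:E)%E by rewrite fineK// ge0_fin_numE ?sqn_ge0//; case: Lu.
have sgE : (sqn g = (fine (sqn g))%:E)%E by rewrite fineK// ge0_fin_numE ?sqn_ge0//; case: Lg.
set U := fine (sqn u) in suE; set G := fine (sqn g) in sgE.
have U0 : 0 <= U by rewrite fine_ge0 ?sqn_ge0.
have G0 : 0 <= G by rewrite fine_ge0 ?sqn_ge0.
(* First [eta] makes the bounded terms [eta * (4 * U + G)] at most [e / 2]; then translations are
   taken so small that the two terms with [eta^-1] contribute [e / 4] each. *)
pose K := 4 * U + G + 1.
have K0 : 0 < K by rewrite ltr_wpDl// addr_ge0// mulr_ge0.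
pose eta := e / (2 * K); have eta0 : 0 < eta by rewrite divr_gt0// mulr_gt0.
pose e' := eta * e / 4; have e'0 : 0 < e' by rewrite divr_gt0// mulr_gt0.
have [d1 /= d10 D1] := L2_translation Lu e'0.
have [d2 /= d20 D2] := L2_translation Lg e'0.
exists (Num.min d1 d2); first by rewrite lt_min d10.
move=> h s; rewrite !lt_min => /andP[h1 _] /andP[_ s2].
have {D1}hu : (sqn (fun t => u (t + h) - u t)%R <= e'%:E)%E.
  by apply: D1; rewrite /= sub0r normrN.
have {D2}sg : (sqn (fun t => g (t + s) - g t)%R <= e'%:E)%E.
  by apply: D2; rewrite /= sub0r normrN.
have [mu_ _] := Lu; have [mg _] := Lg.
have [muh _] := L2fun_shift h Lu; have [mgs _] := L2fun_shift s Lg.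
have mdu := strongly_measurableB muh mu_; have mdg := strongly_measurableB mgs mg.
have mX : measurable_fun (setT : set RM)
    (fun r => `|g (r + s) (u (r + h) + u r) - 2 * g r (u r)|).
  apply: measurableT_comp => //; apply: measurable_funB.
    by apply: measurable_pairing => //; exact: strongly_measurableD.
  by apply: measurable_funM => //; exact: measurable_pairing.
have sqnP (E : normedModType R) (f : RM -> E) (A : R) :
    strongly_measurable (setT : set RM) f -> (sqn f <= A%:E)%E ->
    int_le mu setT (fun t => `|f t| ^+ 2) A.
  move=> mf fA; split=> //.
  exact/measurable_funX/strongly_measurable_norm.
have i1 : 0 <= eta^-1 by rewrite invr_ge0 ltW.
have i2 : 0 <= 2 * eta by rewrite mulr_ge0// ltW.
have : int_le mu setT (fun r => `|g (r + s) (u (r + h) + u r) - 2 * g r (u r)|)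
    (eta^-1 * e' + (2 * eta * U + (2 * eta * U + (eta * G + eta^-1 * e')))).
  apply: (int_leW measurableT mX _ (fun x _ => pairing_diff_le _ _ _ _ eta0) (lexx _)) => //.
  apply: int_leD => //; first by apply: int_leZ => //; exact: sqnP.
  apply: int_leD => //.
    by apply: int_leZ => //; apply: sqnP => //; rewrite sqn_shift// suE.
  apply: int_leD => //; first by apply: int_leZ => //; apply: sqnP => //; rewrite suE.
  apply: int_leD => //.
    by apply: int_leZ; [by []|exact: ltW|]; apply: sqnP => //; rewrite sgE.
  by apply: int_leZ => //; exact: sqnP.
case=> _ _ /le_trans; apply; rewrite lee_fin.
have -> : eta^-1 * e' = e / 4 by rewrite /e'; field; rewrite gt_eqF.
have -> : e / 4 + (2 * eta * U + (2 * eta * U + (eta * G + e / 4))) =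
    e / 2 + eta * (4 * U + G) by field.
have : eta * (4 * U + G) <= eta * K by rewrite ler_wpM2l ?(ltW eta0)// /K lerDl.
have -> : eta * K = e / 2 by rewrite /eta; field; rewrite gt_eqF.
by rewrite -(lerD2l (e / 2)) => /le_trans; apply; rewrite -splitr.
Qed.

Lemma Rintegral_shift (f : RM -> R) (a b h : R) :
  measurable_fun (setT : set RM) f ->
  \int[mu]_(r in `]a, b]) f (r + h) = \int[mu]_(r in `](a + h)%R, (b + h)%R]) f r.
Proof.
move=> mf; rewrite /Rintegral; congr fine.
have mfh : measurable_fun (setT : set RM) (fun r : RM => f (r + h)).
  exact: measurableT_comp mf (measurable_shift h).
have S (g : RM -> R) : measurable_fun (setT : set RM) g -> (forall r, 0 <= g r) ->
    (\int[mu]_(r in `]a, b]) (g (r + h)%R)%:E =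
     \int[mu]_(r in `](a + h)%R, (b + h)%R]) (g r)%:E)%E.
  move=> mg g0; rewrite [LHS]integral_mkcond [RHS]integral_mkcond.
  rewrite -[RHS](fun m p => @ge0_integral_shift R _ h m p); last 2 first.
  - by apply/(measurable_restrictT _ _).1 => //; apply/measurable_EFinP; exact: measurable_funTS.
  - by move=> x; rewrite /patch; case: ifP => // _; rewrite lee_fin.
  apply: eq_integral => r _; rewrite /patch /=.
  have -> : (r \in `]a, b]%classic) = (r + h \in `](a + h), (b + h)]%classic).
    by apply/idP/idP; rewrite !inE/= !in_itv/= ltrD2r lerD2r.
  by [].
rewrite [LHS]integralE [RHS]integralE; congr (_ - _)%E.
  transitivity (\int[mu]_(r in `]a, b]) (Num.max (f (r + h)%R) 0)%:E)%E.
    by apply: eq_integral => r _; rewrite EFin_max ?funeposE ?funenegE.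
  rewrite (S (fun r => Num.max (f r) 0)).
  - by apply: eq_integral => r _; rewrite EFin_max ?funeposE ?funenegE.
  - exact: measurable_maxr.
  - by move=> r; rewrite le_max lexx orbT.
transitivity (\int[mu]_(r in `]a, b]) (Num.max (- f (r + h)%R) 0)%:E)%E.
  by apply: eq_integral => r _; rewrite EFin_max ?funeposE ?funenegE.
rewrite (S (fun r => Num.max (- f r) 0)).
- by apply: eq_integral => r _; rewrite EFin_max ?funeposE ?funenegE.
- by apply: measurable_maxr => //; exact: measurableT_comp.
- by move=> r; rewrite le_max lexx orbT.
Qed.

Section Primitive.
Variable E : RM -> R.
Hypothesis iE : mu.-integrable setT (EFin \o E).

Let sub D : measurable D -> mu.-integrable D (EFin \o E).
Proof. by move=> mD; exact: integrableS iE. Qed.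

Definition primitive (y : R) := \int[mu]_(r in [set` Interval -oo%O (BRight y)]) E r.

Lemma primitiveB x y : x <= y ->
  \int[mu]_(r in `]x, y]) E r = primitive y - primitive x.
Proof.
by move=> xy; rewrite /primitive Rintegral_itvB//; exact: sub (measurable_itv _).
Qed.

Lemma cvg_right_average (x : R) : lebesgue_pt E x ->
  (h^-1 * \int[mu]_(r in `]x, (x + h)%R]) E r) @[h --> (0 : R)^'+] --> E x.
Proof.
move=> Ex; have x1 : x < x + 1 by rewrite ltrDl.
have x0 : (-oo%O < BRight x)%E by exact: ltNyr.
have [dF EF] := FTC1_lebesgue_pt x1 (sub (measurable_itv `]-oo, x + 1])) x0 Ex.
have dF' : h^-1 *: (primitive (h *: 1 + x) - primitive x) @[h --> (0 : R)^'] --> E x.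
  by rewrite -EF derive1E; exact: dF.
apply: cvg_trans (cvg_dnbhs_at_right dF').
apply: near_eq_cvg; near=> h.
by rewrite primitiveB ?lerDl// [h *: 1]mulr1 (addrC h).
Unshelve. all: by end_near. Qed.

End Primitive.

(* The hypothesis says that [E] is differentiable in L^1 with derivative [k].
   Dividing by [h], both sides converge at the Lebesgue points of [E]. *)
Lemma lebesgue_pt_difference (E k : RM -> R) (s t : R) : s < t ->
  mu.-integrable setT (EFin \o E) -> mu.-integrable setT (EFin \o k) ->
  lebesgue_pt E s -> lebesgue_pt E t ->
  (forall e : R, 0 < e -> exists2 d : R, 0 < d & forall h : R, 0 < h -> h < d ->
    (\int[mu]_(r in `]s, t]) (`|E (r + h)%R - E r - h * k r|)%:E <= (h * e)%:E)%E) ->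
  E t - E s = \int[mu]_(r in `]s, t]) k r.
Proof.
move=> st iE ik Es Et Ek.
have mE : measurable_fun (setT : set RM) E by case/integrableP: iE => /measurable_EFinP.
have mk : measurable_fun (setT : set RM) k by case/integrableP: ik => /measurable_EFinP.
have mI : measurable (`]s, t]%classic : set RM) by exact: measurable_itv.
have sub (f : RM -> R) D : mu.-integrable setT (EFin \o f) -> measurable D ->
    mu.-integrable D (EFin \o f) by move=> fi mD; exact: integrableS fi.
have iEh h : mu.-integrable setT (EFin \o (fun r : RM => E (r + h))).
  apply/integrable_EFinP => //; split; first exact: measurableT_comp mE (measurable_shift h).
  rewrite (ge0_integral_shift (f := fun r => (`|E r|)%:E)) => //.
    by move: iE => /integrable_EFinP[].
  by apply/measurable_EFinP; exact: measurableT_comp.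
(* After a shift, [A h] is also [h^-1] times the integral of [E (r + h) - E r] over []s, t]]. The
   first form converges at the Lebesgue points, the second by the hypothesis on [k]. *)
pose A h := h^-1 * \int[mu]_(r in `]t, (t + h)%R]) E r - h^-1 * \int[mu]_(r in `]s, (s + h)%R]) E r.
have AE : A h @[h --> (0 : R)^'+] --> E t - E s.
  by apply: cvgB; exact: cvg_right_average.
have Ak : A h @[h --> (0 : R)^'+] --> \int[mu]_(r in `]s, t]) k r.
  apply/cvgrPdist_le => e e0; have [d d0 D] := Ek e e0.
  near=> h; have h0 : 0 < h by [].
  have -> : \int[mu]_(r in `]s, t]) k r - A h =
      - h^-1 * \int[mu]_(r in `]s, t]) (E (r + h)%R - E r - h * k r).
    rewrite RintegralB//; last 2 first.
    - exact: (integrableB mI (sub _ _ (iEh h) mI) (sub _ _ iE mI)).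
    - exact: (integrableZl mI h (sub _ _ ik mI)).
    rewrite RintegralB//; [|exact: sub..].
    rewrite RintegralZl//; last exact: sub.
    rewrite Rintegral_shift// /A !primitiveB ?lerDl ?(ltW h0) ?lerD2r ?(ltW st)//.
    by field; rewrite gt_eqF.
  have hV : 0 < h^-1 by rewrite invr_gt0.
  rewrite normrM normrN (gtr0_norm hV) ler_pdivrMl//.
  have hd : h < d by near: h; exact: nbhs_right_lt.
  rewrite -lee_fin (le_trans _ (D h h0 hd))//.
  apply: EFin_Rintegral_le => //; apply: measurable_funTS.
  apply: measurable_funB; last exact: measurable_funM.
  by apply: measurable_funB => //; exact: measurableT_comp mE (measurable_shift h).
by apply: cvg_unique AE Ak.
Unshelve. all: by end_near. Qed.

End Energy.

(** * Averaging over intermediate times and the energy increment *)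

Lemma tonelli_on {d1 d2} {T1 : measurableType d1} {T2 : measurableType d2}
    {R : realType} (m1 : {sigma_finite_measure set T1 -> \bar R})
    (m2 : {sigma_finite_measure set T2 -> \bar R}) (D : set T2)
    (f : T1 * T2 -> \bar R) : measurable D -> measurable_fun setT f ->
  (forall z, 0 <= f z)%E ->
  measurable_fun setT (fun x => \int[m2]_(y in D) f (x, y))%E /\
  (\int[m1]_x \int[m2]_(y in D) f (x, y) = \int[m2]_(y in D) \int[m1]_x f (x, y))%E.
Proof.
move=> mD mf f0.
pose h := f \_ (setT `*` D).
have mh : measurable_fun setT h.
  apply/(measurable_restrictT _ _).1; first exact: measurableX.
  exact: measurable_funTS.
have h0 z : (0 <= h z)%E by rewrite /h /patch; case: ifP.
have hE x y : h (x, y) = ((fun y => f (x, y)) \_ D) y.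
  rewrite /h /patch; have -> : ((x, y) \in setT `*` D) = (y \in D); last by [].
  by apply/idP/idP; rewrite !inE/=; [case|].
have FE : (fun x => \int[m2]_(y in D) f (x, y))%E = (fun x => \int[m2]_y h (x, y))%E.
  by apply/funext => x; rewrite integral_mkcond; apply: eq_integral => y _; rewrite hE.
rewrite FE; split; first exact: measurable_fun_fubini_tonelli_F.
rewrite fubini_tonelli; [|exact: mh|exact: h0].
rewrite [RHS]integral_mkcond; apply: eq_integral => y _.
rewrite /patch; case: ifPn => yD; first by apply: eq_integral => x _; rewrite hE patchE yD.
by apply: integral0_eq => x _; rewrite hE patchE (negbTE yD).
Qed.

(** By Tonelli, a bound on the slices that is uniform in [y] survives integration over [D]. In the
    energy increment [y] runs over []0, h]], whose length yields the factor [h]. *)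
Lemma ge0_le_iterated_integral {d1 d2} {T1 : measurableType d1} {T2 : measurableType d2}
    {R : realType} (m1 : {sigma_finite_measure set T1 -> \bar R})
    (m2 : {sigma_finite_measure set T2 -> \bar R}) (A : set T1) (D : set T2)
    (a : T1 -> R) (X : T1 * T2 -> R) (c : R) :
  measurable A -> measurable D -> measurable_fun setT X -> (forall z, 0 <= X z) ->
  measurable_fun A a -> (forall x, 0 <= a x) ->
  {ae m1, forall x, A x -> ((a x)%:E <= \int[m2]_(y in D) (X (x, y))%:E)%E} ->
  (forall y, D y -> (\int[m1]_x (X (x, y))%:E <= c%:E)%E) ->
  (\int[m1]_(x in A) (a x)%:E <= c%:E * m2 D)%E.
Proof.
move=> mA mD mX X0 ma a0 aX Xc.
have mX' : measurable_fun setT (EFin \o X) by exact/measurable_EFinP.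
have X0' z : (0 <= (EFin \o X) z)%E by rewrite /= lee_fin.
have [mF FE] := tonelli_on m1 m2 mD mX' X0'.
have F0 x : (0 <= \int[m2]_(y in D) (X (x, y))%:E)%E.
  by apply: integral_ge0 => y _; exact: (X0' (x, y)).
apply: (@le_trans _ _ (\int[m1]_(x in A) \int[m2]_(y in D) (X (x, y))%:E)%E).
  apply: ae_ge0_le_integral; [exact: mA| | | | |exact: aX].
  - by move=> x _; rewrite lee_fin.
  - exact/measurable_EFinP.
  - by move=> x _; exact: F0.
  - exact: measurable_funTS mF.
apply: (@le_trans _ _ (\int[m1]_x \int[m2]_(y in D) (X (x, y))%:E)%E).
  apply: ge0_subset_integral; [exact: mA|exact: measurableT|exact: mF| |exact: subsetT].
  by move=> x _; exact: F0.
rewrite FE -integral_cst//; apply: ge0_le_integral; [exact: mD| | | |exact: Xc].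
- by move=> y _; apply: integral_ge0 => x _; exact: (X0' (x, y)).
- exact: measurable_funTS (measurable_fun_fubini_tonelli_G _ mX' X0').
- exact: measurable_cst.
Qed.

Lemma le_integrable_real {d} {S : measurableType d} {R : realType}
    (nu : {measure set S -> \bar R}) (D : set S) (f g : S -> R) :
  measurable D -> measurable_fun D f -> (forall x, D x -> `|f x| <= g x) ->
  nu.-integrable D (EFin \o g) -> nu.-integrable D (EFin \o f).
Proof.
move=> mD mf fg ig; apply: (le_integrable mD _ _ ig); first exact/measurable_EFinP.
by move=> x Dx; rewrite /= lee_fin (le_trans (fg _ Dx))// ler_norm.
Qed.

Lemma integrable_cst_lt {d} {S : measurableType d} {R : realType}
    (nu : {measure set S -> \bar R}) (D : set S) (c : R) :
  measurable D -> (nu D < +oo)%E -> nu.-integrable D (EFin \o (fun=> c)).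
Proof.
move=> mD nuD; apply: measurable_bounded_integrable => //.
exists `|c|; split=> [|M cM x _ /=]; first exact: normr_real.
exact: ltW.
Qed.

Section EnergyIdentity.
Context {R : realType} {V H : hilbertType R} (j : gelfand_embedding V H).
Notation mu := (@lebesgue_measure R).
Notation RM := (measurableTypeR R).

Lemma negligible_shift (N : set R) (h : R) :
  mu.-negligible N -> mu.-negligible [set r | N (r + h)].
Proof.
move=> [A [mA A0 NA]]; exists ((fun r : RM => r + h) @^-1` A); split.
- rewrite -[X in measurable X]setTI; exact: measurable_shift.
- exact: (eq_trans (lebesgue_measure_shift h mA) A0).
- by move=> r /NA.
Qed.

Lemma sqr_embed_le : exists2 C : R, 0 < C & forall v, `|j v| ^+ 2 <= C * `|v| ^+ 2.
Proof.
have [C C0 jC] := embed_bound j; exists (C ^+ 2); first by rewrite exprn_gt0.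
by move=> v; rewrite -exprMn lerXn2r ?nnegrE// mulr_ge0// ltW.
Qed.

Lemma integrable_sqr {E : normedModType R} (f : RM -> E) : L2fun f ->
  mu.-integrable (setT : set RM) (EFin \o (fun t => `|f t| ^+ 2)).
Proof.
move=> [mf fi]; apply: (integrable_dominated measurableT (g := fun t => `|f t| ^+ 2)) => //.
- by apply: measurable_funX; exact: strongly_measurable_norm.
- by apply: measurable_funX; exact: strongly_measurable_norm.
- by move=> x _; rewrite ger0_norm.
Qed.

Lemma measurable_sqr_embed (u : RM -> V) : strongly_measurable setT u ->
  measurable_fun (setT : set RM) (fun r => `|j (u r)| ^+ 2).
Proof.
move=> mu_; apply: measurable_funX; apply: strongly_measurable_norm => //.
exact: (strongly_measurable_comp (@embed_continuous _ _ _ j) mu_).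
Qed.

Lemma integrable_sqr_embed (u : RM -> V) : L2fun u ->
  mu.-integrable (setT : set RM) (EFin \o (fun t => `|j (u t)| ^+ 2)).
Proof.
move=> Lu; have [mu_ ui] := Lu; have [C C0 jC] := sqr_embed_le.
have iC : mu.-integrable (setT : set RM) (EFin \o (fun t => C * `|u t| ^+ 2)).
  exact: (integrableZl measurableT C (integrable_sqr Lu)).
apply: (le_integrable_real measurableT _ _ iC) => [|x _]; last by rewrite ger0_norm.
exact: measurable_sqr_embed.
Qed.

Lemma pairing_le (f : dual V) (v : V) : `|f v| <= `|f| ^+ 2 + `|v| ^+ 2.
Proof. by rewrite (le_trans (le_dual _ _))// (le_trans (young _ _ ltr01))// invr1 !mul1r. Qed.

Lemma integrable_pairing_L2 (u : RM -> V) (g : RM -> dual V) : L2fun u -> L2fun g ->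
  mu.-integrable (setT : set RM) (EFin \o (fun t => g t (u t))).
Proof.
move=> Lu Lg; have [mu_ _] := Lu; have [mg _] := Lg.
have := integrableD measurableT (integrable_sqr Lg) (integrable_sqr Lu).
apply: (le_integrable_real measurableT) => [|t _]; last exact: pairing_le.
exact: measurable_pairing.
Qed.

Lemma measurable_energy_integrand (u : RM -> V) (g : RM -> dual V) (h : R) :
  strongly_measurable setT u -> strongly_measurable setT g ->
  measurable_fun (setT : set (RM * RM))
    (fun z => `|g (z.1 + z.2) (u (z.1 + h) + u z.1) - 2 * g z.1 (u z.1)|).
Proof.
move=> mu_ mg.
have m1 : measurable_fun (setT : set (RM * RM)) (fun z => z.1 + z.2 : RM).
  exact: measurable_funD.
have m2 : measurable_fun (setT : set (RM * RM)) (fun z => z.1 + h : RM).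
  exact: measurable_funD.
apply: measurableT_comp => //; apply: measurable_funB.
  apply: measurable_pairing.
    exact: (strongly_measurable_precomp m1 _ mg).
  apply: strongly_measurableD; first exact: (strongly_measurable_precomp m2 _ mu_).
  exact: (strongly_measurable_precomp measurable_fst _ mu_).
apply: measurable_funM => //; apply: measurable_pairing.
  exact: (strongly_measurable_precomp measurable_fst _ mg).
exact: (strongly_measurable_precomp measurable_fst _ mu_).
Qed.

Lemma energy_increment (T : R) (u : RM -> V) (g : RM -> dual V) (N : set R) (s t e : R) :
  L2fun u -> L2fun g -> mu.-negligible N -> primitive_off j T u g N ->
  0 < s -> s < t -> t < T -> 0 < e ->
  exists2 d : R, 0 < d & forall h : R, 0 < h -> h < d ->
    (\int[mu]_(r in `]s, t]) (`|(`|j (u (r + h))| ^+ 2 - `|j (u r)| ^+ 2 - h * (2 * g r (u r)))%R|)%:E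
     <= (h * e)%:E)%E.
Proof.
move=> Lu Lg nN P s0 st tT e0; have [mu_ _] := Lu; have [mg _] := Lg.
have [d d0 D] := L2_pairing_modulus Lu Lg e0.
(* The bound by [T - t] keeps [r + h] below [T] for [r <= t], where the primitive formula
   applies. *)
exists (Num.min d (T - t)); first by rewrite lt_min d0 subr_gt0.
move=> h h0; rewrite lt_min => /andP[hd hT].
pose X (z : RM * RM) := `|g (z.1 + z.2) (u (z.1 + h) + u z.1) - 2 * g z.1 (u z.1)|.
have mX : measurable_fun (setT : set (RM * RM)) X by exact: measurable_energy_integrand.
have X0 z : 0 <= X z by exact: normr_ge0.
have mI : measurable (`]s, t]%classic : set RM) by exact: measurable_itv.
have mJ : measurable (`]0, h]%classic : set RM) by exact: measurable_itv.
have muJE : mu (`]0%R, h]%classic : set RM) = h%:E.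
  by rewrite lebesgue_measure_itv/= lte_fin h0 oppr0 adde0.
have muJ : (mu (`]0%R, h]%classic : set RM) < +oo)%E by rewrite muJE ltry.
rewrite mulrC EFinM -muJE.
have mE := measurable_sqr_embed mu_.
have mEh := measurableT_comp mE (measurable_shift h).
have mk : measurable_fun (setT : set RM) (fun r => h * (2 * g r (u r))).
  by do 2! apply: measurable_funM => //; exact: measurable_pairing.
have mL : measurable_fun (setT : set RM)
    (fun r => `|(`|j (u (r + h))| ^+ 2 - `|j (u r)| ^+ 2 - h * (2 * g r (u r)))|).
  by apply: measurableT_comp => //; do 2 apply: measurable_funB => //.
apply: (ge0_le_iterated_integral mI mJ mX X0 (measurable_funTS mL)); last 1 first.
- move=> x; rewrite /= in_itv/= => /andP[x0 xh].
  by apply: D; rewrite gtr0_norm// (le_lt_trans xh).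
- by move=> x; exact: normr_ge0.
(* The pointwise bound can only fail where [r] or [r + h] lies in [N]. *)
apply: (negligibleS _ (negligibleU nN (negligible_shift h nN))) => r.
move=> Hr; apply: contrapT => /not_orP[Nr Nrh]; apply: Hr => /=.
rewrite in_itv/= => /andP[sr rt].
have rh : r < r + h by rewrite ltrDl.
have rhT : r + h < T by rewrite -ltrBrDl; apply: lt_le_trans hT _; rewrite lerD2l lerN2.
set v := u (r + h) + u r.
have Pv := P r (r + h) (lt_trans s0 sr) rh rhT Nr Nrh v.
have ev : measurable_fun (setT : set RM) (fun x => g x v : R).
  by apply: measurable_pairing => //; exact: strongly_measurable_cst.
have mgs : measurable_fun (setT : set RM) (fun x : RM => g (x + r) v : R).
  exact: measurableT_comp ev (measurable_shift r).
have igs : mu.-integrable (`]0, h] : set RM) (EFin \o (fun x : RM => g (x + r) v : R)).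
  have iS := integrableD mJ (integrableS measurableT mJ (@subsetT _ _) (integrable_sqr (L2fun_shift r Lg)))
    (integrable_cst_lt (`|v| ^+ 2) mJ muJ).
  apply: (le_integrable_real mJ _ _ iS) => [|x _]; first exact: measurable_funTS.
  exact: pairing_le.
(* The difference of squares is the increment of [j u] paired with the image of
   [v = u (r + h) + u r]; the primitive formula tested on this [v] turns it into an integral of
   [g]. *)
have -> : `|j (u (r + h))| ^+ 2 - `|j (u r)| ^+ 2 - h * (2 * g r (u r)) =
    \int[mu]_(x in `]0, h]) (g (x + r) v - 2 * g r (u r)).
  rewrite sqr_normBD -linearD Pv (RintegralB mJ igs (integrable_cst_lt _ mJ muJ)).
  have -> := Rintegral_shift 0 h r ev.
  rewrite add0r (addrC h); congr (_ - _).
  rewrite (Rintegral_cst mu mJ) mulrC; congr (_ * _).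
  exact: (esym (congr1 fine muJE)).
apply: le_trans (EFin_Rintegral_le _ _ _) _ => //.
  by apply: measurable_funB => //; exact: measurable_funTS.
by under eq_integral do rewrite (addrC _ r).
Qed.

(** The exceptional times are the non-Lebesgue points of [|j (u r)| ^+ 2]; [N] enters only through a
    null set of integration variables. *)
Lemma energy_identity (T : R) (u : RM -> V) (g : RM -> dual V) (N : set R) :
  L2fun u -> L2fun g -> mu.-negligible N -> primitive_off j T u g N ->
  exists2 N', mu.-negligible N' & forall s t, 0 < s -> s < t -> t < T -> ~ N' s -> ~ N' t ->
    `|j (u t)| ^+ 2 - `|j (u s)| ^+ 2 = 2 * \int[mu]_(r in `]s, t]) (g r (u r)).
Proof.
move=> Lu Lg nN P.
have iE := integrable_sqr_embed Lu.
have iP := integrable_pairing_L2 Lu Lg.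
have ik := integrableZl measurableT 2 iP.
pose E r := `|j (u r)| ^+ 2.
exists (~` [set t | lebesgue_pt E t]).
  apply: lebesgue_differentiation.
  by have := integrable_locally measurableT iE; rewrite patch_setT.
move=> s t s0 st tT /contrapT Es /contrapT Et.
have mI : measurable (`]s, t]%classic : set RM) by exact: measurable_itv.
rewrite -RintegralZl//; last exact: (integrableS measurableT mI (@subsetT _ _) iP).
apply: (lebesgue_pt_difference st iE ik Es Et) => e e0.
have [d d0 D] := energy_increment Lu Lg nN P s0 st tT e0.
by exists d => // h; exact: D.
Qed.

End EnergyIdentity.

(** * Continuous representatives *)

Section DenseExtension.
Context {R : realType} (A G : set R).
Hypotheses (GA : G `<=` A) (AG : A `<=` closure G).

Lemma cvg_within_dense {S : topologicalType} (f : R -> S) (t : R) : A t ->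
  {within A, continuous f} -> f @ within G (nbhs t) --> f t.
Proof.
move=> At /subspace_continuousP/(_ t At) fA; apply: cvg_trans fA.
move=> B nB; have nB' : nbhs t [set s | A s -> B (f s)] := nB.
by change (nbhs t [set s | G s -> B (f s)]); apply: filterS nB' => s AB /GA.
Qed.

Lemma dense_eq {S : topologicalType} (f : R -> S) (c : S) : hausdorff_space S ->
  {within A, continuous f} -> (forall t, G t -> f t = c) -> forall t, A t -> f t = c.
Proof.
move=> hS cf fc t At; have PF : ProperFilter (within G (nbhs t)).
  by apply: within_nbhs_proper; exact: AG.
apply: (@cvg_unique _ hS (f @ within G (nbhs t))); first exact: cvg_within_dense.
have fc' : {near within G (nbhs t), cst c =1 f}.
  by rewrite near_withinE; apply: nearW => s Gs; rewrite fc.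
by apply: cvg_trans (near_eq_cvg fc') (cvg_cst c).
Qed.

Lemma sqr_lt_lt (x e : R) : 0 <= x -> 0 < e -> x ^+ 2 < e ^+ 2 -> x < e.
Proof. by move=> x0 e0; rewrite ltr_pXn2r// nnegrE// ltW. Qed.

(** The inequality makes [h] Cauchy along [G] at every point of [A], because [Phi] is continuous
    there. Passing to the limit in one argument and then in the other, the extension inherits the
    inequality and hence continuity. *)
Lemma dense_extension {E : completeNormedModType R} (h : R -> E) (Phi : R -> R) :
  {within A, continuous Phi} ->
  (forall s t, G s -> G t -> `|h s - h t| ^+ 2 <= `|Phi s - Phi t|) ->
  exists2 w : R -> E, {within A, continuous w} & forall t, G t -> w t = h t.
Proof.
move=> cPhi hPhi.
have PF t : A t -> ProperFilter (within G (nbhs t)).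
  by move=> At; apply: within_nbhs_proper; exact: AG.
have hcvg t : A t -> cvg (h @ within G (nbhs t)).
  move=> At; have FF := PF t At; apply: cauchy_cvg; apply: cauchy_exP => e /= e0.
  have e2 : 0 < e ^+ 2 / 2 by rewrite divr_gt0// exprn_gt0.
  have cP : \forall s \near within G (nbhs t), `|Phi t - Phi s| < e ^+ 2 / 2.
    exact: (cvgrPdist_lt (FF := FF) _ _).1 (cvg_within_dense At cPhi) _ e2.
  have nG : \forall s \near within G (nbhs t), G s by rewrite near_withinE; exact: nearW.
  have [s0 [Gs0 Ps0]] := filter_ex (filterI nG cP).
  exists (h s0); rewrite -ball_normE/=; apply: filterS (filterI nG cP) => s [Gs Ps].
  apply: sqr_lt_lt => //; rewrite (le_lt_trans (hPhi _ _ Gs0 Gs))//.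
  have -> : Phi s0 - Phi s = (Phi t - Phi s) - (Phi t - Phi s0) by ring.
  by rewrite (le_lt_trans (ler_normB _ _))// [ltRHS]splitr ltrD.
pose w (t : R) : E := lim (h @ within G (nbhs t)).
have wP t s : A t -> G s -> `|w t - h s| ^+ 2 <= `|Phi t - Phi s|.
  move=> At Gs; have FF := PF t At.
  have c1 : (fun r => `|h r - h s| ^+ 2) @ within G (nbhs t) --> `|w t - h s| ^+ 2.
    by apply: cvg_sqr; apply: cvg_norm; apply: cvgB (hcvg t At) (cvg_cst _).
  have c2 : (fun r => `|Phi r - Phi s|) @ within G (nbhs t) --> `|Phi t - Phi s|.
    by apply: cvg_norm; apply: cvgB (cvg_within_dense At cPhi) (cvg_cst _).
  apply: ler_cvg_to c1 c2 _; rewrite near_withinE; apply: nearW => r Gr; exact: hPhi.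
have wPP t s : A t -> A s -> `|w t - w s| ^+ 2 <= `|Phi t - Phi s|.
  move=> At As; have FF := PF s As.
  have c1 : (fun r => `|w t - h r| ^+ 2) @ within G (nbhs s) --> `|w t - w s| ^+ 2.
    by apply: cvg_sqr; apply: cvg_norm; apply: cvgB (cvg_cst _) (hcvg s As).
  have c2 : (fun r => `|Phi t - Phi r|) @ within G (nbhs s) --> `|Phi t - Phi s|.
    by apply: cvg_norm; apply: cvgB (cvg_cst _) (cvg_within_dense As cPhi).
  by apply: ler_cvg_to c1 c2 _; rewrite near_withinE; apply: nearW => r Gr; exact: wP.
exists w => [|t Gt]; last first.
  apply/eqP; rewrite -subr_eq0 -normr_eq0 -sqrf_eq0 eq_le sqr_ge0 andbT.
  by rewrite (le_trans (wP t t (GA Gt) Gt))// subrr normr0.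
apply/subspace_continuousP => t At; have FF : Filter (within A (nbhs t)) by exact: within_filter.
apply/(cvgrPdist_lt (FF := FF)) => e e0; have e2 : 0 < e ^+ 2 by rewrite exprn_gt0.
have cP : \forall s \near within A (nbhs t), `|Phi t - Phi s| < e ^+ 2.
  by move/subspace_continuousP : cPhi => /(_ t At) ct; exact: (cvgrPdist_lt (FF := FF) _ _).1 ct _ e2.
have nA : \forall s \near within A (nbhs t), A s by rewrite near_withinE; exact: nearW.
apply: filterS (filterI nA cP) => s [As Ps].
by apply: sqr_lt_lt => //; exact: le_lt_trans (wPP _ _ At As) Ps.
Qed.

End DenseExtension.

(** Every neighbourhood of a point of [[0, T]] contains a nondegenerate open subinterval of []0,
    T[], which has positive measure and so cannot lie in [N]. *)
Lemma closure_itvoo_setD {R : realType} (T : R) (N : set R) : 0 < T ->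
  (@lebesgue_measure R).-negligible N ->
  `[0, T]%classic `<=` closure (`]0, T[%classic `\` N).
Proof.
move=> T0 nN t /=; rewrite in_itv/= => /andP[t0 tT] B [e /= e0 eB].
pose a := Num.max 0 (t - e); pose b := Num.min T (t + e).
have h1 : t - e < T by rewrite (lt_le_trans _ tT)// gtrBl.
have h2 : 0 < t + e by rewrite ltr_wpDl.
have h3 : t - e < t + e by rewrite ltrD2l gtrN.
have ab : a < b by rewrite lt_min !gt_max T0 h1 h2 h3.
apply: contrapT => nG.
have abN : `]a, b[%classic `<=` N.
  move=> r /=; rewrite in_itv/= gt_max lt_min => /andP[/andP[r0 tr] /andP[rT re]].
  apply: contrapT => Nr; apply: nG; exists r; split; first by split=> //=; rewrite in_itv/= r0.
  by apply: eB => /=; rewrite ltr_distlC tr.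
have muE : @lebesgue_measure R (`]a, b[%classic : set (measurableTypeR R)) = (b - a)%:E.
  by rewrite lebesgue_measure_itv/= lte_fin ab -EFinB.
have [A [mA A0 NA]] := nN.
have : (@lebesgue_measure R (`]a, b[%classic : set (measurableTypeR R)) <= @lebesgue_measure R A)%E.
  by apply: le_measure; rewrite ?inE//; exact: subset_trans NA.
by rewrite A0 muE lee_fin subr_le0 leNgt ab.
Qed.

Section ContinuousRepresentative.
Context {R : realType} {V H : hilbertType R} (j : gelfand_embedding V H).
Notation mu := (@lebesgue_measure R).
Notation RM := (measurableTypeR R).
Variables (T : R) (u : RM -> V) (g : RM -> dual V) (N N' : set R).
Hypotheses (Lu : L2fun u) (Lg : L2fun g).
Hypotheses (nN : mu.-negligible N) (nN' : mu.-negligible N').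
Hypothesis P : primitive_off j T u g N.
Hypothesis E : forall s t, 0 < s -> s < t -> t < T -> ~ N' s -> ~ N' t ->
  `|j (u t)| ^+ 2 - `|j (u s)| ^+ 2 = 2 * \int[mu]_(r in `]s, t]) (g r (u r)).

Let iL (f : RM -> R) (s t : R) : mu.-integrable setT (EFin \o f) ->
  mu.-integrable (`]s, t] : set RM) (EFin \o f).
Proof.
move=> fi; have mJ : measurable (`]s, t]%classic : set RM) by exact: measurable_itv.
exact: (integrableS measurableT mJ (@subsetT _ _) fi).
Qed.

Let good s t := [/\ 0 < s, s < t & t < T] /\ [/\ ~ N s, ~ N t, ~ N' s & ~ N' t].

(** The part free of [v] in [2 |g| |u - v| <= |g|^2 + 2 |u|^2 + 2 |v|^2]. *)
Let kappa r := `|g r| ^+ 2 + 2 * `|u r| ^+ 2.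

Let ikappa : mu.-integrable (setT : set RM) (EFin \o kappa).
Proof.
exact: (integrableD measurableT (integrable_sqr Lg) (integrableZl measurableT 2 (integrable_sqr Lu))).
Qed.

Let ieval s t v : mu.-integrable (`]s, t] : set RM) (EFin \o (fun r : RM => g r v : R)).
Proof.
have mJ : measurable (`]s, t]%classic : set RM) by exact: measurable_itv.
have muJ : (mu (`]s, t]%classic : set RM) < +oo)%E.
  by rewrite lebesgue_measure_itv/=; case: ifP => _; rewrite ?ltry// -EFinB ltry.
have iS := integrableD mJ (iL s t (integrable_sqr Lg)) (integrable_cst_lt (`|v| ^+ 2) mJ muJ).
apply: (le_integrable_real mJ _ _ iS) => [|x _]; last exact: pairing_le.
apply: measurable_funTS; apply: measurable_pairing; first by case: Lg.
exact: strongly_measurable_cst.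
Qed.

Let pairing_average s t v : s < t ->
  `|2 * \int[mu]_(r in `]s, t]) (g r (u r - v))| <=
  \int[mu]_(r in `]s, t]) kappa r + 2 * (t - s) * `|v| ^+ 2.
Proof.
move=> st; have mJ : measurable (`]s, t]%classic : set RM) by exact: measurable_itv.
have muJE : mu (`]s, t]%classic : set RM) = (t - s)%:E.
  by rewrite lebesgue_measure_itv/= lte_fin st -EFinB.
have muJ : (mu (`]s, t]%classic : set RM) < +oo)%E by rewrite muJE ltry.
have ic := integrable_cst_lt (2 * `|v| ^+ 2) mJ muJ.
have -> : 2 * (t - s) * `|v| ^+ 2 = \int[mu]_(r in `]s, t]) (2 * `|v| ^+ 2).
  rewrite (Rintegral_cst mu mJ); have -> : fine _ = t - s := congr1 fine muJE; by ring.
rewrite -(RintegralD mJ (iL s t ikappa) ic).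
have iuv : mu.-integrable (`]s, t] : set RM) (EFin \o (fun r : RM => g r (u r - v) : R)).
  move: (integrableB mJ (iL s t (integrable_pairing_L2 Lu Lg)) (ieval s t v)).
  by apply: eq_integrable => // r _ /=; rewrite linearB EFinB.
rewrite -RintegralZl//; apply: le_trans (le_normr_Rintegral mJ _) _.
  exact: (integrableZl mJ 2 iuv).
apply: (le_Rintegral mJ).
- apply: (@integrable_norm _ _ _ _ _ (fun r : RM => 2 * g r (u r - v) : R)).
  exact: (integrableZl mJ 2 iuv).
- exact: (integrableD mJ (iL s t ikappa) ic).
move=> r _; rewrite normrM ger0_norm//.
have h1 := sqr_normD_le (u r) (- v).
have h2 := le_dual (g r) (u r - v).
have h3 := sqr_ge0 (`|g r| - `|u r - v|).
rewrite normrN in h1; rewrite /kappa.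
move: h1 h2 h3; set x := `|g r|; set y := `|u r - v|; set z := `|_|; set p := `|u r|; set q := `|v|.
nra.
Qed.

(** The square expands to [|j (u t)|^2 - |j (u s)|^2] minus twice the increment paired with
    [j (u s)]: the energy identity gives the former, the primitive formula tested on [u s] the
    latter. Testing on [u t] instead gives the companion formula. *)
Let increment_left s t : good s t ->
  `|j (u t) - j (u s)| ^+ 2 = 2 * \int[mu]_(r in `]s, t]) (g r (u r - u s)).
Proof.
move=> [[s0 st tT] [Ns Nt N's N't]]; have mJ : measurable (`]s, t]%classic : set RM) by exact: measurable_itv.
have -> : \int[mu]_(r in `]s, t]) (g r (u r - u s)) =
    \int[mu]_(r in `]s, t]) (g r (u r)) - \int[mu]_(r in `]s, t]) (g r (u s)).
  rewrite -(RintegralB mJ (iL s t (integrable_pairing_L2 Lu Lg)) (ieval s t _)).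
  by apply: (@eq_Rintegral _ _ _ mu) => r _; rewrite linearB.
rewrite mulrBr -E// -P// sqr_normB dotBl -!sqr_normv; ring.
Qed.

Let increment_right s t : good s t ->
  `|j (u t) - j (u s)| ^+ 2 = - (2 * \int[mu]_(r in `]s, t]) (g r (u r - u t))).
Proof.
move=> [[s0 st tT] [Ns Nt N's N't]]; have mJ : measurable (`]s, t]%classic : set RM) by exact: measurable_itv.
have -> : \int[mu]_(r in `]s, t]) (g r (u r - u t)) =
    \int[mu]_(r in `]s, t]) (g r (u r)) - \int[mu]_(r in `]s, t]) (g r (u t)).
  rewrite -(RintegralB mJ (iL s t (integrable_pairing_L2 Lu Lg)) (ieval s t _)).
  by apply: (@eq_Rintegral _ _ _ mu) => r _; rewrite linearB.
rewrite mulrBr -E// -P// sqr_normB dotBl -!sqr_normv [dotv (j (u s)) _]dotC; ring.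
Qed.

Let kappa_split s r t : s <= r -> r <= t ->
  \int[mu]_(x in `]s, r]) kappa x <= \int[mu]_(x in `]s, t]) kappa x /\
  \int[mu]_(x in `]r, t]) kappa x <= \int[mu]_(x in `]s, t]) kappa x.
Proof.
move=> sr rt; have k0 x y : 0 <= \int[mu]_(x in `]x, y]) kappa x.
  by apply: Rintegral_ge0 => z _; rewrite addr_ge0// mulr_ge0.
have B := @Rintegral_itvB R kappa (BRight s) (BRight t) r (iL s t ikappa) sr rt.
by split; [rewrite -subr_ge0 B|rewrite -B lerBlDr lerDl].
Qed.

Let modulus r := 4 * kappa r + 8 * `|u r| ^+ 2.

Let imodulus : mu.-integrable (setT : set RM) (EFin \o modulus).
Proof.
exact: (integrableD measurableT (integrableZl measurableT 4 ikappa)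
  (integrableZl measurableT 8 (integrable_sqr Lu))).
Qed.

(* Compare [u t] and [u s] through an intermediate [u r] and average in [r]. *)
Let increment_le s t : good s t ->
  `|j (u t) - j (u s)| ^+ 2 <= \int[mu]_(r in `]s, t]) modulus r.
Proof.
move=> gst; have [[s0 st tT] [Ns Nt N's N't]] := gst.
have mJ : measurable (`]s, t]%classic : set RM) by exact: measurable_itv.
have muJE : mu (`]s, t]%classic : set RM) = (t - s)%:E.
  by rewrite lebesgue_measure_itv/= lte_fin st -EFinB.
have h0 : 0 < t - s by rewrite subr_gt0.
set A := `|_| ^+ 2; set K := \int[mu]_(x in `]s, t]) kappa x.
have iu := iL s t (integrable_sqr Lu).
have -> : \int[mu]_(r in `]s, t]) modulus r = 4 * K + 8 * \int[mu]_(r in `]s, t]) (`|u r| ^+ 2).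
  rewrite (RintegralD mJ (iL s t (integrableZl measurableT 4 ikappa)) (iL s t (integrableZl measurableT 8 (integrable_sqr Lu)))).
  by rewrite !RintegralZl//; exact: iL.
(* Passing through [u r] gives [A <= 4 * K + 8 * (t - s) * |u r|^2]; solved for [|u r|^2], this is a
   lower bound valid for almost every [r], which is then integrated. *)
pose c := (A - 4 * K) / (8 * (t - s)).
have cr r : s < r -> r < t -> ~ N r -> ~ N' r -> c <= `|u r| ^+ 2.
  move=> sr rt Nr N'r; have [K1 K2] := kappa_split (ltW sr) (ltW rt).
  have gsr : good s r by split; split => //; exact: lt_trans tT.
  have grt : good r t by split; split => //; exact: lt_trans sr.
  have L1 : `|j (u t) - j (u r)| ^+ 2 <= K + 2 * (t - s) * `|u r| ^+ 2.
    rewrite (increment_left grt) (le_trans (ler_norm _))//.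
    rewrite (le_trans (pairing_average _ rt))// lerD// ler_wpM2r// ler_wpM2l//.
    by rewrite lerD2l lerN2 ltW.
  have L2 : `|j (u r) - j (u s)| ^+ 2 <= K + 2 * (t - s) * `|u r| ^+ 2.
    rewrite (increment_right gsr) (le_trans (ler_norm _))// normrN.
    rewrite (le_trans (pairing_average _ sr))// lerD// ler_wpM2r// ler_wpM2l//.
    by rewrite lerD2r ltW.
  have L3 : A <= 2 * `|j (u t) - j (u r)| ^+ 2 + 2 * `|j (u r) - j (u s)| ^+ 2.
    rewrite /A (_ : j (u t) - j (u s) = (j (u t) - j (u r)) + (j (u r) - j (u s))).
      exact: sqr_normD_le.
    by rewrite addrA subrK.
  rewrite ler_pdivrMr ?mulr_gt0//; move: L1 L2 L3.
  set x := `|_| ^+ 2; set y := `|_| ^+ 2; set z := `|u r| ^+ 2; set h := t - s.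
  lra.
have : c * (t - s) <= \int[mu]_(r in `]s, t]) (`|u r| ^+ 2).
  (* [c] may be negative, whereas the comparison of integrals is between nonnegative functions. *)
  have c0 : c <= Num.max c 0 by rewrite le_max lexx.
  apply: (@le_trans _ _ (Num.max c 0 * (t - s))); first by rewrite ler_wpM2r// ltW.
  have -> : Num.max c 0 * (t - s) = \int[mu]_(r in `]s, t]) (Num.max c 0).
    by rewrite (Rintegral_cst mu mJ); congr (_ * _); exact: (esym (congr1 fine muJE)).
  apply: fine_le.
  - have muJ : (mu (`]s, t]%classic : set RM) < +oo)%E by rewrite muJE ltry.
    exact: (integrable_fin_num mJ (integrable_cst_lt _ mJ muJ)).
  - by apply: integrable_fin_num.
  apply: ae_ge0_le_integral => //.
  - by move=> r _; rewrite lee_fin le_max lexx orbT.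
  - exact: (measurable_int mu iu).
  (* The interval contains its right end, but the pair [r], [t] is admissible only for [r < t]. *)
  have nt : mu.-negligible [set t] by apply/negligibleP => //; exact: lebesgue_measure_set1.
  apply: (negligibleS _ (negligibleU nt (negligibleU nN nN'))) => r.
  move=> Hr; apply: contrapT => /not_orP[rt /not_orP[Nr N'r]]; apply: Hr => /=.
  rewrite in_itv/= => /andP[sr]; rewrite le_eqVlt => /predU1P[|{}rt]; first by move=> rt'; case: (rt rt').
  by rewrite lee_fin ge_max sqr_ge0 cr.
have -> : c * (t - s) = (A - 4 * K) / 8 by rewrite /c; field; rewrite gt_eqF.
by lra.
Qed.

Hypothesis T_gt0 : 0 < T.

Let goodset : set R := `]0, T[%classic `\` (N `|` N').

(** Increments between good times are bounded by those of the primitive of [modulus], which is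
    continuous on all of [[0, T]]; good times are dense, so [dense_extension] applies. *)
Lemma continuous_representative_ex : exists2 w : R -> H,
  {within `[0, T], continuous w} & forall t, 0 < t -> t < T -> ~ (N `|` N') t -> w t = j (u t).
Proof.
pose Phi t := \int[mu]_(r in `[0, t]) modulus r.
have mT : measurable (`[0, T]%classic : set RM) by exact: measurable_itv.
have cPhi : {within `[0, T], continuous Phi}.
  apply: parameterized_integral_continuous; first exact: ltW.
  exact: (integrableS measurableT mT (@subsetT _ _) imodulus).
have PhiB s t : 0 <= s -> s <= t -> \int[mu]_(r in `]s, t]) modulus r = Phi t - Phi s.
  move=> s0 st; rewrite /Phi -(@Rintegral_itvB R modulus (BLeft 0) (BRight t) s)//.
  have mt : measurable (`[0, t]%classic : set RM) by exact: measurable_itv.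
  exact: (integrableS measurableT mt (@subsetT _ _) imodulus).
have GA : goodset `<=` `[0, T]%classic.
  by move=> t [/=]; rewrite !in_itv/= => /andP[/ltW-> /ltW->].
have AG : `[0, T]%classic `<=` closure goodset.
  exact: closure_itvoo_setD T_gt0 (negligibleU nN nN').
have hPhi s t : goodset s -> goodset t -> `|j (u s) - j (u t)| ^+ 2 <= `|Phi s - Phi t|.
  wlog st : s t / s < t => [H0 Gs Gt|].
    have [/H0|ts|->] := ltgtP s t; first exact.
      by rewrite distrC (distrC (Phi s)); exact: H0.
    by rewrite !subrr !normr0 expr0n.
  move=> [/= + /not_orP[Ns N's]] [/= + /not_orP[Nt N't]].
  rewrite !in_itv/= => /andP[s0 sT] /andP[t0 tT].
  rewrite distrC (distrC (Phi s)) (le_trans (increment_le _))//.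
  by rewrite PhiB ?(ltW s0) ?(ltW st)// ler_norm.
have [w cw wE] := dense_extension GA AG cPhi hPhi.
exists w => // t t0 tT Nt; apply: wE; split => //=; by rewrite in_itv/= t0.
Qed.

(** The function [|w t| ^+ 2] minus twice the integral is continuous and takes one value on a dense
    set of times, hence is constant on [[0, T]], endpoints included. *)
Lemma energy_representative (w : R -> H) (M : set R) : mu.-negligible M ->
  {within `[0, T], continuous w} ->
  (forall t, 0 < t -> t < T -> ~ M t -> w t = j (u t)) ->
  forall t, 0 <= t -> t <= T ->
  `|w t| ^+ 2 - `|w 0| ^+ 2 = 2 * \int[mu]_(r in `[0, t]) (g r (u r)).
Proof.
move=> nM cw wE.
pose G : set R := `]0, T[%classic `\` (M `|` N').
pose Psi t := \int[mu]_(r in `[0, t]) (g r (u r)).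
have iP := integrable_pairing_L2 Lu Lg.
have mi t : measurable (`[0, t]%classic : set RM) by exact: measurable_itv.
have it t := integrableS measurableT (mi t) (@subsetT _ _) iP.
have cPsi : {within `[0, T], continuous Psi}.
  by apply: parameterized_integral_continuous; [exact: ltW|exact: it].
have GA : G `<=` `[0, T]%classic.
  by move=> t [/=]; rewrite !in_itv/= => /andP[/ltW-> /ltW->].
have AG : `[0, T]%classic `<=` closure G.
  exact: closure_itvoo_setD T_gt0 (negligibleU nM nN').
pose D t := `|w t| ^+ 2 - 2 * Psi t.
have cD : {within `[0, T], continuous D}.
  move=> t; apply: cvgB; first by apply: cvg_sqr; apply: cvg_norm; exact: cw.
  by apply: cvgM; [exact: cvg_cst|exact: cPsi].
have DG s t : G s -> G t -> D s = D t.
  wlog st : s t / s < t => [H0 Gs Gt|].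
    have [/H0|ts|->//] := ltgtP s t; first exact.
    by apply/esym; exact: H0.
  move=> [/= + /not_orP[Ms N's]] [/= + /not_orP[Mt N't]].
  rewrite !in_itv/= => /andP[s0 sT] /andP[t0 tT].
  have B := @Rintegral_itvB R (fun r => g r (u r)) (BLeft 0) (BRight t) s (it t) (ltW s0) (ltW st).
  rewrite /D !wE//; apply/eqP; rewrite -subr_eq0; apply/eqP.
  have := E s0 st tT N's N't; rewrite -B /Psi mulrBr => E'.
  transitivity (2 * \int[mu]_(r in `[0, t]) (g r (u r)) - 2 * \int[mu]_(r in `[0, s]) (g r (u r)) -
    (`|j (u t)| ^+ 2 - `|j (u s)| ^+ 2)); first by ring.
  by rewrite E' subrr.
have [s [Gs _]] : (G `&` setT) !=set0.
  have := AG 0; rewrite /= in_itv/= lexx (ltW T_gt0) => /(_ isT setT filterT).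
  by [].
have DE : forall t, `[0, T]%classic t -> D t = D s.
  by apply: (dense_eq GA AG) cD _ => // t Gt; exact: DG.
move=> t t0 tT.
have D0 : D 0 = `|w 0| ^+ 2 by rewrite /D /Psi set_itv1 Rintegral_set1 mulr0 subr0.
have /eqP : D t = D 0.
  by rewrite !DE//= in_itv/= ?lexx ?(ltW T_gt0)// t0.
by rewrite D0 /D => /eqP <-; rewrite subKr.
Qed.

End ContinuousRepresentative.

(** * Derivatives and representatives of elements of W *)

Section WSpace.
Context {R : realType} {V H : hilbertType R} (j : gelfand_embedding V H).
Notation mu := (@lebesgue_measure R).
Notation RM := (measurableTypeR R).

Lemma sqn_zext {E : normedModType R} (A : set RM) (f : RM -> E) :
  sqn (zext A f) = (\int[mu]_(t in A) (`|f t| ^+ 2)%:E)%E.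
Proof.
rewrite /sqn (integral_zext mu setT A f (h := fun y => (`|y| ^+ 2)%:E)) ?setTI//.
by rewrite normr0 expr0n.
Qed.

(** [joined] uses [u] at time 0 as well, and a kernel with atoms sees single values, so the
    extension must keep the value at the left end. It differs by a function supported at one
    point. *)
Lemma in_L2_zext_left {E : normedModType R} (a b : R) (f : RM -> E) : in_L2 a b f ->
  L2fun (zext `[a, b[ f).
Proof.
move=> Lf; have [ab|ba] := ltP a b; last first.
  rewrite (_ : zext _ _ = zext `]a, b[ f); first exact: in_L2_zext.
  by apply/funext => r; rewrite !set_itv_ge ?bnd_simp -?leNgt.
have ms : measurable ([set a] : set RM) by exact: measurable_set1.
have La : L2fun (zext [set a] (fun=> f a) : RM -> E).
  apply: L2fun_zext => //; first exact: strongly_measurable_cst.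
  by rewrite integral_set1 ltry.
rewrite (_ : zext _ _ = (fun r => zext `]a, b[ f r + zext [set a] (fun=> f a) r)).
  exact: L2funD (in_L2_zext Lf) La.
apply/funext => r; have [->|ra] := eqVneq r a.
  rewrite zextE/= ?in_itv/= ?lexx// zext0/= ?in_itv/= ?ltxx//.
  by rewrite zextE// add0r.
rewrite [X in _ + X]zext0; last by move=> /eqP; rewrite (negbTE ra).
rewrite addr0 /zext; congr (if _ then _ else _).
by apply/idP/idP; rewrite !inE/= !in_itv/= => /andP[ar ->]; rewrite andbT ?(ltW ar)// lt_neqAle eq_sym ra.
Qed.

Lemma primitive_off_zext (T : R) (A B : set RM) (u : R -> V) (g : R -> dual V) (N : set R) :
  `]0, T[%classic `<=` A -> `]0, T[%classic `<=` B ->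
  primitive_off j T u g N -> primitive_off j T (zext A u) (zext B g) N.
Proof.
move=> TA TB P s t s0 st tT Ns Nt v.
have I r : s <= r -> r <= t -> `]0, T[%classic r.
  by move=> sr rt /=; rewrite in_itv/= (lt_le_trans s0 sr) (le_lt_trans rt tT).
rewrite !zextE; [|by apply: TA; apply: I; rewrite ?(ltW st)..].
rewrite P//; apply: (@eq_Rintegral _ _ _ mu) => r; rewrite inE/= in_itv/= => /andP[sr rt].
by rewrite zextE//; apply: TB; apply: I; rewrite // ltW.
Qed.

Lemma dt_spec (T : R) (u : R -> V) : in_W j T u ->
  in_L2 0 T (dt j T u) /\ is_weak_derivative j T u (dt j T u).
Proof.
move=> [_ [g Lg ug]]; pose P := [set g | in_L2 0 T g /\ is_weak_derivative j T u g].
by apply: (xgetPex (cst 0) (P := P)); exists g.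
Qed.

Lemma in_L2P {E : normedModType R} (a b : R) (f : R -> E) :
  strongly_measurable (`]a, b[ : set RM) f -> (sqn (zext `]a, b[ f) < +oo)%E -> in_L2 a b f.
Proof.
move=> mf; rewrite sqn_zext => fi; split => //; rewrite /L2_norm.
by apply: poweR_lty.
Qed.

Lemma in_L2B {E : normedModType R} (a b : R) (f g : R -> E) : in_L2 a b f -> in_L2 a b g ->
  in_L2 a b (fun t => f t - g t).
Proof.
move=> Lf Lg; have [mf _] := Lf; have [mg _] := Lg.
apply: in_L2P; first exact: strongly_measurableB.
have [_] := L2funB (in_L2_zext Lf) (in_L2_zext Lg).
by congr (sqn _ < _)%E; apply/funext => t; rewrite zextB.
Qed.

Lemma bochner_scaleB (T : R) (phi : R -> R) (g h : R -> dual V) : continuous phi ->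
  strongly_measurable (`]0, T[ : set RM) g -> (\int[mu]_(t in `]0%R, T[) (`|g t|)%:E < +oo)%E ->
  strongly_measurable (`]0, T[ : set RM) h -> (\int[mu]_(t in `]0%R, T[) (`|h t|)%:E < +oo)%E ->
  bochner_integral mu (`]0, T[ : set RM) (fun t => phi t *: (g t - h t)) =
  bochner_integral mu (`]0, T[ : set RM) (fun t => phi t *: g t) -
  bochner_integral mu (`]0, T[ : set RM) (fun t => phi t *: h t).
Proof.
move=> cphi mg gi mh hi; apply: dual_ext => v.
have mI : measurable (`]0, T[%classic : set RM) by exact: measurable_itv.
have mgh := strongly_measurableB mg mh.
have [C C0 pC] := continuous_itv_bounded T cphi.
have mphi : measurable_fun (`]0, T[%classic : set RM) phi.
  by apply: measurable_funTS; exact: continuous_measurable_fun.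
have iphi (f : R -> dual V) : strongly_measurable (`]0, T[ : set RM) f ->
    (\int[mu]_(t in `]0%R, T[) (`|f t|)%:E < +oo)%E ->
    mu.-integrable (`]0, T[ : set RM) (EFin \o (fun t => phi t * f t v)).
  move=> mf fi; apply: (integrable_mul_bounded mI mphi pC).
  exact: (integrable_pairing mI v mf fi).
have ghi : (\int[mu]_(t in `]0%R, T[) (`|g t - h t|)%:E < +oo)%E.
  apply: (@le_lt_trans _ _ (\int[mu]_(t in `]0%R, T[) ((`|g t|)%:E + (`|h t|)%:E))%E).
    apply: ge0_le_integral => //.
    - exact/measurable_EFinP/strongly_measurable_norm.
    - by apply: emeasurable_funD; exact/measurable_EFinP/strongly_measurable_norm.
    - by move=> t _; rewrite -EFinD lee_fin ler_normB.
  by rewrite ge0_integralD//; [exact: lte_add_pinfty|exact/measurable_EFinP/strongly_measurable_norm..].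
apply: (etrans (bochner_scale v cphi mgh ghi)); apply/esym.
apply: (etrans (f_equal2 (fun x y : R => x - y) (bochner_scale v cphi mg gi)
  (bochner_scale v cphi mh hi))).
apply: (etrans (esym (RintegralB mI (iphi _ mg gi) (iphi _ mh hi)))).
by apply: (@eq_Rintegral _ _ _ mu) => t _; rewrite dualB mulrBr.
Qed.

Lemma is_weak_derivativeB (T : R) (u v : R -> V) (g h : R -> dual V) :
  in_L2 0 T u -> in_L2 0 T v -> in_L2 0 T g -> in_L2 0 T h ->
  is_weak_derivative j T u g -> is_weak_derivative j T v h ->
  is_weak_derivative j T (fun t => u t - v t) (fun t => g t - h t).
Proof.
move=> Lu Lv Lg Lh ug vh phi tphi; have [cphi cphi'] := test_function_continuous tphi.
have [mg _] := Lg; have [mh _] := Lh.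
have [mGu Gui] := gelfand_L1 j Lu; have [mGv Gvi] := gelfand_L1 j Lv.
have E1 := bochner_scaleB cphi mg (in_L2_L1 Lg) mh (in_L2_L1 Lh).
have E2 := bochner_scaleB cphi' mGu Gui mGv Gvi.
have alg (x y : dual V) : - x - - y = - (x - y) by rewrite opprB opprK addrC.
apply: (etrans _ (etrans E2 (etrans (f_equal2 (fun x y : dual V => x - y) (ug phi tphi)
  (vh phi tphi)) (etrans (alg _ _) (f_equal -%R (esym E1)))))).
congr bochner_integral; apply/funext => t; congr (_ *: _); apply: dual_ext => w.
by rewrite dualB !gelfandE -dotBl linearB.
Qed.

(** Apply [du_bois_reymond] with [p = 0]: [(g - h) v] has integral 0 over all subintervals, hence
    vanishes at its Lebesgue points, and a countable dense set of [v] suffices. Since [dt] is a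
    chosen representative, it is additive only almost everywhere, through this lemma. *)
Lemma weak_derivative_unique (T : R) (u : R -> V) (g h : R -> dual V) :
  separable V -> in_L2 0 T u -> in_L2 0 T g -> in_L2 0 T h ->
  is_weak_derivative j T u g -> is_weak_derivative j T u h ->
  {ae mu, forall t, t \in `]0, T[ -> g t = h t}.
Proof.
move=> [A cA dA] Lu Lg Lh ug uh.
have mI : measurable (`]0, T[%classic : set RM) by exact: measurable_itv.
have [mg _] := Lg; have [mh _] := Lh.
pose q v t : R := (g t - h t) v.
have iev v (f : R -> dual V) : in_L2 0 T f -> mu.-integrable (`]0, T[ : set RM) (EFin \o (fun t => f t v : R)).
  by move=> Lf; have [mf _] := Lf; exact: (integrable_pairing mI v mf (in_L2_L1 Lf)).
have iq v : mu.-integrable (`]0, T[ : set RM) (EFin \o q v).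
  exact: (integrableB mI (iev v _ Lg) (iev v _ Lh)).
have q0 v a b : 0 < a -> a < b -> b < T -> \int[mu]_(t in `]a, b]) q v t = 0.
  move=> a0 ab bT; pose z : R -> R := fun=> 0.
  have zpt x : lebesgue_pt (z \_ `]0, T[) x.
    rewrite (_ : _ \_ _ = cst 0); last by apply/funext => y; rewrite /patch; case: ifP.
    apply: (@continuous_lebesgue_pt _ _ _ setT) => //; last exact: cst_continuous.
    by split => //; exact: openT.
  rewrite -(@du_bois_reymond R T z (q v) _ (iq v) _ a b)// ?subrr//.
    exact: integrable0.
  move=> phi tphi; have [cphi cphi'] := test_function_continuous tphi.
  rewrite (@eq_Rintegral _ _ _ mu _ (fun=> 0)) => [|t _]; last by rewrite mulr0.
  rewrite Rintegral_cst// mul0r.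
  have E := congr1 (fun F : dual V => F v) (oppr_inj (esym (etrans (esym (ug phi tphi)) (uh phi tphi)))).
  have [C C0 pC] := continuous_itv_bounded T cphi.
  have mphi : measurable_fun (`]0, T[%classic : set RM) phi.
    by apply: measurable_funTS; exact: continuous_measurable_fun.
  rewrite (@eq_Rintegral _ _ _ mu _ (fun t => phi t * g t v - phi t * h t v)) => [|t _]; last first.
    by rewrite /q dualB mulrBr.
  have ig := integrable_mul_bounded mI mphi pC (iev v _ Lg).
  have ih := integrable_mul_bounded mI mphi pC (iev v _ Lh).
  rewrite (RintegralB mI ig ih).
  have E1 := etrans (esym (bochner_scale v cphi mh (in_L2_L1 Lh)))
    (etrans E (bochner_scale v cphi mg (in_L2_L1 Lg))).
  by rewrite -E1 subrr oppr0.
pose Q v : RM -> R := q v \_ `]0, T[.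
have iQ v : mu.-integrable (setT : set RM) (EFin \o Q v).
  by rewrite /Q -restrict_EFin; apply/integrable_restrict => //; rewrite setTI.
pose N v : set R := ~` [set t | lebesgue_pt (Q v) t].
have nN v : mu.-negligible (N v).
  exact: (lebesgue_differentiation (integrable_locally mI (iq v))).
apply: (negligibleS _ (negligible_countable_union cA nN)) => t /= Ht.
apply: contrapT => Nt; apply: Ht => /=; rewrite in_itv/= => /andP[t0 tT].
apply: dual_ext => v; apply/eqP; rewrite -subr_eq0 -dualB; apply/eqP.
apply: (@dense_linear_eq0 _ V A (fun v => (g t - h t) v) `|g t - h t| dA) => [w w'|w Aw].
  by rewrite -linearB le_dual.
have Qt : lebesgue_pt (Q w) t by apply: contrapT => Qt; apply: Nt; exists w.
have := cvg_right_average (iQ w) Qt.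
have -> : Q w t = (g t - h t) w by rewrite /Q patchE mem_set//= in_itv/= t0.
move=> /(@cvg_unique _ (@norm_hausdorff _ _)); apply.
apply: cvg_near_cst; near=> k.
rewrite (_ : \int[mu]_(r in _) _ = 0) ?mulr0//.
have k0 : 0 < k by [].
have kT : t + k < T.
  by rewrite -ltrBrDl; near: k; apply: nbhs_right_lt; rewrite subr_gt0.
rewrite -(q0 w t (t + k))// ?ltrDl//.
apply: (@eq_Rintegral _ _ _ mu) => r; rewrite inE/= in_itv/= => /andP[tr rk].
by rewrite /Q patchE mem_set//= in_itv/= (lt_trans t0 tr) (le_lt_trans rk).
Unshelve. all: by end_near. Qed.

Lemma in_W_primitive (T : R) (u : R -> V) : separable V -> in_W j T u ->
  exists2 N, mu.-negligible N & primitive_off j T (zext `[0, T[ u) (zext `[0, T[ (dt j T u)) N.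
Proof.
move=> sV Wu; have [Lg ug] := dt_spec Wu; have [Lu _] := Wu.
have [N nN P] := weak_derivative_primitive sV Lu Lg ug.
have sub : `]0, T[%classic `<=` `[0, T[%classic.
  by move=> t /=; rewrite !in_itv/= => /andP[/ltW-> ->].
by exists N => //; exact: primitive_off_zext.
Qed.

Lemma Crepr_spec (T : R) (u : R -> V) : separable V -> 0 < T -> in_W j T u ->
  {within `[0, T], continuous (Crepr j T u)} /\
  {ae mu, forall t, t \in `]0, T[ -> Crepr j T u t = j (u t)}.
Proof.
move=> sV T0 Wu; have [Lg _] := dt_spec Wu; have [Lu _] := Wu.
have [N nN P] := in_W_primitive sV Wu.
have Lu' := in_L2_zext_left Lu; have Lg' := in_L2_zext_left Lg.
have [N' nN' E] := energy_identity Lu' Lg' nN P.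
have [w cw wE] := continuous_representative_ex Lu' Lg' nN nN' P E T0.
pose Q := [set w : R -> H | {within `[0, T], continuous w} /\
    {ae lebesgue_measure, forall t, t \in `]0, T[ -> w t = j (u t)}].
apply: (xgetPex (cst 0) (P := Q)); exists w; split => //.
apply: (negligibleS _ (negligibleU nN nN')) => t Ht; apply: contrapT => Nt; apply: Ht => /=.
rewrite in_itv/= => /andP[t0 tT]; rewrite wE// zextE//=.
by rewrite in_itv/= ltW.
Qed.

(** Taking any continuous [w] makes the identity available for the difference of two [Crepr]
    functions, without identifying it with [Crepr] of the difference. *)
Lemma energy_Crepr (T : R) (u : R -> V) (g : R -> dual V) (w : R -> H) : separable V -> 0 < T ->
  in_L2 0 T u -> in_L2 0 T g -> is_weak_derivative j T u g ->
  {within `[0, T], continuous w} -> {ae mu, forall t, t \in `]0, T[ -> w t = j (u t)} ->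
  forall t, 0 <= t -> t <= T -> `|w t| ^+ 2 - `|w 0| ^+ 2 =
    2 * \int[mu]_(r in `[0, t]) (zext `[0, T[ g r (zext `[0, T[ u r)).
Proof.
move=> sV T0 Lu Lg ug cw wE.
have [N nN P0] := weak_derivative_primitive sV Lu Lg ug.
have sub : `]0, T[%classic `<=` `[0, T[%classic.
  by move=> t /=; rewrite !in_itv/= => /andP[/ltW-> ->].
have P := primitive_off_zext sub sub P0.
have Lu' := in_L2_zext_left Lu; have Lg' := in_L2_zext_left Lg.
have [N' nN' E] := energy_identity Lu' Lg' nN P.
apply: (energy_representative Lu' Lg' nN' E T0 wE cw) => t t0 tT Mt.
rewrite zextE/= ?in_itv/= ?(ltW t0)//; apply: contrapT => Hw; apply: Mt => Hw'.
by apply: Hw; apply: Hw'; rewrite in_itv/= t0.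
Qed.

End WSpace.

(** * Delay operators *)

Section Convolution.
Context {R : realType} {E : normedModType R}.
Notation mu := (@lebesgue_measure R).
Notation RM := (measurableTypeR R).
Variables (nu : {finite_measure set RM -> \bar R}) (D : set RM).
Hypothesis mD : measurable D.
Implicit Types f : RM -> E.

Definition delay_conv f (t : RM) : R := \int[nu]_(s in D) `|f (t - s)|.

Lemma delay_conv_ge0 f t : 0 <= delay_conv f t.
Proof. by apply: Rintegral_ge0 => s _. Qed.

Lemma strongly_measurable_delay f (t : RM) : strongly_measurable setT f ->
  strongly_measurable (setT : set RM) (fun s => f (t - s)).
Proof.
move=> mf; apply: (strongly_measurable_precomp _ _ mf) => //.
exact: measurable_funB.
Qed.

Let measurable_norm_delay f : strongly_measurable setT f ->
  measurable_fun (setT : set (RM * RM)) (fun z => `|f (z.1 - z.2)|).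
Proof.
move=> mf; apply: strongly_measurable_norm => //.
apply: (strongly_measurable_precomp _ _ mf) => //; exact: measurable_funB.
Qed.

Lemma measurable_delay_conv f : strongly_measurable setT f -> measurable_fun setT (delay_conv f).
Proof.
move=> mf; apply: (@measurableT_comp _ _ _ _ _ _ fine) => //.
have mX : measurable_fun (setT : set (RM * RM)) (fun z => (`|f (z.1 - z.2)|)%:E).
  by apply/measurable_EFinP; exact: measurable_norm_delay.
have X0 (z : RM * RM) : (0 <= (`|f (z.1 - z.2)|)%:E)%E by rewrite lee_fin.
by have [] := tonelli_on mu nu mD mX X0.
Qed.

Variable M : R.
Hypotheses (M0 : 0 < M) (nuM : (nu D <= M%:E)%E).

Let nuD : (nu D < +oo)%E.
Proof. by rewrite (le_lt_trans nuM)// ltry. Qed.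

Let J f (t : RM) : \bar R := (\int[nu]_(s in D) (`|f (t - s)%R| ^+ 2)%:E)%E.

Let J_ge0 f t : (0 <= J f t)%E.
Proof. by apply: integral_ge0 => s _; rewrite lee_fin. Qed.

Let integral_J f : L2fun f ->
  measurable_fun setT (J f) /\ (\int[mu]_t J f t = sqn f * nu D)%E.
Proof.
move=> [mf fi].
have mX : measurable_fun (setT : set (RM * RM)) (fun z => (`|f (z.1 - z.2)| ^+ 2)%:E).
  by apply/measurable_EFinP; apply: measurable_funX; exact: measurable_norm_delay.
have X0 (z : RM * RM) : (0 <= (`|f (z.1 - z.2)| ^+ 2)%:E)%E by rewrite lee_fin.
have [mJ JE] := tonelli_on mu nu mD mX X0; split => //.
have fE : sqn f = (fine (sqn f))%:E by rewrite fineK// ge0_fin_numE ?sqn_ge0.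
rewrite [LHS]JE fE -integral_cst//; apply: eq_integral => s _; rewrite -fE.
exact: (sqn_shift (- s) mf).
Qed.

Let J_lty f t : strongly_measurable setT f -> (J f t < +oo)%E ->
  (\int[nu]_(s in D) (`|f (t - s)%R|)%:E < +oo)%E.
Proof.
move=> mf Jt; have mft := strongly_measurable_delay t mf.
have mn : measurable_fun D (fun s => `|f (t - s)|).
  by apply: measurable_funTS; exact: strongly_measurable_norm.
apply: (@le_lt_trans _ _ (\int[nu]_(s in D) (1 + (`|f (t - s)%R| ^+ 2)%:E))%E).
  apply: ge0_le_integral => //.
  - exact/measurable_EFinP.
  - by apply: emeasurable_funD => //; apply/measurable_EFinP/measurable_funX.
  - move=> s _; rewrite -EFinD lee_fin; have := sqr_ge0 (`|f (t - s)| - 1); nra.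
rewrite ge0_integralD//; last by apply/measurable_EFinP/measurable_funX.
by rewrite lte_add_pinfty// integral_cst// mul1e.
Qed.

(** By Tonelli [J f] has finite integral, so it is finite almost everywhere, and then so is the
    integral of the norm since [nu] is finite. At such times the delay operator is a true Bochner
    integral. *)
Lemma delay_conv_fin f : L2fun f ->
  {ae mu, forall t, (\int[nu]_(s in D) (`|f (t - s)%R|)%:E < +oo)%E}.
Proof.
move=> Lf; have [mf fi] := Lf; have [mJ JE] := integral_J Lf.
have iJ : mu.-integrable setT (J f).
  apply/integrableP; split => //.
  under eq_integral do rewrite gee0_abs//.
  by rewrite JE lte_mul_pinfty ?sqn_ge0// ge0_fin_numE ?sqn_ge0.
have := integrable_ae measurableT iJ.
apply: filterS => t /(_ Logic.I) Jt; apply: J_lty => //.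
by rewrite -ge0_fin_numE.
Qed.

(** Cauchy-Schwarz against a measure of mass at most [M], obtained by integrating
    [2 c z <= z^2 + c^2] with the optimal constant [c = x / M]. If [J f t] is infinite the claim is
    trivial. *)
Lemma sqr_delay_conv_le f t : strongly_measurable setT f ->
  ((delay_conv f t ^+ 2)%:E <= M%:E * J f t)%E.
Proof.
move=> mf; have := J_ge0 f t; have := J_lty (t := t) mf.
have [Jt /(_ isT) ft J0|JtN _ J0] := boolP (J f t < +oo)%E; last first.
  have -> : J f t = +oo%E by apply/eqP; rewrite -leye_eq leNgt.
  by rewrite gt0_muley ?leey// lte_fin.
have mft := strongly_measurable_delay t mf.
have mn : measurable_fun D (fun s => `|f (t - s)|).
  by apply: measurable_funTS; exact: strongly_measurable_norm.
have JE : J f t = (fine (J f t))%:E by rewrite fineK// ge0_fin_numE.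
set x := delay_conv f t; set c := x / M; set y := fine (J f t) in JE.
have x0 : 0 <= x by exact: delay_conv_ge0.
have c0 : 0 <= c by rewrite divr_ge0// ltW.
have cx : (\int[nu]_(s in D) (`|f (t - s)%R|)%:E = x%:E)%E.
  by rewrite /x /delay_conv /Rintegral fineK// ge0_fin_numE// integral_ge0.
have : ((2 * c * x)%:E <= y%:E + (c ^+ 2)%:E * nu D)%E.
  rewrite EFinM -cx -JE -ge0_integralZl//; last 2 first.
  - exact/measurable_EFinP.
  - by rewrite lee_fin mulr_ge0.
  have -> : (J f t + (c ^+ 2)%:E * nu D =
      \int[nu]_(s in D) ((`|f (t - s)%R| ^+ 2)%:E + (c ^+ 2)%:E))%E.
    rewrite ge0_integralD//; first by rewrite integral_cst.
      by apply/measurable_EFinP/measurable_funX.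
    by move=> s _; rewrite lee_fin sqr_ge0.
  apply: ge0_le_integral => //.
  - by move=> s _; rewrite -EFinM lee_fin mulr_ge0// mulr_ge0.
  - by apply: measurable_funeM; exact/measurable_EFinP.
  - by apply: emeasurable_funD => //; apply/measurable_EFinP/measurable_funX.
  - move=> s _; rewrite -EFinM -EFinD lee_fin.
    have := sqr_ge0 (`|f (t - s)| - c); set z := `|_|; nra.
have : ((c ^+ 2)%:E * nu D <= (c ^+ 2 * M)%:E)%E.
  by rewrite (EFinM (c ^+ 2)) lee_wpmul2l// lee_fin sqr_ge0.
move=> h1 /le_trans; rewrite JE -EFinM => /(_ _ (leeD (lexx _) h1)).
rewrite -EFinD !lee_fin => h.
have xE : x = c * M by rewrite /c divfK// gt_eqF.
have h' : c ^+ 2 * M <= y.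
  move: h; rewrite xE (_ : 2 * c * (c * M) = c ^+ 2 * M + c ^+ 2 * M); last by ring.
  by rewrite lerD2r.
rewrite xE (_ : (c * M) ^+ 2 = M * (c ^+ 2 * M)); last by ring.
by rewrite ler_wpM2l// ltW.
Qed.

(** Young's inequality for the convolution of an L^2 function with a finite measure. *)
Lemma sqn_delay_conv f : L2fun f ->
  (\int[mu]_t (delay_conv f t ^+ 2)%:E <= (M ^+ 2)%:E * sqn f)%E.
Proof.
move=> Lf; have [mf _] := Lf; have [mJ JE] := integral_J Lf.
apply: (@le_trans _ _ (\int[mu]_t (M%:E * J f t))%E).
  apply: ge0_le_integral => //.
  - by move=> t _; rewrite lee_fin sqr_ge0.
  - by apply/measurable_EFinP/measurable_funX; exact: measurable_delay_conv.
  - exact: measurable_funeM.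
  - by move=> t _; exact: sqr_delay_conv_le.
rewrite ge0_integralZl//; last by rewrite lee_fin ltW.
rewrite JE expr2 EFinM -muleA lee_wpmul2l//; first by rewrite lee_fin ltW.
by rewrite muleC lee_wpmul2r// sqn_ge0.
Qed.

End Convolution.

Lemma eq_bochner_integral {d} {S : measurableType d} {R : realType} {E : normedModType R}
    (nu : {measure set S -> \bar R}) (D : set S) (f g : S -> E) :
  (forall x, D x -> f x = g x) -> bochner_integral nu D f = bochner_integral nu D g.
Proof.
move=> fg; rewrite /bochner_integral; congr xget; apply/funext => I; apply/propext.
have norm_eq (s : S -> E) : (\int[nu]_(x in D) (`|f x - s x|)%:E =
    \int[nu]_(x in D) (`|g x - s x|)%:E)%E.
  by apply: eq_integral => x; rewrite inE => Dx; rewrite fg.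
split=> -[s [ss sf fs sI]]; exists s; split => //.
- by apply: filterS sf => x + Dx => /(_ Dx); rewrite fg.
- by under eq_fun do rewrite -norm_eq.
- by apply: filterS sf => x + Dx => /(_ Dx); rewrite fg.
- by under eq_fun do rewrite norm_eq.
Qed.

(** * Consequences of narrow convergence for masses *)

Section NarrowConvergence.
Context {R : realType}.
Notation RM := (measurableTypeR R).
Variables (tau : R) (nu_ : nat -> {finite_measure set RM -> \bar R})
  (nu : {finite_measure set RM -> \bar R}).
Hypothesis cv : narrow_cvg tau nu_ nu.
Let D : set RM := `[0, tau]%classic.
Let mD : measurable D. Proof. exact: measurable_itv. Qed.

(** Testing with the constant 1 shows that the masses converge, hence are bounded. *)
Lemma narrow_mass_bound : exists2 M : R, 0 < M &
  (nu D <= M%:E)%E /\ forall n, (nu_ n D <= M%:E)%E.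
Proof.
have c1 : {within `[0, tau], continuous (fun=> 1 : R)}.
  by apply: continuous_subspaceT; exact: cst_continuous.
have := cv c1.
have E (s : {finite_measure set RM -> \bar R}) : \int[s]_(r in D) 1 = fine (s D).
  by rewrite (Rintegral_cst s mD) mul1r.
have fE (s : {finite_measure set RM -> \bar R}) : s D = (fine (s D))%:E.
  by rewrite fineK// fin_num_measure.
under eq_fun do rewrite E; rewrite E => c.
have /cvg_seq_bounded[K [_ HK]] : cvgn (fun n => fine (nu_ n D)) by apply/cvg_ex; exists (fine (nu D)).
exists (`|K| + 1 + fine (nu D)).
  by rewrite ltr_wpDr ?fine_ge0// ltr_wpDl.
split; first by rewrite fE lee_fin lerDr addr_ge0.
move=> n; rewrite fE lee_fin (@le_trans _ _ (`|K| + 1))//; last by rewrite lerDl fine_ge0.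
have := HK (`|K| + 1); rewrite (le_lt_trans (ler_norm K)) ?ltrDl// => /(_ isT n Logic.I).
by rewrite /=; apply: le_trans; exact: ler_norm.
Qed.

(** The intervals [[0, 2 / k.+1]] shrink to the origin, so one of them has [nu]-mass at most
    [e / 2]. A continuous cutoff carries this to the approximating kernels, and the gap between
    [e / 2] and [e] leaves room for convergence. *)
Lemma narrow_no_mass_at0 (e : R) : 0 < e -> nu [set 0] = 0%E ->
  exists2 d : R, 0 < d & exists N, forall n, (N <= n)%N ->
    (nu_ n (D `&` `[0%R, d]) <= e%:E)%E.
Proof.
move=> e0 nu0.
pose A k : set RM := `[0, 2 / k.+1%:R]%classic.
have mA k : measurable (A k) by exact: measurable_itv.
have cA : (nu \o A) k @[k --> \oo] --> nu (\bigcap_k A k).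
  apply: nonincreasing_cvg_mu => //.
  - by rewrite -ge0_fin_numE// fin_num_measure.
  - exact: bigcapT_measurable.
  - move=> m n mn; apply/subsetPset => r; rewrite /A/= !in_itv/= => /andP[-> /le_trans]; apply.
    by rewrite ler_pM2l// lef_pV2 ?posrE// ler_nat.
have A0 : \bigcap_k A k = [set 0].
  apply/seteqP; split => [r Ar|r -> k _]; last by rewrite /A/= in_itv/= lexx divr_ge0.
  have /andP[r0 _] : 0 <= r <= 2 / 1%:R by have := Ar 0%N Logic.I; rewrite /A/= in_itv.
  apply/eqP; rewrite eq_le r0 andbT leNgt; apply/negP => rp.
  have r2 : 0 < r / 2 by rewrite divr_gt0.
  have [k Hk] := ltr_add_invr r2.
  have := Ar k Logic.I; rewrite /A/= in_itv/= r0/= leNgt => /negP; apply.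
  by rewrite mulrC -ltr_pdivlMr// -[X in X < _]add0r.
rewrite A0 nu0 in cA.
have [k _ /(_ k (leqnn k)) Ake] := (cvge0P (fun k => measure_ge0 nu (A k))).1 cA (e / 2) (divr_gt0 e0 (ltr0n _ 2)).
pose d : R := k.+1%:R^-1; have d0 : 0 < d by rewrite invr_gt0.
(* This is [step (2 - r / d)]: equal to 1 on [[0, d]] and to 0 beyond [2 * d], which is the right
   end of [A k]. *)
pose phi (r : R) : R := step (- d^-1 * r + 2).
have cphi : continuous phi.
  exact: (smooth_gen_continuous (smooth_affine _ _ smooth_step)).
have phi0 r : 0 <= phi r by case/andP: (step_bound (- d^-1 * r + 2)).
have phi1 r : phi r <= 1 by case/andP: (step_bound (- d^-1 * r + 2)).
have mphi : measurable_fun D phi.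
  by apply: measurable_funTS; exact: continuous_measurable_fun.
have phiE (s : {finite_measure set RM -> \bar R}) :
    ((\int[s]_(r in D) phi r)%:E = \int[s]_(r in D) (phi r)%:E)%E.
  have sD : (s D < +oo)%E by rewrite -ge0_fin_numE// fin_num_measure.
  rewrite fineK// integrable_fin_num//.
  apply: (le_integrable_real mD mphi _ (integrable_cst_lt 1 mD sD)) => r _.
  by rewrite ger0_norm.
exists d => //.
have Lphi : \int[nu]_(r in D) phi r < e.
  rewrite -lte_fin phiE; apply: (@le_lt_trans _ _ (nu (A k))); last first.
    by rewrite (le_lt_trans Ake)// lte_fin gtr_pMr// invf_lt1// ltr1n.
  apply: (@le_trans _ _ (\int[nu]_(r in D) (\1_(A k) r)%:E)%E); last first.
    by rewrite integral_indic//; apply: le_measure; rewrite ?inE//; apply: measurableI.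
  apply: ge0_le_integral => //.
  - by move=> r _; rewrite lee_fin.
  - exact/measurable_EFinP.
  - by apply/measurable_EFinP; exact: measurable_indic.
  - move=> r; rewrite /D/= in_itv/= => /andP[r0 _]; rewrite indicE lee_fin; case: (boolP (r \in A k)) => // rA.
    have rd : 2 * d < r.
      by rewrite ltNge; apply: contra rA => rd; rewrite inE /A/= in_itv/= r0.
    by rewrite /phi step_le0// addrC mulNr mulrC subr_le0 ler_pdivlMr// ltW.
have := cv (continuous_subspaceT cphi); move=> /cvgr_lt/(_ _ Lphi)[N _ HN].
exists N => n /HN /= Hn.
have mB : measurable (D `&` `[0%R, d]) by exact: measurableI.
rewrite -[leLHS]mul1e -integral_cst//.
apply: (@le_trans _ _ (\int[nu_ n]_(r in D) (phi r)%:E)%E); last first.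
  by rewrite -phiE lee_fin ltW.
apply: (@le_trans _ _ (\int[nu_ n]_(r in D `&` `[0%R, d]) (phi r)%:E)%E).
  apply: ge0_le_integral => //.
  - by apply/measurable_EFinP; apply: measurable_funTS; exact: continuous_measurable_fun.
  - move=> r [_ /=]; rewrite in_itv/= => /andP[r0 rd].
    rewrite lee_fin /phi step_ge1// addrC mulNr mulrC.
    by rewrite lerBrDr -lerBrDl (_ : 2 - 1 = 1 :> R) ?ler_pdivrMr ?mul1r//; ring.
apply: ge0_subset_integral => //.
- exact/measurable_EFinP.
- by move=> r _; rewrite lee_fin.
Qed.

End NarrowConvergence.

Section DelayPairing.
Context {R : realType} {V : hilbertType R}.
Notation mu := (@lebesgue_measure R).
Notation RM := (measurableTypeR R).
Variables (A1 : V -> dual V) (L tau : R).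
Hypotheses (L0 : 0 < L) (A1B : forall v w, A1 v - A1 w = A1 (v - w))
  (A1L : forall v, `|A1 v| <= L * `|v|).
Implicit Types (f : RM -> V) (s : {finite_measure set RM -> \bar R}).

Let A1D v w : A1 (v + w) = A1 v + A1 w.
Proof.
have A10 : A1 0 = 0 by rewrite -[X in A1 X](subrr 0) -A1B subrr.
have A1N : A1 (- w) = - A1 w by rewrite -[X in A1 X]sub0r -A1B A10 sub0r.
by rewrite -[X in A1 (_ + X)]opprK -A1B A1N opprK.
Qed.

Lemma bounded_linear_continuous : continuous A1.
Proof.
move=> v; apply/(cvgrPdist_lt (FF := nbhs_filter v)) => e e0.
near=> w; rewrite A1B (le_lt_trans (A1L _))// -ltr_pdivlMl//.
near: w; apply: cvgr_dist_lt => //; by rewrite mulr_gt0// invr_gt0.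
Unshelve. all: by end_near. Qed.

Let D : set RM := `[0, tau]%classic.
Let mD : measurable D. Proof. exact: measurable_itv. Qed.

(** The real counterpart of [delay_op] tested on [v]; the two agree wherever the norm integral is
    finite. *)
Definition delay_pairing s f (t : RM) (v : V) : R := \int[s]_(r in D) (A1 (f (t - r)) v).

Lemma strongly_measurable_A1_delay f (t : RM) : strongly_measurable setT f ->
  strongly_measurable (setT : set RM) (fun r => A1 (f (t - r))).
Proof.
move=> mf; exact: (strongly_measurable_comp bounded_linear_continuous
  (strongly_measurable_delay t mf)).
Qed.

Let A1_lty s f (t : RM) : strongly_measurable setT f ->
  (\int[s]_(r in D) (`|f (t - r)%R|)%:E < +oo)%E ->
  (\int[s]_(r in D) (`|A1 (f (t - r)%R)|)%:E < +oo)%E.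
Proof.
move=> mf fi; have mn : measurable_fun D (fun r => `|f (t - r)|).
  by apply: measurable_funTS; apply: strongly_measurable_norm => //; exact: strongly_measurable_delay.
apply: (@le_lt_trans _ _ (\int[s]_(r in D) (L%:E * (`|f (t - r)%R|)%:E))%E).
  apply: ge0_le_integral => //.
  - apply/measurable_EFinP; apply: measurable_funTS; apply: strongly_measurable_norm => //.
    exact: strongly_measurable_A1_delay.
  - by apply: measurable_funeM; exact/measurable_EFinP.
  - by move=> r _; rewrite -EFinM lee_fin.
rewrite ge0_integralZl//; [|exact/measurable_EFinP|by rewrite lee_fin ltW].
by rewrite lte_mul_pinfty// lee_fin ltW.
Qed.

Lemma delay_opE s f (t : RM) v : strongly_measurable setT f ->
  (\int[s]_(r in D) (`|f (t - r)%R|)%:E < +oo)%E ->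
  delay_op A1 tau s f t v = delay_pairing s f t v.
Proof.
move=> mf fi; apply: (bochner_integral_dual mD); last exact: A1_lty.
exact: (strongly_measurableS (@subsetT _ _) (strongly_measurable_A1_delay t mf)).
Qed.

Lemma integrable_delay_pairing s f (t : RM) v : strongly_measurable setT f ->
  (\int[s]_(r in D) (`|f (t - r)%R|)%:E < +oo)%E ->
  s.-integrable D (EFin \o (fun r => A1 (f (t - r)) v : R)).
Proof.
move=> mf fi; apply: (integrable_pairing mD v); last exact: A1_lty.
exact: (strongly_measurableS (@subsetT _ _) (strongly_measurable_A1_delay t mf)).
Qed.

Lemma delay_pairing_le s f (t : RM) v : strongly_measurable setT f ->
  (\int[s]_(r in D) (`|f (t - r)%R|)%:E < +oo)%E ->
  `|delay_pairing s f t v| <= L * delay_conv s D f t * `|v|.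
Proof.
move=> mf fi; have ip := integrable_delay_pairing v mf fi.
have imn : s.-integrable D (EFin \o (fun r => `|f (t - r)|)).
  apply/integrable_EFinP => //; split; last by under eq_integral do rewrite normr_id.
  by apply: measurable_funTS; apply: strongly_measurable_norm => //; exact: strongly_measurable_delay.
have ic : s.-integrable D (EFin \o (fun r => L * `|v| * `|f (t - r)|)).
  exact: (integrableZl mD (L * `|v|) imn).
rewrite (_ : L * _ * _ = \int[s]_(r in D) (L * `|v| * `|f (t - r)|)); last first.
  by rewrite RintegralZl// /delay_conv mulrAC.
apply: le_trans (le_normr_Rintegral mD ip) _.
apply: le_Rintegral => //; first exact: integrable_norm ip.
by move=> r _; rewrite (le_trans (le_dual _ _))// mulrAC ler_wpM2r.
Qed.

Lemma delay_pairingD s f g (t : RM) v : strongly_measurable setT f -> strongly_measurable setT g ->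
  (\int[s]_(r in D) (`|f (t - r)%R|)%:E < +oo)%E ->
  (\int[s]_(r in D) (`|g (t - r)%R|)%:E < +oo)%E ->
  delay_pairing s (fun t => f t + g t) t v = delay_pairing s f t v + delay_pairing s g t v.
Proof.
move=> mf mg fi gi; rewrite /delay_pairing.
rewrite -(RintegralD mD (integrable_delay_pairing v mf fi) (integrable_delay_pairing v mg gi)).
by apply: (@eq_Rintegral _ _ _ s) => r _; rewrite A1D dualD.
Qed.

End DelayPairing.

Lemma ae_imp2 {d} {S : measurableType d} {R : realType} (nu : {measure set S -> \bar R})
    (P Q F : S -> Prop) : (forall x, P x -> Q x -> F x) ->
  {ae nu, forall x, P x} -> {ae nu, forall x, Q x} -> {ae nu, forall x, F x}.
Proof.
move=> PQF nP nQ; apply: (negligibleS _ (negligibleU nP nQ)) => x Fx.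
by apply: contrapT => /not_orP[/contrapT Px /contrapT Qx]; apply: Fx; exact: PQF.
Qed.

(** * Convergence of the delay operators on a fixed function *)

Section DelayConvergence.
Context {R : realType} {V : hilbertType R}.
Notation mu := (@lebesgue_measure R).
Notation RM := (measurableTypeR R).
Variables (A1 : V -> dual V) (L tau T : R).
Hypotheses (L0 : 0 < L) (A1B : forall v w, A1 v - A1 w = A1 (v - w))
  (A1Z : forall (c : R) v, A1 (c *: v) = c *: A1 v)
  (A1L : forall v, `|A1 v| <= L * `|v|).
Variables (nu_ : nat -> {finite_measure set RM -> \bar R})
  (nu : {finite_measure set RM -> \bar R}).
Hypothesis cv : narrow_cvg tau nu_ nu.
Let D : set RM := `[0, tau]%classic.
Let mD : measurable D. Proof. exact: measurable_itv. Qed.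

Definition small_L2 (rho : RM -> R) (e : R) := [/\ measurable_fun setT rho,
  forall t, 0 <= rho t & (\int[mu]_(t in `]0%R, T[) (rho t ^+ 2)%:E <= e%:E)%E].

Definition delay_gap n (f : RM -> V) t v : R :=
  `|delay_pairing A1 tau (nu_ n) f t v - delay_pairing A1 tau nu f t v|.

(** Convergence in [L^2(0, T; dual V)], expressed by a scalar majorant [rho] common to all [v], so
    that measurability is asked of [rho] alone and not of a dual-valued difference. *)
Definition delay_cvg (f : RM -> V) := forall e : R, 0 < e -> exists N, forall n, (N <= n)%N ->
  exists2 rho, small_L2 rho e &
    {ae mu, forall t, forall v, delay_gap n f t v <= rho t * `|v|}.

Let mI : measurable (`]0, T[%classic : set RM). Proof. exact: measurable_itv. Qed.

Let muI : (mu (`]0%R, T[%classic : set RM) < +oo)%E.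
Proof. by rewrite lebesgue_measure_itv/=; case: ifP => _; rewrite ?ltry// -EFinB ltry. Qed.

Let fin_mass (s : {finite_measure set RM -> \bar R}) : (s D < +oo)%E.
Proof. by rewrite -ge0_fin_numE// fin_num_measure. Qed.

Section Scalar.
Variables (phi : R -> R) (C : R).
Hypotheses (cphi : continuous phi) (C0 : 0 <= C) (phiC : forall x, `|phi x| <= C).

Let c (s : {finite_measure set RM -> \bar R}) (t : RM) : R := \int[s]_(r in D) phi (t - r).

Let mphi (t : RM) : measurable_fun D (fun r : RM => phi (t - r)).
Proof.
apply: measurable_funTS; apply: (measurableT_comp (continuous_measurable_fun cphi)).
exact: measurable_funB.
Qed.

Let iphi (s : {finite_measure set RM -> \bar R}) (t : RM) : s.-integrable D (EFin \o (fun r : RM => phi (t - r))).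
Proof.
apply: (le_integrable_real mD (mphi t) _ (integrable_cst_lt C mD (fin_mass s))) => r _.
exact: phiC.
Qed.

(** Adding [C] makes the integrand nonnegative, so that the measurability of [delay_conv] applies;
    the added constant contributes [C] times the mass. *)
Let measurable_c s : measurable_fun setT (c s).
Proof.
have mf : strongly_measurable (setT : set RM) (fun r => phi r + C : R^o).
  apply/strongly_measurableP => //; apply: measurable_funD => //.
  exact: continuous_measurable_fun.
rewrite (_ : c s = fun t => delay_conv s D (fun r => phi r + C : R^o) t - C * fine (s D)).
  by apply: measurable_funB => //; exact: measurable_delay_conv.
apply/funext => t; rewrite /c.
have -> : delay_conv s D (fun r => phi r + C : R^o) t = \int[s]_(r in D) (phi (t - r) + C).
  apply: (@eq_Rintegral _ _ _ s) => r _; rewrite [LHS]ger0_norm//.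
  by rewrite -lerBlDr sub0r; have := phiC (t - r); rewrite ler_norml => /andP[].
rewrite (RintegralD mD (iphi s t) (integrable_cst_lt C mD (fin_mass s))).
by rewrite (Rintegral_cst s mD) addrK.
Qed.

(** For each [t] the function [phi (t - r)] of [r] is an admissible test function. The common mass
    bound gives the constant majorant [B] for dominated convergence on []0, T[]. *)
Lemma scalar_delay_cvg (K e : R) : 0 <= K -> 0 < e -> exists N, forall n, (N <= n)%N ->
  small_L2 (fun t => K * `|c (nu_ n) t - c nu t|) e.
Proof.
move=> K0 e0; have [M M0 [nuM nu_M]] := narrow_mass_bound cv.
pose rho n t := K * `|c (nu_ n) t - c nu t|.
have mrho n : measurable_fun (setT : set RM) (rho n).
  apply: measurable_funM => //; apply: measurableT_comp => //.
  exact: measurable_funB (measurable_c _) (measurable_c _).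
have rho0 n t : 0 <= rho n t by rewrite mulr_ge0.
have cM (s : {finite_measure set RM -> \bar R}) t : (s D <= M%:E)%E -> `|c s t| <= C * M.
  move=> sM; apply: le_trans (le_normr_Rintegral mD (iphi s t)) _.
  apply: (@le_trans _ _ (\int[s]_(r in D) C)).
    apply: le_Rintegral => //; first exact: integrable_norm (iphi s t).
    exact: (integrable_cst_lt C mD (fin_mass s)).
  rewrite (Rintegral_cst s mD) ler_wpM2l// -lee_fin fineK//.
  by rewrite ge0_fin_numE// fin_mass.
pose B := (K * (C * M + C * M)) ^+ 2.
have rhoB n t : rho n t ^+ 2 <= B.
  rewrite lerXn2r ?nnegrE ?mulr_ge0 ?addr_ge0 ?mulr_ge0 ?(ltW M0)// ler_wpM2l//.
  by rewrite (le_trans (ler_normB _ _))// lerD// cM.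
have rho_cvg t : (rho n t ^+ 2)%:E @[n --> \oo] --> 0%E.
  apply/(cvge0P (fun n => _)) => [n|d d0]; first by rewrite lee_fin sqr_ge0.
  have cphit : {within `[0, tau], continuous (fun r => phi (t - r))}.
    by apply: continuous_subspaceT => r; apply: continuous_comp;
      [apply: cvgB; [exact: cvg_cst|exact: cvg_id]|exact: cphi].
  have : rho n t ^+ 2 @[n --> \oo] --> (K * `|c nu t - c nu t|) ^+ 2.
    apply: cvg_sqr; apply: cvgM; first exact: cvg_cst.
    by apply: cvg_norm; apply: cvgB; [exact: (cv cphit)|exact: cvg_cst].
  rewrite subrr normr0 mulr0 expr0n/= => /cvgr_lt/(_ _ d0); apply: filterS => n.
  by rewrite lee_fin => /ltW.
have [] := @dominated_convergence _ RM R mu _ mI (fun n t => (rho n t ^+ 2)%:E) (cst 0%E)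
  (fun=> B%:E).
- by move=> n; apply/measurable_EFinP; apply: measurable_funTS; exact: measurable_funX.
- exact: measurable_cst.
- by apply: nearW => t _; exact: rho_cvg.
- exact: (integrable_cst_lt B mI muI).
- by apply: nearW => t n _; rewrite gee0_abs lee_fin ?sqr_ge0.
move=> _ _; rewrite integral0 => /(cvge0P (fun n => integral_ge0 _ _)) H.
have [N _ HN] := H (fun n t _ => sqr_ge0 (rho n t)) e e0.
exists N => n /HN /= Hn; split; [exact: mrho|exact: rho0 n|exact: Hn].
Qed.

End Scalar.

Let delay_cvg_base (phi : R -> R) (v0 : V) (M : R) : continuous phi ->
  (forall x, M < `|x| -> phi x = 0) -> delay_cvg (fun t => phi t *: v0).
Proof.
move=> cphi p0 e e0; have [C C0 phiC] := bounded_compact_support cphi p0.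
have K0 : 0 <= L * `|v0| by rewrite mulr_ge0// ltW.
have [N HN] := scalar_delay_cvg cphi C0 phiC K0 e0.
exists N => n Nn.
exists (fun t => L * `|v0| * `|\int[nu_ n]_(r in D) phi (t - r) - \int[nu]_(r in D) phi (t - r)|).
  exact: HN.
apply: nearW => t v; rewrite /delay_gap.
have mphi : measurable_fun D (fun r : RM => phi (t - r)).
  apply: measurable_funTS; apply: (measurableT_comp (continuous_measurable_fun cphi)).
  exact: measurable_funB.
have pE (s : {finite_measure set RM -> \bar R}) : delay_pairing A1 tau s (fun t => phi t *: v0) t v =
    A1 v0 v * \int[s]_(r in D) phi (t - r).
  rewrite -RintegralZl//.
    by apply: (@eq_Rintegral _ _ _ s) => r _; rewrite A1Z dualZ mulrC.
  apply: (le_integrable_real mD mphi _ (integrable_cst_lt C mD (fin_mass s))) => r _.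
  exact: phiC.
rewrite !pE -mulrBr normrM [leRHS]mulrAC ler_wpM2r// (le_trans (le_dual _ _))//.
by rewrite ler_wpM2r.
Qed.

Let delay_gapD n f g t v : strongly_measurable setT f -> strongly_measurable setT g ->
  (\int[nu_ n]_(r in D) (`|f (t - r)%R|)%:E < +oo)%E ->
  (\int[nu_ n]_(r in D) (`|g (t - r)%R|)%:E < +oo)%E ->
  (\int[nu]_(r in D) (`|f (t - r)%R|)%:E < +oo)%E ->
  (\int[nu]_(r in D) (`|g (t - r)%R|)%:E < +oo)%E ->
  delay_gap n (fun t => f t + g t) t v <= delay_gap n f t v + delay_gap n g t v.
Proof.
move=> mf mg fn gn ff gg; rewrite /delay_gap !(delay_pairingD L0 A1B A1L)//.
by rewrite opprD addrACA ler_normD.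
Qed.

Let sqn_le_small (rho rho' : RM -> R) (e e' : R) : small_L2 rho e -> small_L2 rho' e' ->
  small_L2 (fun t => rho t + rho' t) (2 * e + 2 * e').
Proof.
move=> [mr r0 re] [mr' r'0 r'e]; split; first exact: measurable_funD.
  by move=> t; rewrite addr_ge0.
have mS (f : RM -> R) : measurable_fun setT f -> measurable_fun (`]0, T[%classic : set RM) (fun t => f t ^+ 2).
  by move=> mf; apply: measurable_funTS; exact: measurable_funX.
have S (f : RM -> R) a : measurable_fun setT f -> (\int[mu]_(t in `]0%R, T[) (f t ^+ 2)%:E <= a%:E)%E ->
    int_le mu `]0, T[%classic (fun t => f t ^+ 2) a.
  by move=> mf fa; split; [exact: mS|move=> t _; exact: sqr_ge0|exact: fa].
have SS := int_leD mI (int_leZ mI (ler0n _ 2) (S _ _ mr re)) (int_leZ mI (ler0n _ 2) (S _ _ mr' r'e)).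
have [] := int_leW mI (mS _ (measurable_funD mr mr')) (fun t _ => sqr_ge0 _) _ (lexx _) SS => //.
move=> t _ /=; have := sqr_ge0 (rho t - rho' t); set x := rho t; set y := rho' t; nra.
Qed.

Let fin_ae (f : RM -> V) n : L2fun f -> {ae mu, forall t,
  (\int[nu_ n]_(r in D) (`|f (t - r)%R|)%:E < +oo)%E /\
  (\int[nu]_(r in D) (`|f (t - r)%R|)%:E < +oo)%E}.
Proof.
move=> Lf; have [M M0 [nuM nu_M]] := narrow_mass_bound cv.
by apply: ae_imp2 (delay_conv_fin mD (nu_M n) Lf) (delay_conv_fin mD nuM Lf) => t; split.
Qed.

Let small_conv (s : {finite_measure set RM -> \bar R}) (K M e : R) (f : RM -> V) :
  0 < M -> (s D <= M%:E)%E -> 0 <= K -> L2fun f -> (sqn f <= e%:E)%E ->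
  small_L2 (fun t => K * delay_conv s D f t) (K ^+ 2 * (M ^+ 2 * e)).
Proof.
move=> M0 sM K0 Lf fe; have [mf _] := Lf.
have mc := measurable_delay_conv s mD mf.
have mS (h : RM -> R) : measurable_fun setT h -> measurable_fun (setT : set RM) (fun t => h t ^+ 2).
  by move=> mh; exact: measurable_funX.
have H : int_le mu setT (fun t => delay_conv s D f t ^+ 2) (M ^+ 2 * e).
  split; [exact: mS|by move=> t _; exact: sqr_ge0|].
  apply: le_trans (sqn_delay_conv mD M0 sM Lf) _.
  by rewrite (EFinM (M ^+ 2)) lee_wpmul2l// lee_fin sqr_ge0.
have [mK _ KH] := int_leZ measurableT (sqr_ge0 K) H.
split; first exact: measurable_funM.
  by move=> t; rewrite mulr_ge0// delay_conv_ge0.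
apply: le_trans KH.
have -> : (\int[mu]_(t in `]0%R, T[) ((K * delay_conv s D f t) ^+ 2)%:E =
    \int[mu]_(t in `]0%R, T[) (K ^+ 2 * delay_conv s D f t ^+ 2)%:E)%E.
  by apply: eq_integral => t _; rewrite exprMn.
apply: ge0_subset_integral; [exact: mI|exact: measurableT|exact/measurable_EFinP| |exact: subsetT].
by move=> t _; rewrite lee_fin mulr_ge0// sqr_ge0.
Qed.

(** The limit step of [L2_ind] works because the operators for [nu_ n] and [nu] share the norm bound
    [L * M], uniformly in [n]. *)
Lemma delay_cvg_L2 f : L2fun f -> delay_cvg f.
Proof.
move: f; apply: L2_ind; first exact: delay_cvg_base.
  move=> f g Lf Lg fc gc e e0; have e4 : 0 < e / 4 by rewrite divr_gt0.
  have [N1 H1] := fc _ e4; have [N2 H2] := gc _ e4.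
  exists (maxn N1 N2) => n; rewrite geq_max => /andP[/H1[r1 s1 g1] /H2[r2 s2 g2]].
  exists (fun t => r1 t + r2 t).
    have := sqn_le_small s1 s2; rewrite -mulrDr (_ : 2 * (e / 4 + e / 4) = e)//; by field.
  have [mf _] := Lf; have [mg _] := Lg.
  apply: (ae_imp2 _ (ae_imp2 (fun t => @conj _ _) g1 g2)
    (ae_imp2 (fun t => @conj _ _) (fin_ae n Lf) (fin_ae n Lg))).
  move=> t [h1 h2] [[a b] [c d]] v; rewrite (le_trans (delay_gapD _ _ _ _ _ _ _))// mulrDl.
  by rewrite lerD.
move=> f Lf H e e0; have [M M0 [nuM nu_M]] := narrow_mass_bound cv.
have e4 : 0 < e / 4 by rewrite divr_gt0.
(* Applying [sqn_le_small] twice gives [2 * (e / 4) + 8 * (L ^+ 2 * M ^+ 2) * e' = e]. *)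
pose e' := e / (16 * (L ^+ 2 * M ^+ 2)).
have e'0 : 0 < e' by rewrite divr_gt0// !mulr_gt0// exprn_gt0.
have [g [Lg gc fg]] := H _ e'0; have [N HN] := gc _ e4.
exists N => n /HN[r sr gr].
have Lfg := L2funB Lf Lg.
have s1 := small_conv M0 (nu_M n) (ltW L0) Lfg fg.
have s2 := small_conv M0 nuM (ltW L0) Lfg fg.
exists (fun t => r t + (L * delay_conv (nu_ n) D (fun t => f t - g t) t + L * delay_conv nu D (fun t => f t - g t) t)).
  have := sqn_le_small sr (sqn_le_small s1 s2).
  rewrite (_ : 2 * (e / 4) + _ = e)// /e'; field.
  by rewrite !gt_eqF.
have [mf _] := Lf; have [mg _] := Lg; have [mfg _] := Lfg.
apply: (ae_imp2 _ gr (ae_imp2 (fun t => @conj _ _) (fin_ae n Lfg) (fin_ae n Lg))).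
move=> t h [[a b] [c d]] v.
have fE : f = fun t => g t + (f t - g t) by apply/funext => x; rewrite addrC subrK.
rewrite [in X in X <= _]fE (le_trans (delay_gapD _ _ _ _ _ _ _))// mulrDl lerD//.
rewrite /delay_gap (le_trans (ler_normB _ _))// mulrDl lerD//.
  exact: (delay_pairing_le L0 A1B A1L).
exact: (delay_pairing_le L0 A1B A1L).
Qed.

End DelayConvergence.

(** * Stability *)

Lemma ae_Rintegral_le {d} {S : measurableType d} {R : realType}
    (nu : {measure set S -> \bar R}) (D : set S) (f g : S -> R) (A : R) :
  measurable D -> nu.-integrable D (EFin \o f) -> int_le nu D g A ->
  {ae nu, forall x, D x -> f x <= g x} -> \int[nu]_(x in D) f x <= A.
Proof.
move=> mD intf [mg g0 gA] fg.
have mf : measurable_fun D f by move/measurable_int/measurable_EFinP : intf.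
have mp : measurable_fun D (fun x => Num.max (f x) 0) by exact: measurable_maxr.
have ip : nu.-integrable D (EFin \o (fun x => Num.max (f x) 0)).
  apply: (le_integrable_real mD mp _ (integrable_norm intf)) => x _.
  rewrite ger0_norm ?le_max ?lexx ?orbT// ge_max normr_ge0 andbT; exact: ler_norm.
apply: (@le_trans _ _ (\int[nu]_(x in D) Num.max (f x) 0)).
  by apply: le_Rintegral => // x _; rewrite le_max lexx.
rewrite -lee_fin fineK ?integrable_fin_num//; apply: le_trans gA.
apply: ae_ge0_le_integral => //.
- by move=> x _; rewrite lee_fin le_max lexx orbT.
- exact/measurable_EFinP.
- exact/measurable_EFinP.
- move: fg; apply: filterS => x fg Dx; by rewrite lee_fin ge_max fg// g0.
Qed.

(** The method of steps: advancing by [d] replaces the constant [b] by [B * (b + 1)], starting from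
    0 at nonpositive times. *)
Lemma discrete_gronwall {R : realType} (Y : R -> R) (B d e T : R) (k : nat) :
  0 < d -> 0 <= B -> 0 <= e -> (forall t, t <= 0 -> Y t <= 0) ->
  (forall t, 0 < t -> t <= T -> Y t <= B * (Y (t - d) + e)) ->
  forall t, t <= T -> t <= k%:R * d -> Y t <= iter k (fun b => B * (b + 1)) 0 * e.
Proof.
move=> d0 B0 e0 Y0 YB.
have b0 m : 0 <= iter m (fun b => B * (b + 1)) 0 by elim: m => //= m IH; rewrite mulr_ge0// addr_ge0.
elim: k => [t _|k IH t tT]; first by rewrite mul0r => /Y0; rewrite mul0r.
have [t0 _|t0 tk] := leP t 0; first by rewrite (le_trans (Y0 _ t0))// mulr_ge0.
rewrite (le_trans (YB _ t0 tT))//= -mulrA ler_wpM2l// mulrDl mul1r lerD2r IH//.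
  by rewrite (le_trans _ tT)// gerBl ltW.
by rewrite lerBlDr (le_trans tk)// mulrSr mulrDl mul1r.
Qed.

Lemma sqr_sum3_le {R : realType} (a b c : R) :
  (a + (b + c)) ^+ 2 <= 3 * (a ^+ 2 + (b ^+ 2 + c ^+ 2)).
Proof.
have := sqr_ge0 (a - b); have := sqr_ge0 (b - c); have := sqr_ge0 (a - c); nra.
Qed.

(** Half of the coercivity pays for [x]. The three summands are meant for the short delays, the long
    delays and the right-hand side. *)
Lemma dissipation_young {R : realType} (alpha x a b c : R) : 0 < alpha ->
  (a + (b + c)) * x <= alpha / 2 * x ^+ 2 + 3 / (2 * alpha) * (a ^+ 2 + (b ^+ 2 + c ^+ 2)).
Proof.
move=> a0; have a2 : 0 < 2 * alpha by rewrite mulr_gt0.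
rewrite -(ler_pM2l a2).
have -> : 2 * alpha * (alpha / 2 * x ^+ 2 + 3 / (2 * alpha) * (a ^+ 2 + (b ^+ 2 + c ^+ 2))) =
  alpha ^+ 2 * x ^+ 2 + 3 * (a ^+ 2 + (b ^+ 2 + c ^+ 2)) by field; rewrite gt_eqF.
have := sqr_sum3_le a b c; set S := _ + (b + c) => h.
have := sqr_ge0 (alpha * x - S); move: h; set Q := 3 * _; nra.
Qed.

Section Stability.
Context {R : realType} {V H : hilbertType R}.
Notation mu := (@lebesgue_measure R).
Notation RM := (measurableTypeR R).
Variables (T tau alpha L0 L M d m e : R) (s : {finite_measure set RM -> \bar R}).
Hypotheses (T_gt0 : 0 < T) (alpha_gt0 : 0 < alpha) (L0_gt0 : 0 < L0) (L_gt0 : 0 < L)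
  (M_gt0 : 0 < M) (d_gt0 : 0 < d) (m_gt0 : 0 < m) (e_ge0 : 0 <= e).
Let D : set RM := `[0, tau]%classic.
Hypotheses (sM : (s D <= M%:E)%E) (sm : (s (D `&` `[0%R, d]) <= m%:E)%E).
(** Exactly what makes [3 / (2 * alpha) * (L ^+ 2 * m ^+ 2)] at most [alpha / 4], so that the short
    delays can be absorbed. *)
Hypothesis m_small : 6 * (L ^+ 2 * m ^+ 2) <= alpha ^+ 2.
Variables (w : RM -> V) (g : RM -> dual V) (W : R -> H) (rho : RM -> R).
Hypotheses (Lw : L2fun w) (Lg : L2fun g) (rho_e : small_L2 T rho e).
Hypothesis w_supp : forall t, ~ `[0, T[%classic t -> w t = 0.
Hypothesis energy : forall t, 0 <= t -> t <= T ->
  `|W t| ^+ 2 = 2 * \int[mu]_(r in `[0, t]) (g r (w r)).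
Hypothesis dissipation : {ae mu, forall t, `]0, T[%classic t ->
  g t (w t) <= - alpha * `|w t| ^+ 2 + (L * delay_conv s D w t + rho t) * `|w t|}.
Hypothesis g_le : {ae mu, forall t, `]0, T[%classic t ->
  `|g t| <= L0 * `|w t| + (L * delay_conv s D w t + rho t)}.

Let mD : measurable D. Proof. exact: measurable_itv. Qed.
Let D1 : set RM := D `&` `[0, d]%classic.
Let D2 : set RM := D `\` `[0, d]%classic.
Let mD1 : measurable D1. Proof. by apply: measurableI. Qed.
Let mD2 : measurable D2. Proof. by apply: measurableD. Qed.

Let sD2 : (s D2 <= M%:E)%E.
Proof. by apply: le_trans sM; apply: le_measure; rewrite ?inE//; exact: subDsetl. Qed.

Let mw : strongly_measurable (setT : set RM) w. Proof. by case: Lw. Qed.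

Let Y t := \int[mu]_(r in `]0, t[) (`|w r| ^+ 2).

Let Lz t : L2fun (zext (`[0, t[ : set RM) w).
Proof.
apply: (L2fun_le _ Lw); first exact: strongly_measurable_zext (strongly_measurableS (@subsetT _ _) mw).
by move=> r; rewrite /zext; case: ifP => //; rewrite normr0.
Qed.

Let YE t : sqn (zext (`[0, t[ : set RM) w) = (Y t)%:E.
Proof.
rewrite sqn_zext -integral_itv_obnd_cbnd.
  rewrite fineK// integrable_fin_num//.
  apply: (integrableS measurableT) (integrable_sqr Lw) => //.
by apply/measurable_EFinP; apply: measurable_funTS; apply: measurable_funX; exact: strongly_measurable_norm.
Qed.

Let Y_le0 t : t <= 0 -> Y t <= 0.
Proof. by move=> t0; rewrite /Y set_itv_ge ?Rintegral_set0// bnd_simp -leNgt. Qed.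

(** A delay in [D1] still sees [w] before [t], while a delay in [D2] exceeds [d] and sees [w] only
    before [t - d]. Negative times contribute nothing, by [w_supp]. *)
Let conv_split t r : r < t -> (\int[s]_(x in D) (`|w (r - x)%R|)%:E < +oo)%E ->
  delay_conv s D w r <= delay_conv s D1 (zext (`[0, t[ : set RM) w) r + delay_conv s D2 (zext (`[0, (t - d)%R[ : set RM) w) r.
Proof.
move=> rt wi.
have mwr : strongly_measurable (setT : set RM) (fun x => w (r - x)) := strongly_measurable_delay r mw.
have iw : s.-integrable D (EFin \o (fun x => `|w (r - x)|)).
  apply/integrable_EFinP => //; split; last by under eq_integral do rewrite normr_id.
  by apply: measurable_funTS; exact: strongly_measurable_norm.
have E1 : delay_conv s D1 (zext (`[0, t[ : set RM) w) r = \int[s]_(x in D1) `|w (r - x)|.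
  apply: (@eq_Rintegral _ _ _ s) => x; rewrite inE => -[/=]; rewrite in_itv/= => /andP[x0 _] _.
  have [rx|rx] := leP 0 (r - x).
    by rewrite zextE//= in_itv/= rx ltrBlDr (lt_le_trans rt)// lerDl.
  by rewrite w_supp ?zext0//= in_itv/= leNgt rx.
have E2 : delay_conv s D2 (zext (`[0, t - d[ : set RM) w) r = \int[s]_(x in D2) `|w (r - x)|.
  apply: (@eq_Rintegral _ _ _ s) => x; rewrite inE => -[Dx nx].
  move: Dx; rewrite /D/= in_itv/= => /andP[x0 _].
  have dx : d < x by rewrite ltNge; apply/negP => xd; apply: nx; rewrite /= in_itv/= x0.
  have [rx|rx] := leP 0 (r - x).
    by rewrite zextE//= in_itv/= rx ltrD// ltrN2.
  by rewrite w_supp ?zext0//= in_itv/= leNgt rx.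
rewrite E1 E2 /delay_conv -[X in Rintegral _ X]/D -[X in Rintegral _ X _ <= _](setUIDK D `[0, d]%classic).
rewrite Rintegral_setU//; first by rewrite setUIDK.
by apply/disj_setPS => x [[_ xd] [_ /(_ xd)]].
Qed.

Let subI t : t <= T -> (`]0, t[%classic : set RM) `<=` `]0, T[%classic.
Proof. by move=> tT r /=; rewrite !in_itv/= => /andP[-> /lt_le_trans]; apply. Qed.

Let conv_int_le (A : set RM) (N t x : R) : measurable A -> 0 < N -> (s A <= N%:E)%E ->
  int_le mu (`]0, t[%classic : set RM)
    (fun r => (L * delay_conv s A (zext (`[0, x[ : set RM) w) r) ^+ 2) (L ^+ 2 * (N ^+ 2 * Y x)).
Proof.
move=> mA N0 sA.
have [mc c0 cI] : int_le mu (setT : set RM)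
    (fun r => delay_conv s A (zext (`[0, x[ : set RM) w) r ^+ 2) (N ^+ 2 * Y x).
  split; [|by move=> r _; exact: sqr_ge0|].
    by apply: measurable_funX; apply: measurable_delay_conv => //; case: (Lz x).
  by apply: le_trans (sqn_delay_conv mA N0 sA (Lz x)) _; rewrite YE EFinM.
have hI : int_le mu (`]0, t[%classic : set RM)
    (fun r => delay_conv s A (zext (`[0, x[ : set RM) w) r ^+ 2) (N ^+ 2 * Y x).
  split; [exact: measurable_funTS|by move=> r _; exact: sqr_ge0|].
  by apply: le_trans cI; apply: ge0_subset_integral => //; exact/measurable_EFinP.
have mI : measurable (`]0, t[%classic : set RM) by exact: measurable_itv.
have [mH _ HI] := int_leZ mI (sqr_ge0 L) hI.
split; [|by move=> r _; exact: sqr_ge0|].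
- by apply: eq_measurable_fun mH => r _; rewrite exprMn.
- by apply: le_trans HI; under eq_integral do rewrite exprMn.
Qed.

Let rho_int_le t : t <= T -> int_le mu (`]0, t[%classic : set RM) (fun r => rho r ^+ 2) e.
Proof.
move=> tT; have [mr _ rI] := rho_e; split; [|by move=> r _; exact: sqr_ge0|].
  by apply: measurable_funTS; exact: measurable_funX.
apply: le_trans rI; apply: ge0_subset_integral => //; last exact: subI.
  by apply/measurable_EFinP; apply: measurable_funTS; exact: measurable_funX.
by move=> r _; rewrite lee_fin sqr_ge0.
Qed.

Let fin_ae : {ae mu, forall t, (\int[s]_(r in D) (`|w (t - r)%R|)%:E < +oo)%E}.
Proof. exact: (delay_conv_fin mD sM). Qed.

(** Half of the coercive term stays on the left, the other half is spent in [dissipation_young]; the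
    convolution inequality then bounds each delay term by the mass of its part of the kernel. *)
Let energy_estimate t : 0 < t -> t <= T ->
  `|W t| ^+ 2 / 2 + alpha / 2 * Y t <= 3 / (2 * alpha) *
    (L ^+ 2 * (m ^+ 2 * Y t) + (L ^+ 2 * (M ^+ 2 * Y (t - d)) + e)).
Proof.
move=> t0 tT; have mI : measurable (`]0, t[%classic : set RM) by exact: measurable_itv.
have ip := integrable_pairing_L2 Lw Lg.
have ipI := integrableS measurableT mI (@subsetT _ _) ip.
have iwI := integrableS measurableT mI (@subsetT _ _) (integrable_sqr Lw).
have E : `|W t| ^+ 2 / 2 = \int[mu]_(r in `]0, t[) (g r (w r)).
  rewrite energy ?(ltW t0)// mulrAC divff// mul1r.
  rewrite Rintegral_itv_obnd_cbnd//; rewrite Rintegral_itv_bndo_bndc//.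
  have mJ : measurable (`[0, t[%classic : set RM) by exact: measurable_itv.
  exact: (integrableS measurableT mJ (@subsetT _ _) ip).
pose F r := g r (w r) + alpha / 2 * `|w r| ^+ 2.
have iF : mu.-integrable (`]0, t[%classic : set RM) (EFin \o F).
  exact: (integrableD mI ipI (integrableZl mI (alpha / 2) iwI)).
have -> : `|W t| ^+ 2 / 2 + alpha / 2 * Y t = \int[mu]_(r in `]0, t[) F r.
  rewrite (RintegralD mI ipI (integrableZl mI (alpha / 2) iwI)) E; congr (_ + _).
  by rewrite RintegralZl.
have a0 : 0 <= 3 / (2 * alpha) by rewrite divr_ge0// mulr_ge0// ltW.
have G := int_leZ mI a0 (int_leD mI (conv_int_le t t mD1 m_gt0 sm)
  (int_leD mI (conv_int_le t (t - d) mD2 M_gt0 sD2) (rho_int_le tT))).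
apply: (ae_Rintegral_le mI iF G).
apply: (ae_imp2 _ dissipation fin_ae) => r Hr fr rI.
have {Hr} := Hr (subI tT rI).
have rt : r < t by move: rI => /=; rewrite in_itv/= => /andP[].
have := conv_split rt fr; rewrite /F.
have [_ r0 _] := rho_e; have := r0 r.
have := delay_conv_ge0 s D w r.
have := normr_ge0 (w r).
set c := delay_conv s D w r; set c1 := delay_conv s D1 _ r; set c2 := delay_conv s D2 _ r.
set x := `|w r|; set p := rho r; set y := g r (w r) => x0 c0 p0 cc yx.
have q : L * c + p <= L * c1 + (L * c2 + p).
  by rewrite addrA -mulrDr lerD2r ler_wpM2l// ltW.
have := @dissipation_young R alpha x (L * c1) (L * c2) p alpha_gt0.
have : (L * c + p) * x <= (L * c1 + (L * c2 + p)) * x by rewrite ler_wpM2r.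
move: yx; set z := _ * x; set z' := _ * x; set S := _ / _ * _; set X := x ^+ 2.
lra.
Qed.

(** The short-delay term costs [alpha / 4] of the remaining [alpha / 2], so the right-hand side
    involves only the time [t - d]. *)
Let gain t : 0 < t -> t <= T ->
  `|W t| ^+ 2 / 2 + alpha / 4 * Y t <= 3 / (2 * alpha) * (L ^+ 2 * (M ^+ 2 * Y (t - d)) + e).
Proof.
move=> t0 tT; have := energy_estimate t0 tT.
have Y0 : 0 <= Y t by apply: Rintegral_ge0 => r _; exact: sqr_ge0.
have : 3 / (2 * alpha) * (L ^+ 2 * (m ^+ 2 * Y t)) <= alpha / 4 * Y t.
  have -> : 3 / (2 * alpha) * (L ^+ 2 * (m ^+ 2 * Y t)) =
      (4 * alpha)^-1 * (6 * (L ^+ 2 * m ^+ 2)) * Y t by field; rewrite gt_eqF.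
  have -> : alpha / 4 * Y t = (4 * alpha)^-1 * alpha ^+ 2 * Y t by field; rewrite gt_eqF.
  by rewrite ler_wpM2r// ler_wpM2l// invr_ge0 mulr_ge0// ltW.
rewrite mulrDr; set a := _ * (L ^+ 2 * (m ^+ 2 * _)); set b := _ * (_ + e).
set c := _ / 2; set y := Y t; lra.
Qed.

Variable k : nat.
Hypothesis Tkd : T <= k%:R * d.
(** Dividing [gain] by [alpha / 4] turns the factor [3 / (2 * alpha)] into [6 / alpha ^+ 2]; the
    [+ 1] puts the [Y (t - d)] term and [e] under one factor. *)
Let B := 6 / alpha ^+ 2 * (L ^+ 2 * M ^+ 2 + 1).
Let b := iter k (fun b => B * (b + 1)) 0.

Let B0 : 0 <= B.
Proof.
apply: mulr_ge0; first by apply: divr_ge0 => //; exact: sqr_ge0.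
by apply: addr_ge0 => //; apply: mulr_ge0; exact: sqr_ge0.
Qed.

Let b0 : 0 <= b.
Proof. by rewrite /b; elim: (k) => //= i IH; apply: mulr_ge0 => //; exact: addr_ge0. Qed.

Let Y_ge0 t : 0 <= Y t.
Proof. by apply: Rintegral_ge0 => r _; exact: sqr_ge0. Qed.

Let Y_le t : t <= T -> Y t <= b * e.
Proof.
move=> tT; apply: (discrete_gronwall d_gt0 B0 e_ge0 Y_le0 _ tT); last exact: le_trans Tkd.
move=> x x0 xT; have := gain x0 xT; have := sqr_ge0 `|W x|.
have := Y_ge0 (x - d); have LM0 : 0 <= L ^+ 2 * M ^+ 2 by rewrite mulr_ge0 ?sqr_ge0.
rewrite (mulrA (L ^+ 2)) /B; set LM := L ^+ 2 * _ in LM0 *; set y' := Y (x - d); set y := Y x.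
set W2 := `|W x| ^+ 2 => y'0 W0 h.
have h2 : alpha / 4 * y <= 3 / (2 * alpha) * (LM * y' + e).
  by apply: le_trans h; rewrite lerDr divr_ge0.
have h3 : LM * y' + e <= (LM + 1) * (y' + e).
  rewrite mulrDl !mulrDr !mul1r; have := mulr_ge0 LM0 e_ge0; lra.
have a4 : 0 < alpha / 4 by rewrite divr_gt0.
rewrite -(ler_pM2l a4) (le_trans h2)//.
have -> : alpha / 4 * (6 / alpha ^+ 2 * (LM + 1) * (y' + e)) =
  3 / (2 * alpha) * ((LM + 1) * (y' + e)) by field; rewrite gt_eqF.
by rewrite ler_wpM2l// divr_ge0// mulr_ge0// ltW.
Qed.

Let LM_le y : y <= b * e ->
  L ^+ 2 * (M ^+ 2 * y) + e <= L ^+ 2 * (M ^+ 2 * b) * e + e.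
Proof.
move=> yb; have -> : L ^+ 2 * (M ^+ 2 * b) * e = L ^+ 2 * (M ^+ 2 * (b * e)) by ring.
by rewrite lerD2r; apply: ler_wpM2l; [exact: sqr_ge0|apply: ler_wpM2l; [exact: sqr_ge0|]].
Qed.

Lemma stability_L2 : (sqn w <= (b * e)%:E)%E.
Proof.
have -> : w = zext (`[0, T[%classic : set RM) w.
  apply/funext => t; have [tT|tT] := pselect (`[0, T[%classic t); first by rewrite zextE.
  by rewrite zext0// w_supp.
by rewrite YE lee_fin Y_le.
Qed.

Lemma stability_sup t : 0 <= t -> t <= T ->
  `|W t| ^+ 2 <= 3 / alpha * (L ^+ 2 * (M ^+ 2 * b) + 1) * e.
Proof.
have a0 : 0 <= 3 / alpha by rewrite divr_ge0// ltW.
have LM : 0 <= L ^+ 2 * M ^+ 2 by rewrite mulr_ge0 ?sqr_ge0.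
rewrite le_eqVlt => /predU1P[<- _|t0 tT].
  rewrite energy ?lexx ?(ltW T_gt0)// set_itv1 Rintegral_set1 mulr0.
  by rewrite mulr_ge0// mulr_ge0// addr_ge0// mulrA mulr_ge0.
have h := gain t0 tT; have y0 := Y_ge0 t.
have tdT : t - d <= T by rewrite (le_trans _ tT)// gerBl ltW.
have h2 : L ^+ 2 * (M ^+ 2 * Y (t - d)) + e <= (L ^+ 2 * (M ^+ 2 * b) + 1) * e.
  by rewrite mulrDl mul1r; apply: LM_le; exact: Y_le.
have a2 : 0 <= 3 / (2 * alpha) by rewrite divr_ge0// mulr_ge0// ltW.
have h3 := ler_wpM2l a2 h2.
have h4 : 0 <= alpha / 4 * Y t by rewrite mulr_ge0// divr_ge0// ltW.
have -> : 3 / alpha * (L ^+ 2 * (M ^+ 2 * b) + 1) * e =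
  2 * (3 / (2 * alpha) * ((L ^+ 2 * (M ^+ 2 * b) + 1) * e)) by field; rewrite gt_eqF.
move: h h3 h4; set P := _ * (_ + e); set Q := _ * (_ * e); set Z := alpha / 4 * _; set W2 := `|W t| ^+ 2.
lra.
Qed.

(** The pointwise bound [g_le] is squared and integrated; the factor 3 comes from [sqr_sum3_le]. *)
Lemma stability_derivative :
  (\int[mu]_(t in `]0%R, T[) (`|g t| ^+ 2)%:E <=
   (3 * (L0 ^+ 2 * b + (L ^+ 2 * (M ^+ 2 * b) + 1)) * e)%:E)%E.
Proof.
have mI : measurable (`]0, T[%classic : set RM) by exact: measurable_itv.
have iw : int_le mu (`]0, T[%classic : set RM) (fun r => `|w r| ^+ 2) (Y T).
  split; [|by move=> r _; exact: sqr_ge0|].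
    by apply: measurable_funTS; apply: measurable_funX; exact: strongly_measurable_norm.
  rewrite /Y fineK// integrable_fin_num//.
  exact: (integrableS measurableT mI (@subsetT _ _) (integrable_sqr Lw)).
have zw : zext (`[0, T[%classic : set RM) w = w.
  apply/funext => t; have [tT|tT] := pselect (`[0, T[%classic t); first by rewrite zextE.
  by rewrite zext0// w_supp.
have ic := conv_int_le T T mD M_gt0 sM; rewrite zw in ic.
have [mG G0 GI] := int_leZ mI (ler0n R 3) (int_leD mI (int_leZ mI (sqr_ge0 L0) iw)
  (int_leD mI ic (rho_int_le (lexx T)))).
apply: (@le_trans _ _ (3 * (L0 ^+ 2 * Y T + (L ^+ 2 * (M ^+ 2 * Y T) + e)))%:E); last first.
  rewrite lee_fin -mulrA ler_wpM2l// mulrDl !(mulrDl _ _ e) mul1r.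
  have YT := Y_le (lexx T).
  apply: lerD; first by rewrite -mulrA; apply: ler_wpM2l => //; exact: sqr_ge0.
  exact: LM_le.
apply: le_trans GI; apply: ae_ge0_le_integral => //.
- apply/measurable_EFinP; apply: measurable_funTS; apply: measurable_funX.
  by apply: strongly_measurable_norm => //; case: Lg.
- exact/measurable_EFinP.
apply: (ae_imp2 _ g_le g_le) => t Hg _ tI; rewrite lee_fin.
have [_ r0 _] := rho_e; have := r0 t; have := delay_conv_ge0 s D w t.
have := Hg tI; have := normr_ge0 (w t).
set c := delay_conv s D w t; set x := `|w t|; set p := rho t; set y := `|g t| => x0 yx c0 p0.
have y0 : 0 <= y by exact: normr_ge0.
have sq : y ^+ 2 <= (L0 * x + (L * c + p)) ^+ 2.
  by rewrite lerXn2r// nnegrE (le_trans y0).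
apply: le_trans sq _; rewrite -exprMn; exact: sqr_sum3_le.
Qed.

End Stability.

(** * The difference of two solutions *)

Section Difference.
Context {R : realType} {V H : hilbertType R} (j : gelfand_embedding V H).
Notation mu := (@lebesgue_measure R).
Notation RM := (measurableTypeR R).
Variables (T tau L : R) (A0 A1 : V -> dual V).
Hypotheses (sV : separable V) (T_gt0 : 0 < T) (tau_gt0 : 0 < tau) (L_gt0 : 0 < L)
  (A0B : forall v w, A0 v - A0 w = A0 (v - w))
  (A1B : forall v w, A1 v - A1 w = A1 (v - w))
  (A1L : forall v, `|A1 v| <= L * `|v|).
Variables (u0 : H) (f : R -> dual V) (psi : R -> V).
Hypothesis psi_L2 : in_L2 (- tau) 0 psi.

(** The truncation puts the joined trajectory in L^2 of the line. It is invisible to the delay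
    operator at times in []0, T[], since [t - r] then lies in [[- tau, T[] for all delays [r] in
    [[0, tau]]. *)
Definition joined_ext (u : RM -> V) : RM -> V := zext (`[(- tau), T[%classic : set RM) (joined psi u).

Lemma joined_ext_L2 u : in_L2 0 T u -> L2fun (joined_ext u).
Proof.
move=> Lu; rewrite (_ : joined_ext u = fun t => zext (`[(- tau), 0[%classic : set RM) psi t +
    zext (`[0, T[%classic : set RM) u t).
  exact: L2funD (in_L2_zext_left psi_L2) (in_L2_zext_left Lu).
apply/funext => t; rewrite /joined_ext /joined /zext !mem_setE/= !in_itv/=.
have [t0|t0] := ltP t 0; first by rewrite (lt_trans t0 T_gt0) addr0.
by rewrite andbF add0r (le_trans _ t0)// lerNl oppr0 ltW.
Qed.

Lemma joined_split (u v : RM -> V) t : `[(- tau), T[%classic t ->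
  joined psi v t = joined_ext u t + zext (`[0, T[%classic : set RM) (fun t => v t - u t) t.
Proof.
move=> tI; rewrite /joined_ext zextE// /joined.
move: tI; rewrite /= in_itv/= => /andP[_ tT].
have [t0|t0] := ltP t 0; first by rewrite zext0 ?addr0//= in_itv/= leNgt t0.
by rewrite zextE/= ?in_itv/= ?t0// addrC subrK.
Qed.

(** The common history cancels: on [[- tau, T[] the joined trajectory of [v] is exactly [F + w]. The
    equations are subtracted after testing on [z], at times where all the delay integrals are finite
    and [dt] of the difference is the difference of the [dt]. *)
Lemma difference_equation (s nu : {finite_measure set RM -> \bar R}) (M : R) (v u : R -> V) :
  (s `[0%R, tau]%classic <= M%:E)%E -> (nu `[0%R, tau]%classic <= M%:E)%E ->
  weak_solution j A0 A1 T tau s u0 f psi v -> weak_solution j A0 A1 T tau nu u0 f psi u ->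
  let w : RM -> V := zext (`[0, T[%classic : set RM) (fun t => v t - u t) in
  let F := joined_ext u in
  {ae mu, forall t, `]0, T[%classic t ->
    forall z, dt j T (fun t => v t - u t) t z = - A0 (w t) z - delay_pairing A1 tau s w t z -
      (delay_pairing A1 tau s F t z - delay_pairing A1 tau nu F t z)}.
Proof.
move=> sM nuM [Wv _ ev] [Wu _ eu] w F.
have [Lgv dv] := dt_spec Wv; have [Lgu du] := dt_spec Wu.
have [Lv _] := Wv; have [Lu _] := Wu.
have Lw0 := in_L2B Lv Lu; have Lg0 := in_L2B Lgv Lgu.
have dw := is_weak_derivativeB Lv Lu Lgv Lgu dv du.
have Ww : in_W j T (fun t => v t - u t) by split => //; eexists; [exact: Lg0|exact: dw].
have [Lgw dw'] := dt_spec Ww.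
have gE := weak_derivative_unique sV Lw0 Lgw Lg0 dw' dw.
have Lw : L2fun w := in_L2_zext_left Lw0.
have LF : L2fun F := joined_ext_L2 Lu.
have [mw _] := Lw; have [mF _] := LF.
have mD : measurable (`[0, tau]%classic : set RM) by exact: measurable_itv.
have fw := delay_conv_fin mD sM Lw.
have fF := delay_conv_fin mD sM LF.
have fFw := delay_conv_fin mD sM (L2funD LF Lw).
have fFn := delay_conv_fin mD nuM LF.
have C P Q := @ae_imp2 _ _ _ mu P Q _ (fun t => @conj _ _).
apply: (ae_imp2 _ (C _ _ gE (C _ _ ev eu)) (C _ _ (C _ _ fw fF) (C _ _ fFw fFn))).
move=> t [gt [evt eut]] [[wt Ft] [Fwt Fnt]] tI z.
have tI' : t \in `]0, T[%R by [].
have {}gt := gt tI'; have {}evt := evt tI'; have {}eut := eut tI'.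
move: tI => /=; rewrite in_itv/= => /andP[t0 tT].
have tD r : `[0, tau]%classic r -> `[(- tau), T[%classic (t - r).
  rewrite /= !in_itv/= => /andP[r0 rtau]; rewrite lerBrDr addrC.
  by rewrite (le_trans _ (ltW t0)) ?subr_le0//= ltrBlDr (lt_le_trans tT)// lerDl.
have w0E : w t = v t - u t by rewrite /w zextE//= in_itv/= (ltW t0).
have [mFw _] := L2funD LF Lw.
have K1 : delay_op A1 tau s (joined psi v) t z = delay_pairing A1 tau s F t z + delay_pairing A1 tau s w t z.
  have -> : delay_op A1 tau s (joined psi v) t = delay_op A1 tau s (fun r => F r + w r) t.
    by apply: eq_bochner_integral => r rD; rewrite (joined_split u)//; exact: tD.
  exact: etrans (delay_opE L_gt0 A1B A1L z mFw Fwt) (delay_pairingD L_gt0 A1B A1L z mF mw Ft wt).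
have K2 : delay_op A1 tau nu (joined psi u) t z = delay_pairing A1 tau nu F t z.
  have -> : delay_op A1 tau nu (joined psi u) t = delay_op A1 tau nu F t.
    by apply: eq_bochner_integral => r rD; rewrite /F /joined_ext zextE//; exact: tD.
  exact: (delay_opE L_gt0 A1B A1L z mF Fnt).
have h1 : dt j T v t z + A0 (v t) z + (delay_pairing A1 tau s F t z + delay_pairing A1 tau s w t z) = f t z.
  by rewrite -K1; exact: (congr1 (fun F : dual V => F z) evt).
have h2 : dt j T u t z + A0 (u t) z + delay_pairing A1 tau nu F t z = f t z.
  by rewrite -K2; exact: (congr1 (fun F : dual V => F z) eut).
have h3 : dt j T (fun t => v t - u t) t z = dt j T v t z - dt j T u t z :=
  congr1 (fun F : dual V => F z) gt.
have h4 : A0 (v t - u t) z = A0 (v t) z - A0 (u t) z :=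
  congr1 (fun F : dual V => F z) (esym (A0B (v t) (u t))).
have alg (a b c d e p q r : R) : a + c + (p + q) = e -> b + d + r = e ->
  a - b = - (c - d) - q - (p - r).
  by move=> <- bdr; rewrite (_ : b = b + d + r - d - r); [rewrite bdr; ring|ring].
rewrite h3 w0E h4; exact: alg h1 h2.
Qed.

End Difference.

(** * From squared bounds to the convergences of the statement *)

Lemma L2_norm_sqr {R : realType} {E : normedModType R} (a b r : R) (f : R -> E) :
  (\int[@lebesgue_measure R]_(t in `]a, b[) (`|f t| ^+ 2)%:E <= r%:E)%E ->
  (0 <= L2_norm a b f ^+ 2 <= r%:E)%E.
Proof.
move=> fr; rewrite /L2_norm; move: fr.
have : (0 <= \int[@lebesgue_measure R]_(t in `]a, b[) (`|f t| ^+ 2)%:E)%E.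
  by apply: integral_ge0 => t _; rewrite lee_fin sqr_ge0.
move: (\int[_]_(t in _) _)%E => -[x| |]//= x0 xr.
rewrite lee_fin in x0; rewrite powR12_sqrt// -EFinM -expr2 sqr_sqrtr// lee_fin x0.
exact: xr.
Qed.

Lemma uniform_cvgP {R : realType} {E : normedModType R} (A : set R) (F : nat -> R -> E) (G : R -> E) :
  (forall e : R, 0 < e -> \forall n \near \oo, forall t, A t -> `|F n t - G t| < e) ->
  {uniform A, F @ \oo --> G}.
Proof.
move=> FG P /uniform_nbhs[B [eB BP]].
move: eB; rewrite -entourage_ballE => -[e /= e0 eB].
apply: filterS (FG e e0) => n Fn; apply: BP => t At; apply: eB => /=.
by rewrite -ball_normE/= distrC Fn.
Qed.

Lemma poweR_half_le {R : realType} (x : \bar R) (e : R) : (0 <= x)%E -> 0 < e ->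
  (x <= (e ^+ 2)%:E)%E -> (x `^ 2^-1 <= e%:E)%E.
Proof.
move: x => [r| |]//= r0 e0 re; rewrite lee_fin in r0; rewrite lee_fin powR12_sqrt//.
by rewrite -[leRHS](gtr0_norm e0) -sqrtr_sqr ler_wsqrtr.
Qed.

Theorem theorem5p8 (R : realType) (V H : hilbertType R)
    (sepV : separable V) (sepH : separable H) (j : gelfand_embedding V H)
    (T tau : R) (T_gt0 : 0 < T) (tau_gt0 : 0 < tau)
    (a0 a1 : {biscalar V}) (Lambda0 Lambda1 alpha0 : R)
    (Lambda0_gt0 : 0 < Lambda0) (Lambda1_gt0 : 0 < Lambda1)
    (alpha0_gt0 : 0 < alpha0)
    (a0_bounded : forall w v : V, `|a0 w v| <= Lambda0 * `|w| * `|v|)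
    (a1_bounded : forall w v : V, `|a1 w v| <= Lambda1 * `|w| * `|v|)
    (a0_coercive : forall v : V, alpha0 * `|v| ^+ 2 <= a0 v v)
    (A0 A1 : V -> dual V)
    (A0E : forall w v : V, A0 w v = a0 w v)
    (A1E : forall w v : V, A1 w v = a1 w v)
    (mu_ : nat -> {finite_measure set (measurableTypeR R) -> \bar R})
    (mu : {finite_measure set (measurableTypeR R) -> \bar R})
    (mu_M : forall n, Mplus0 tau (mu_ n)) (mu_Mlim : Mplus0 tau mu)
    (mu_cvg : narrow_cvg tau mu_ mu)
    (u0 : H) (f : R -> dual V) (psi : R -> V)
    (f_L2 : in_L2 0 T f) (psi_L2 : in_L2 (- tau) 0 psi)
    (u_ : nat -> R -> V) (u : R -> V)
    (u_sol : forall n, weak_solution j A0 A1 T tau (mu_ n) u0 f psi (u_ n))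
    (u_sol_lim : weak_solution j A0 A1 T tau mu u0 f psi u) :
  W_norm j T (fun t => u_ n t - u t) @[n --> \oo] --> 0%E /\
  {uniform `[0, T], (fun n => Crepr j T (u_ n)) @ \oo --> Crepr j T u}.
Proof.
have A0B v w : A0 v - A0 w = A0 (v - w).
  by apply: dual_ext => z; rewrite dualB !A0E linearBl.
have A1B v w : A1 v - A1 w = A1 (v - w).
  by apply: dual_ext => z; rewrite dualB !A1E linearBl.
have A1Z (c : R) v : A1 (c *: v) = c *: A1 v.
  by apply: dual_ext => z; rewrite dualZ !A1E linearZl_LR.
have A1L v : `|A1 v| <= Lambda1 * `|v|.
  apply: dual_norm_le => [|z]; first by rewrite mulr_ge0// ltW.
  by rewrite A1E.
have [Wu u00 _] := u_sol_lim; have [Lu _] := Wu.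
have LF := joined_ext_L2 T_gt0 tau_gt0 psi_L2 Lu.
have [M M0 [nuM nu_M]] := narrow_mass_bound mu_cvg.
(* This choice gives [6 * (Lambda1 ^+ 2 * m ^+ 2) = alpha0 ^+ 2 / 6], below the threshold for
   absorption. *)
pose m := alpha0 / (6 * Lambda1).
have m0 : 0 < m by rewrite divr_gt0// mulr_gt0.
have m_small : 6 * (Lambda1 ^+ 2 * m ^+ 2) <= alpha0 ^+ 2.
  have -> : 6 * (Lambda1 ^+ 2 * m ^+ 2) = alpha0 ^+ 2 / 6 by rewrite /m; field; rewrite gt_eqF.
  by rewrite ler_pdivrMr// ler_peMr ?sqr_ge0// ler1n.
have [d d0 [N1 HN1]] := narrow_no_mass_at0 mu_cvg m0 mu_Mlim.2.
have [k Tkd] : exists k : nat, T <= k%:R * d.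
  exists (Num.bound (T / d)); rewrite -ler_pdivrMr// ltW//.
  by rewrite archi_boundP// divr_ge0// ltW.
(* The constant depends on [d], through the number [k] of steps, but neither on [e] nor on [n]: [d]
   was fixed by absorption alone, before the size of the right-hand side is chosen. *)
have key : exists C : R, 0 < C /\ forall e : R, 0 < e -> \forall n \near \oo,
    [/\ (\int[lebesgue_measure]_(t in `]0%R, T[) (`|(u_ n t - u t)%R| ^+ 2)%:E <= (C * e)%:E)%E,
     (\int[lebesgue_measure]_(t in `]0%R, T[) (`|dt j T (fun t => u_ n t - u t)%R t| ^+ 2)%:E <= (C * e)%:E)%E &
     forall t, 0 <= t -> t <= T -> `|Crepr j T (u_ n) t - Crepr j T u t| ^+ 2 <= C * e].
  pose b := iter k (fun b : R => 6 / alpha0 ^+ 2 * (Lambda1 ^+ 2 * M ^+ 2 + 1) * (b + 1)) 0.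
  pose C1 := 3 / alpha0 * (Lambda1 ^+ 2 * (M ^+ 2 * b) + 1).
  pose C2 := 3 * (Lambda0 ^+ 2 * b + (Lambda1 ^+ 2 * (M ^+ 2 * b) + 1)).
  (* One constant for the three estimates, whose own constants are [b], [C2] and [C1]; the summand 1
     makes it positive. *)
  exists (1 + (`|b| + (`|C1| + `|C2|))); split; first by rewrite ltr_wpDr// !addr_ge0.
  move=> e e0; have [N2 HN2] := delay_cvg_L2 T Lambda1_gt0 A1B A1Z A1L mu_cvg LF e0.
  exists (maxn N1 N2) => // n /=; rewrite geq_max => /andP[/HN1 sm /HN2[rho rho_e gap]].
  have [Wn un0 _] := u_sol n; have [Ln _] := Wn.
  have [Lgn dn] := dt_spec Wn; have [Lgu du] := dt_spec Wu.
  have Lw0 := in_L2B Ln Lu.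
  have Ww : in_W j T (fun t => u_ n t - u t).
    split => //; exists (fun t => dt j T (u_ n) t - dt j T u t); first exact: in_L2B.
    exact: is_weak_derivativeB.
  have [Lgw dw] := dt_spec Ww.
  pose w : measurableTypeR R -> V := zext (`[0, T[%classic : set (measurableTypeR R)) (fun t => u_ n t - u t).
  pose g : measurableTypeR R -> dual V := zext (`[0, T[%classic : set (measurableTypeR R)) (dt j T (fun t => u_ n t - u t)).
  have Lw : L2fun w := in_L2_zext_left Lw0.
  have Lg : L2fun g := in_L2_zext_left Lgw.
  have [mw _] := Lw; have [mF _] := LF.
  pose W t := Crepr j T (u_ n) t - Crepr j T u t.
  have [cn aen] := Crepr_spec sepV T_gt0 Wn; have [cu aeu] := Crepr_spec sepV T_gt0 Wu.
  have cW : {within `[0, T], continuous W} by move=> t; apply: cvgB; [exact: cn|exact: cu].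
  have aeW : {ae lebesgue_measure, forall t, t \in `]0, T[ -> W t = j (u_ n t - u t)}.
    by apply: (ae_imp2 _ aen aeu) => t hn hu tI; rewrite /W hn// hu// linearB.
  have energy t : 0 <= t -> t <= T ->
      `|W t| ^+ 2 = 2 * \int[lebesgue_measure]_(r in `[0, t]) (g r (w r)).
    move=> t0 tT; rewrite -(energy_Crepr sepV T_gt0 Lw0 Lgw dw cW aeW t0 tT).
    by rewrite /W un0 u00 subrr normr0 expr0n/= subr0.
  have w_supp t : ~ `[0, T[%classic t -> w t = 0 by exact: zext0.
  have gE t : `]0, T[%classic t -> g t = dt j T (fun t => u_ n t - u t) t.
    by rewrite /= in_itv/= => /andP[t0 tT]; rewrite /g zextE//= in_itv/= ltW.
  have wE t : `]0, T[%classic t -> w t = u_ n t - u t.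
    by rewrite /= in_itv/= => /andP[t0 tT]; rewrite /w zextE//= in_itv/= ltW.
  have mD : measurable (`[0, tau]%classic : set (measurableTypeR R)) by exact: measurable_itv.
  have eqn := difference_equation sepV T_gt0 tau_gt0 Lambda1_gt0 A0B A1B A1L psi_L2 (nu_M n) nuM
    (u_sol n) u_sol_lim.
  have finw := delay_conv_fin mD (nu_M n) Lw.
  (* Taking [z = w t] and coercivity gives the dissipation inequality; arbitrary [z] and boundedness
     of [a0] give the bound on the norm of [g t]. *)
  have est : {ae lebesgue_measure, forall t, `]0, T[%classic t -> forall z,
      `|g t z + a0 (w t) z| <= (Lambda1 * delay_conv (mu_ n) `[0, tau] w t + rho t) * `|z|}.
    apply: (ae_imp2 _ (ae_imp2 (fun t => @conj _ _) eqn gap) (ae_imp2 (fun t => @conj _ _) finw finw)).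
    move=> t [eqt gapt] [ft _] tI z; rewrite gE// (eqt tI z) -A0E -/w.
    have := delay_pairing_le Lambda1_gt0 A1B A1L z mw ft.
    have := gapt z; rewrite /delay_gap -/w.
    set P := delay_pairing A1 tau (mu_ n) w t z; set Q := _ - _; set a := A0 _ _ => hQ hP.
    rewrite (_ : - a - P - Q + a = - (P + Q)); last by ring.
    by rewrite normrN (le_trans (ler_normD _ _))// mulrDl lerD.
  have diss : {ae lebesgue_measure, forall t, `]0, T[%classic t ->
      g t (w t) <= - alpha0 * `|w t| ^+ 2 + (Lambda1 * delay_conv (mu_ n) `[0, tau] w t + rho t) * `|w t|}.
    apply: (ae_imp2 _ est est) => t Ht _ tI.
    have := Ht tI (w t); rewrite ler_norml => /andP[_].
    by move=> h; rewrite mulNr [leRHS]addrC lerBrDr (le_trans _ h)// lerD2l.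
  have gle : {ae lebesgue_measure, forall t, `]0, T[%classic t ->
      `|g t| <= Lambda0 * `|w t| + (Lambda1 * delay_conv (mu_ n) `[0, tau] w t + rho t)}.
    have [_ rho0 _] := rho_e.
    apply: (ae_imp2 _ est est) => t Ht _ tI; apply: dual_norm_le => [|z].
      by rewrite !addr_ge0// mulr_ge0 ?(ltW Lambda0_gt0) ?(ltW Lambda1_gt0)// delay_conv_ge0.
    rewrite mulrDl -[g t z](addrK (a0 (w t) z)) addrC.
    by rewrite (le_trans (ler_normD _ _))// normrN lerD// Ht.
  have S1 := stability_L2 alpha0_gt0 Lambda1_gt0 M0 d0 m0 (ltW e0) (nu_M n) sm m_small Lw Lg rho_e
    w_supp energy diss Tkd.
  have S2 t := @stability_sup _ _ _ _ _ _ _ _ _ _ _ _ T_gt0 alpha0_gt0 Lambda1_gt0 M0 d0 m0 (ltW e0) (nu_M n) sm m_small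
    _ _ _ _ Lw Lg rho_e w_supp energy diss _ Tkd t.
  have S3 := stability_derivative alpha0_gt0 Lambda1_gt0 M0 d0 m0 (ltW e0) (nu_M n) sm m_small Lw Lg rho_e
    w_supp energy diss gle Tkd.
  have Cb : b * e <= (1 + (`|b| + (`|C1| + `|C2|))) * e.
    rewrite ler_wpM2r// ?(ltW e0)//; have := ler_norm b; have := normr_ge0 C1; have := normr_ge0 C2; lra.
  have CC1 : C1 * e <= (1 + (`|b| + (`|C1| + `|C2|))) * e.
    rewrite ler_wpM2r// ?(ltW e0)//; have := ler_norm C1; have := normr_ge0 b; have := normr_ge0 C2; lra.
  have CC2 : C2 * e <= (1 + (`|b| + (`|C1| + `|C2|))) * e.
    rewrite ler_wpM2r// ?(ltW e0)//; have := ler_norm C2; have := normr_ge0 C1; have := normr_ge0 b; lra.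
  split.
  - apply: (@le_trans _ _ (sqn w)); last by rewrite (le_trans S1)// lee_fin.
    have mI : measurable (`]0, T[%classic : set (measurableTypeR R)) by exact: measurable_itv.
    rewrite (@eq_integral _ _ _ lebesgue_measure _ (fun t => (`|w t| ^+ 2)%:E)).
      apply: ge0_subset_integral => //; exact: measurable_sqn.
    by move=> t; rewrite inE => tI; rewrite wE.
  - rewrite (@eq_integral _ _ _ lebesgue_measure _ (fun t => (`|g t| ^+ 2)%:E)).
      by rewrite (le_trans S3)// lee_fin.
    by move=> t; rewrite inE => tI; rewrite gE.
  - by move=> t t0 tT; rewrite (le_trans (S2 t t0 tT)).
have [C [C0 HC]] := key; split.
  apply/cvge0P => [n|e e0]; first exact: poweR_ge0.
  (* With this radius each of the two squared norms is at most [e ^+ 2 / 2], so their sum is at most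
     [e ^+ 2]. *)
  have r0 : 0 < e ^+ 2 / (2 * C) by rewrite divr_gt0 ?exprn_gt0// mulr_gt0.
  apply: filterS (HC _ r0) => n [h1 h2 _].
  have /andP[x0 xr] := L2_norm_sqr h1; have /andP[y0 yr] := L2_norm_sqr h2.
  apply: poweR_half_le => //; first exact: adde_ge0.
  apply: (le_trans (leeD xr yr)); rewrite -EFinD lee_fin le_eqVlt; apply/orP; left; apply/eqP.
  by field; rewrite gt_eqF.
apply: uniform_cvgP => e e0.
(* Here a single square is bounded by [e ^+ 2 / 2], which makes the uniform estimate strict. *)
have r0 : 0 < e ^+ 2 / (2 * C) by rewrite divr_gt0 ?exprn_gt0// mulr_gt0.
apply: filterS (HC _ r0) => n [_ _ h] t /=; rewrite in_itv/= => /andP[t0 tT].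
apply: sqr_lt_lt => //; rewrite (le_lt_trans (h t t0 tT))//.
have -> : C * (e ^+ 2 / (2 * C)) = e ^+ 2 / 2 by field; rewrite gt_eqF.
by rewrite ltr_pdivrMr// ltr_pMr ?exprn_gt0// ltr1n.
Qed.
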